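(* Let $w$ be an excursion. The marked edge of the 2-near-cubic marked-depth-map $\Phi(w)$ is the root-edge if and only if $w$ is a Kreweras walk ending at the origin. Consequently, for every $n\geq 0$, $\Phi$ (forgetting the marking, which is the root-edge) induces a bijection between Kreweras walks of size $n$ (length $3n$) ending at the origin and bridgeless 2-near-cubic depth-maps of size $n$ ($3n+1$ edges).
   Context: Words are on $\{a,b,c\}$; $|w|_\alpha$ counts occurrences of $\alpha$. An excursion is a word $w$ with every prefix $w'$ satisfying $|w'|_a+|w'|_b\leq 2|w'|_c$ and $|w|_a+|w|_b=2|w|_c$. A Kreweras walk ending at the origin is a word $w$ such that every prefix $w'$ satisfies $|w'|_a\leq|w'|_c$ and $|w'|_b\leq |w'|_c$, and $|w|_a=|w|_b=|w|_c$; it has size $|w|/3$. Maps: a planar map is a connected planar graph (loops, multiple edges allowed) embedded in the sphere up to orientation-preserving homeomorphism; edges consist of two half-edges. A rooted map has a distinguished half-edge (root); its edge is the root-edge and its endpoint the root-vertex. 2-near-cubic: root-vertex degree 2, all others degree 3; size $n$ means $3n+1$ edges. Bridgeless: no edge whose deletion disconnects the map. Given a spanning tree $T$, edges not in $T$ are external; $u$ is an ancestor of $v$ if $u$ lies on the $T$-path from root-vertex to $v$; comparable = one is ancestor of the other. A depth tree is a spanning tree such that every external edge joins comparable vertices and the root-edge is external. A depth-map is a map with a depth tree; a marked-depth-map additionally has a marked external edge. Growing maps: a rooted map with some legs (half-edges not in a complete edge), one of them the head, all legs in one face (head-face); head-vertex = endpoint of head; the root may be a leg. A tree-growing map has a distinguished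 spanning tree. The tour of the head-face follows its border counterclockwise from the head and orders the other legs, defining first and last legs. Construction of $\Phi$: $M^0_\bullet$ is one vertex with two legs, the root and the head. $\varphi_a(M_T)$ (resp. $\varphi_b$) replaces the head by a complete edge $e$ from the head-vertex to a new vertex $v$ carrying the new head and a further leg immediately at the left (resp. right) of the new head; tree becomes $T\cup\{e,v\}$. $\varphi_c(M_T)$ is defined when first and last legs exist with distinct comparable endpoints; naming them $s,t$ with endpoint of $s$ an ancestor of that of $t$, glue the head with $s$ into an edge, $t$ becomes the new head, $T$ unchanged. $\varphi_{a_1\cdots a_m}=\varphi_{a_1}\circ\cdots\circ\varphi_{a_m}$. For an excursion $w$, $\varphi_w(M^0_\bullet)$ is well defined with exactly one leg besides the head, and $\Phi(w)$ is obtained by gluing these two into a marked edge; $\Phi$ is a bijection from excursions of size $n$ to bridgeless 2-near-cubic marked-depth-maps of size $n$. *)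

(* Defs.v *)
From HB Require Import structures.
From mathcomp Require Import all_boot.
From mathcomp Require Import boolp.

Set Implicit Arguments.
Unset Strict Implicit.
Unset Printing Implicit Defensive.

(** * Words on {a, b, c} *)

Inductive letter := La | Lb | Lc.

Definition letter_code (x : letter) : option bool :=
  match x with La => Some true | Lb => Some false | Lc => None end.
Definition letter_decode (o : option bool) : letter :=
  match o with Some true => La | Some false => Lb | None => Lc end.
Lemma letter_codeK : cancel letter_code letter_decode.
Proof. by case. Qed.
HB.instance Definition _ := Equality.copy letter (can_type letter_codeK).

Definition word := seq letter.

Definition excursion (w : word) : Prop :=
  (forall w', prefix w' w ->
     count_mem La w' + count_mem Lb w' <= 2 * count_mem Lc w')
  /\ count_mem La w + count_mem Lb w = 2 * count_mem Lc w.

Definition kreweras (w : word) : Prop :=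
  [/\ forall w', prefix w' w ->
        count_mem La w' <= count_mem Lc w' /\ count_mem Lb w' <= count_mem Lc w',
      count_mem La w = count_mem Lc w
    & count_mem Lb w = count_mem Lc w].

(** * Rooted maps, possibly with legs

    A map on the sphere, up to orientation-preserving homeomorphism, is encoded
    by its half-edges (darts): [vrot d] is the next half-edge after [d] in
    counterclockwise order around the endpoint of [d], and [opp d] is the other
    half of the edge containing [d]. A leg is a fixed point of [opp]. Vertices
    are the orbits of [vrot]; every vertex carries a half-edge, since a rooted
    map is connected and has at least one half-edge. *)

Record hmap := HMap {
  dart : finType;
  vrot : dart -> dart;
  opp : dart -> dart;
  root_dart : dart }.

Definition is_leg (M : hmap) (d : dart M) : bool := opp d == d.

(* The endpoint of the half-edge [d], as the set of half-edges incident to it. *)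
Definition vertex (M : hmap) (d : dart M) : {set dart M} :=
  [set e | fconnect (@vrot M) d e].

Definition edge (M : hmap) (d : dart M) : {set dart M} := [set d; opp d].

(* Walks along the border of a face: along [d], then, on arrival, the next
   half-edge counterclockwise. At a leg this goes around the tip of the leg.
   The face lies on the right, so that, when it is drawn as the infinite face,
   the map is toured counterclockwise. *)
Definition face_next (M : hmap) (d : dart M) : dart M := vrot (opp d).

Definition face (M : hmap) (d : dart M) : {set dart M} :=
  [set e | fconnect (@face_next M) d e].

Definition vertices (M : hmap) : {set {set dart M}} := [set vertex d | d : dart M].
Definition edges (M : hmap) : {set {set dart M}} := [set edge d | d : dart M].
Definition faces (M : hmap) : {set {set dart M}} := [set face d | d : dart M].

Definition root_vertex (M : hmap) : {set dart M} := vertex (root_dart M).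
Definition root_edge (M : hmap) : {set dart M} := edge (root_dart M).

(* Sets of edges are represented by the set [S] of their half-edges. *)
Definition adjacent (M : hmap) (S : {set dart M}) (U V : {set dart M}) : bool :=
  [exists d in S, (vertex d == U) && (vertex (opp d) == V)].

(* The graph with all the vertices of [M] and the edges in [S] is connected. *)
Definition connected_by (M : hmap) (S : {set dart M}) : Prop :=
  forall d e : dart M, connect (adjacent S) (vertex d) (vertex e).

(* Planarity is Euler's relation for the connected map [M]. *)
Definition planar_map (M : hmap) : Prop :=
  [/\ injective (@vrot M),
      involutive (@opp M) /\ (forall d : dart M, ~~ is_leg d),
      connected_by [set: dart M]
    & #|vertices M| + #|faces M| = #|edges M| + 2].

Definition near_cubic2 (M : hmap) : Prop :=
  #|root_vertex M| = 2 /\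
  forall d : dart M, vertex d != root_vertex M -> #|vertex d| = 3.

Definition map_size (M : hmap) (n : nat) : Prop := #|edges M| = 3 * n + 1.

Definition bridgeless (M : hmap) : Prop :=
  forall d : dart M, connected_by (~: edge d).

(** * Spanning trees and depth-maps *)

(* A simple cycle, as the sequence of its half-edges in the direction of travel:
   distinct vertices and distinct edges (the latter matters for length 2). *)
Definition simple_cycle (M : hmap) (p : seq (dart M)) : Prop :=
  [/\ p != [::],
      cycle (fun d e : dart M => vertex (opp d) == vertex e) p,
      uniq [seq vertex d | d <- p]
    & uniq [seq edge d | d <- p]].

Definition spanning_tree (M : hmap) (T : {set dart M}) : Prop :=
  [/\ forall d : dart M, d \in T -> opp d \in T,
      connected_by T
    & forall p : seq (dart M), {subset p <= T} -> ~ simple_cycle p].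

Record tree_map := TreeMap {
  tm_map :> hmap;
  tree : {set dart tm_map} }.

(* [U] lies on the path of the tree from the root-vertex to [V]. *)
Definition ancestor (M : tree_map) (U V : {set dart M}) : Prop :=
  exists p : seq {set dart M},
    [/\ path (adjacent (tree M)) (root_vertex M) p,
        last (root_vertex M) p = V,
        uniq (root_vertex M :: p)
      & U \in root_vertex M :: p].

Definition tree_comparable (M : tree_map) (U V : {set dart M}) : Prop :=
  ancestor U V \/ ancestor V U.

Definition depth_tree (M : tree_map) : Prop :=
  [/\ spanning_tree (tree M),
      forall d : dart M, d \notin tree M -> tree_comparable (vertex d) (vertex (opp d))
    & root_dart M \notin tree M].

Definition depth_map (M : tree_map) : Prop := planar_map M /\ depth_tree M.

Record marked_map := MarkedMap {
  mm_map :> tree_map;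
  marked_edge : {set dart mm_map} }.

Definition marked_depth_map (M : marked_map) : Prop :=
  depth_map M /\ exists2 d : dart M, d \notin tree M & marked_edge M = edge d.

(* Equality of rooted maps with a distinguished spanning tree, the sphere being
   considered up to orientation-preserving homeomorphism. *)
Definition tree_map_iso (M N : tree_map) : Prop :=
  exists f : dart M -> dart N,
    [/\ bijective f,
        forall d, f (vrot d) = vrot (f d),
        forall d, f (opp d) = opp (f d),
        f (root_dart M) = root_dart N
      & forall d, (f d \in tree N) = (d \in tree M)].

(** * Growing maps and the mappings phi *)

Record growing_map := GrowingMap {
  gm_map :> tree_map;
  head_leg : dart gm_map }.

(* Legs other than the head, in the order of the tour of the head-face. *)
Definition tour_legs (M : growing_map) : seq (dart M) :=
  [seq d <- behead (orbit (@face_next M) (head_leg M)) | is_leg d].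

Definition init_map : growing_map :=
  @GrowingMap
    (@TreeMap (@HMap bool negb id false) set0)
    true.

(* The half-edges at the vertex created by phi_a and phi_b: [NStem] belongs to
   the new edge, [NHead] is the new head, [NLeg] is the further leg. *)
Inductive new_dart := NStem | NHead | NLeg.

Definition new_dart_code (x : new_dart) : option bool :=
  match x with NStem => None | NHead => Some true | NLeg => Some false end.
Definition new_dart_decode (o : option bool) : new_dart :=
  match o with None => NStem | Some true => NHead | Some false => NLeg end.
Lemma new_dart_codeK : cancel new_dart_code new_dart_decode.
Proof. by case. Qed.
HB.instance Definition _ := Finite.copy new_dart (can_type new_dart_codeK).

(* Counterclockwise order around the new vertex: a leg immediately at the left
   of the head follows the head, a leg immediately at its right precedes it. *)
Definition rot_left (x : new_dart) : new_dart :=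
  match x with NStem => NHead | NHead => NLeg | NLeg => NStem end.
Definition rot_right (x : new_dart) : new_dart :=
  match x with NStem => NLeg | NLeg => NHead | NHead => NStem end.

Definition grow_rot (D : Type) (r : D -> D) (r' : new_dart -> new_dart)
    (x : D + new_dart) : D + new_dart :=
  match x with inl d => inl (r d) | inr y => inr (r' y) end.

Definition grow_opp (D : eqType) (o : D -> D) (h : D)
    (x : D + new_dart) : D + new_dart :=
  match x with
  | inl d => if d == h then inr NStem else inl (o d)
  | inr NStem => inl h
  | inr y => inr y
  end.

Definition grow (r' : new_dart -> new_dart) (M : growing_map) : growing_map :=
  let D := (dart M + new_dart)%type : finType in
  @GrowingMap
    (@TreeMap
      (@HMap D (grow_rot (@vrot M) r') (grow_opp (@opp M) (head_leg M)) (inl (root_dart M)))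
      ([set inl d | d in tree M] :|: [set inl (head_leg M); inr NStem]))
    (inr NHead).

Definition phi_a : growing_map -> growing_map := grow rot_left.
Definition phi_b : growing_map -> growing_map := grow rot_right.

Definition glue_opp (D : eqType) (o : D -> D) (h s : D) (d : D) : D :=
  if d == h then s else if d == s then h else o d.

(* [M] with its head and its leg [s] glued into a complete edge. *)
Definition glue (M : growing_map) (s : dart M) : tree_map :=
  @TreeMap
    (@HMap (dart M) (@vrot M) (glue_opp (@opp M) (head_leg M) s) (root_dart M))
    (tree M).

Definition glue_and_move (M : growing_map) (s t : dart M) : growing_map :=
  @GrowingMap (glue s) t.

Definition phi_c (M : growing_map) : option growing_map :=
  if tour_legs M is l1 :: l then
    let l2 := last l1 l in
    if vertex l1 == vertex l2 then None
    else if `[< ancestor (vertex l1) (vertex l2) >] then Some (glue_and_move l1 l2)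
    else if `[< ancestor (vertex l2) (vertex l1) >] then Some (glue_and_move l2 l1)
    else None
  else None.

Definition phi (x : letter) (M : growing_map) : option growing_map :=
  match x with
  | La => Some (phi_a M)
  | Lb => Some (phi_b M)
  | Lc => phi_c M
  end.

(* The composite of the [phi x]: the last letter of [w] acts first. *)
Definition phi_word (w : word) (M : growing_map) : option growing_map :=
  foldr (fun x oM => obind (phi x) oM) (Some M) w.

Definition close (M : growing_map) : option marked_map :=
  if tour_legs M is [:: s]
  then Some (@MarkedMap (glue s) [set head_leg M; s])
  else None.

(* [None] when some step is undefined, or when the final growing map does not
   have exactly one leg besides the head. *)
Definition Phi (w : word) : option marked_map :=
  obind close (phi_word w init_map).

(* Main.v *)
Require Import Defs.
From mathcomp Require Import fingroup perm boolp zify.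
From mathcomp Require Import all_boot.

Set Implicit Arguments.
Unset Strict Implicit.
Unset Printing Implicit Defensive.

(** The legs of a growing map, read along the tour of the head-face, form a deque:
    [phi_a] and [phi_b] push a leg at its front and at its back, and [phi_c]
    removes both ends. All legs hang from ancestors of the head-vertex, and their
    depths first decrease and then increase along the tour, so that [phi_c] is
    defined as long as two legs remain and preserves this shape. The root stays
    in the deque, between the legs pushed at the front and those pushed at the
    back, as long as neither end is exhausted, which is the Kreweras condition.

    For the bijection, the growth is undone inside a fixed depth-map [N], a state
    being a set of cut edges and a head. If the head-vertex [v] carries a second
    leg, the last letter was [a] or [b]. Otherwise it was [c], and the edge to cut
    leads from the subtree of [v] to a proper ancestor of [v]. The edges leaving
    that subtree form a bond, so by planarity a face contains at most one
    half-edge going out of the subtree and at most one coming in; the stem of [v]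
    lies on the head-face, and since it is not a bridge there is exactly one other
    such edge on the head-face. Hence a state determines the last letter and the
    previous state, which gives injectivity and surjectivity at once. *)

(** * Orbits and connected components *)

Section Orbits.

Variable T : finType.
Implicit Types (e : rel T) (f g : T -> T) (x y z : T).

(** Planarity is only given through Euler's relation, so the one topological fact needed, that the
    two sides of a non-bridge lie in different faces, must come from counting. Cutting an edge
    multiplies the edge and face permutations by a transposition, and the genus can only drop; it is
    0 for [N] itself and when all edges are cut, hence at every stage in between. Ancestors are
    defined by the existence of simple tree paths, which is awkward to update. The relation is
    replaced by a certificate, an order with a stem at each vertex, which a growth step extends
    explicitly and which can be extracted from any spanning tree. The theorem identifies maps up to
    isomorphism. Undoing letters inside one fixed map [N] avoids building smaller maps and comparing
    them: a stage is a subset of the half-edges of [N], a growing map is compared with it through an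
    injection, and two words with isomorphic images become two embeddings into the same [N]. *)

Definition nclasses e := #|[set [set y | connect e x y] | x : T]|.

Lemma fconnect_ind f (P : T -> Prop) x y :
  P x -> (forall z, fconnect f x z -> P z -> P (f z)) -> fconnect f x y -> P y.
Proof.
move=> Px IH /iter_findex <-; elim: (findex f x y) => //= n.
by apply: IH; apply: fconnect_iter.
Qed.

Lemma fconnect_exit f (B : pred T) x y :
  fconnect f x y -> B x -> ~~ B y ->
  exists z, [/\ fconnect f x z, B z & ~~ B (f z)].
Proof.
move=> xy Bx nBy.
case: (boolP [exists z, [&& fconnect f x z, B z & ~~ B (f z)]]).
  by case/existsP=> z /and3P[]; exists z.
move/existsPn=> noex; case/negP: nBy.
apply: (fconnect_ind (P := B) _ _ xy) => // z xz Bz.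
by move: (noex z); rewrite xz Bz /= negbK.
Qed.

Lemma connect_ind e (P : T -> Prop) x y :
  P x -> (forall z z', P z -> e z z' -> P z') -> connect e x y -> P y.
Proof.
move=> Px IH /connectP[p ep ->]; elim: p x Px ep => //= z p IHp x Px /andP[exz ep].
by apply: IHp ep; apply: IH exz.
Qed.

(** Pointwise form of [g = f \o tperm x y]. Cutting or gluing an edge changes the edge and face
    permutations in exactly this way. *)
Definition swap_of f g x y :=
  [/\ g x = f y, g y = f x & forall z, z != x -> z != y -> g z = f z].

Lemma nclasses_porbits f (inj_f : injective f) :
  nclasses (frel f) = #|porbits (perm inj_f)|.
Proof.
rewrite /porbits; congr #|pred_of_set _|; apply: eq_imset => x.
apply/setP=> y; rewrite inE; apply/idP/porbitP => [/iter_findex <-|[i ->]].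
  exists (findex f x y); rewrite permX; apply: eq_iter => z.
  by rewrite permE.
rewrite permX (@eq_iter _ _ f) ?fconnect_iter // => z.
by rewrite permE.
Qed.

(** A transposition splits the cycle containing both points or merges their two cycles; the doubled
    boolean puts both cases into one equation without subtraction. *)
Lemma nclasses_swap f g x y : injective f -> x != y -> swap_of f g x y ->
  nclasses (frel g) + (~~ fconnect f x y).*2 = nclasses (frel f) + 1.
Proof.
move=> inj_f xy [gx gy gz].
have g_tperm z : g z = f (tperm x y z).
  by case: tpermP => [->|->|/eqP zx /eqP zy] //; apply: gz.
have inj_g : injective g by move=> a b; rewrite !g_tperm => /inj_f/perm_inj.
have := porbits_mul_tperm (perm inj_f) x y; rewrite /= xy.
rewrite (nclasses_porbits inj_f) (nclasses_porbits inj_g).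
have -> : (tperm x y * perm inj_f)%g = perm inj_g.
  by apply/perm.permP=> z; rewrite permM 2!permE g_tperm.
suff -> : (x \in porbit (perm inj_f) y) = fconnect f x y by [].
rewrite porbit_sym; apply/porbitP/idP => [[i ->]|/iter_findex <-].
  rewrite permX (@eq_iter _ _ f) ?fconnect_iter // => z.
  by rewrite permE.
exists (findex f x y); rewrite permX; apply: eq_iter => z.
by rewrite permE.
Qed.

(* Walking along [g] from [x] one follows the [f]-orbit of [y] up to [y] itself. *)
Lemma fconnect_swap f g x y : injective f -> swap_of f g x y ->
  ~~ fconnect f x y -> fconnect g x y.
Proof.
move=> inj_f [gx gy gz] nxy.
have to_y n z : iter n f z = y -> fconnect f y z -> fconnect g z y.
  elim: n z => [|n IHn] z /=; first by move=> ->.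
  case: (eqVneq z y) => [-> //|zy]; rewrite -iterS iterSr => fz yz.
  have zx : z != x.
    by apply: contraNneq nxy => <-; rewrite (fconnect_sym inj_f).
  apply: connect_trans (fconnect1 g z) _; rewrite gz //.
  by apply: IHn => //; apply: connect_trans yz (fconnect1 f z).
apply: connect_trans (fconnect1 g x) _; rewrite gx.
have yf : fconnect f (f y) y by rewrite (fconnect_sym inj_f) fconnect1.
by apply: (to_y _ _ (iter_findex yf)); rewrite (fconnect_sym inj_f).
Qed.

Lemma swap_of_inj f g x y : injective f -> swap_of f g x y -> injective g.
Proof.
move=> inj_f [gx gy gz].
have g_tperm z : g z = f (tperm x y z).
  by case: tpermP => [->|->|/eqP zx /eqP zy] //; apply: gz.
by move=> a b; rewrite !g_tperm => /inj_f/perm_inj.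
Qed.

(** Merging two cycles loses no connection: the steps of [f] out of [x] and [y] are recovered by
    first going along [g] from one of these points to the other. *)
Lemma fconnect_merge f g x y z z' : injective f -> swap_of f g x y ->
  ~~ fconnect f x y -> fconnect f z z' -> fconnect g z z'.
Proof.
move=> inj_f sw nxy zz'; have inj_g := swap_of_inj inj_f sw.
have xy : fconnect g x y by apply: fconnect_swap nxy.
apply: (fconnect_ind (P := fconnect g z) _ _ zz') => // u _ zu.
apply: connect_trans zu _; case: sw => [gx gy gz].
have yx : fconnect g y x by rewrite (fconnect_sym inj_g).
case: (eqVneq u x) => [->|ux].
  by apply: connect_trans xy _; rewrite -gy fconnect1.
case: (eqVneq u y) => [->|uy].
  by apply: connect_trans yx _; rewrite -gx fconnect1.
by rewrite -gz // fconnect1.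
Qed.

Lemma nclassesE e : connect_sym e -> nclasses e = n_comp e T.
Proof.
move=> sym_e; rewrite /nclasses.
have -> : [set [set y | connect e x y] | x : T] =
          [set [set y | connect e x y] | x in [set x | roots e x]].
  apply/setP=> C; apply/imsetP/imsetP => [[x _ ->]|[x _ ->]]; last by exists x.
  exists (fingraph.root e x); first by rewrite inE roots_root.
  apply/setP=> y; rewrite !inE; apply: (same_connect sym_e).
  exact: connect_root.
rewrite card_in_imset; first by rewrite cardsE; apply: eq_card => x; rewrite !inE andbT.
move=> x y; rewrite !inE => /eqP rx /eqP ry /setP/(_ y).
by rewrite !inE connect0 => /(rootP sym_e); rewrite rx ry.
Qed.

(** Here [e] plays the part of [e'] with an edge between [x] and [y] removed. Apart from the
    [e]-root of [y], the [e]-roots have distinct [e']-roots, since [e'] can only join the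
    [e]-components of [x] and [y]. *)
Lemma n_comp_add_edge e e' x y : connect_sym e -> connect_sym e' ->
  (forall z z', e' z z' -> connect e z z' \/
     (connect e z x || connect e z y) && (connect e z' x || connect e z' y)) ->
  n_comp e T <= (n_comp e' T).+1.
Proof.
move=> se se' ee'.
pose C z := connect e z x || connect e z y.
have C_e z z' : connect e z z' -> C z -> C z'.
  by move=> zz'; rewrite /C !(same_connect se zz').
have cee' z z' : connect e' z z' -> connect e z z' \/ C z && C z'.
  apply: (connect_ind (P := fun u => connect e z u \/ C z && C u)); first by left.
  move=> u u' [zu|/andP[Cz Cu]] /ee' [uu'|/andP[Du Du']].
  - by left; apply: connect_trans uu'.
  - by right; rewrite [C u']Du' (C_e u z) // se.
  - by right; rewrite Cz (C_e u).
  - by right; rewrite Cz [C u']Du'.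
rewrite /n_comp_mem (cardD1 (fingraph.root e y)).
apply: (@leq_trans (1 + #|[predD1 predI (roots e) T & fingraph.root e y]|)).
  by rewrite leq_add2r leq_b1.
rewrite add1n ltnS.
have inj : {in [predD1 predI (roots e) T & fingraph.root e y] &, injective (fingraph.root e')}.
  move=> z z'; rewrite !inE !andbT => /andP[zy /eqP rz] /andP[z'y /eqP rz'].
  move=> /(rootP se') /cee' [/(rootP se)|]; first by rewrite rz rz'.
  have ny u : fingraph.root e u = u -> u != fingraph.root e y -> connect e u y = false.
    by move=> ru; rewrite -{1}ru root_connect // => /negbTE.
  rewrite /C !ny // !orbF => /andP[/(rootP se) zx /(rootP se) z'x].
  by rewrite -rz -rz' zx z'x.
rewrite -(card_in_image inj); apply: subset_leq_card.
by apply/subsetP=> u /imageP[z _ ->]; rewrite !inE roots_root.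
Qed.

Lemma orbit_fcycle f x s : fcycle f (x :: s) -> uniq (x :: s) -> orbit f x = x :: s.
Proof.
move=> cyc un; rewrite (orbitE cyc un) ?mem_head //=.
by rewrite eqxx rot0.
Qed.

End Orbits.

(** * Maps cut along a set of edges *)

Section Cut.

Variable N : hmap.
Notation D := (dart N).
Implicit Types (L : {set D}) (d x y : D).

(** A cut edge leaves its two half-edges as legs, so all stages live on the same type of
    half-edges. *)
Definition cut_opp L d := if d \in L then d else opp d.
Definition cut_face L d := vrot (cut_opp L d).
Definition cut_rel L : rel D := fun x y => (vrot x == y) || (cut_opp L x == y).

Definition opp_closed L := forall d, (opp d \in L) = (d \in L).

Hypothesis vrot_inj : injective (@vrot N).
Hypothesis oppK : involutive (@opp N).
Hypothesis opp_neq : forall d, opp d != d.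

Lemma edgeC d : edge (opp d) = edge d.
Proof. by rewrite /edge oppK setUC. Qed.

Lemma in_edge d x : (x \in edge d) = (x == d) || (x == opp d).
Proof. by rewrite !inE. Qed.

Lemma opp_eq d x : (opp x == d) = (x == opp d).
Proof. by rewrite (can2_eq oppK oppK). Qed.

Lemma edge_sym d x : (x \in edge d) = (d \in edge x).
Proof. by rewrite !in_edge eq_sym -opp_eq [opp x == d]eq_sym. Qed.

Lemma card_edges : #|D| = #|edges N| * 2.
Proof.
rewrite -cardsT; apply: card_uniform_partition => [A /imsetP[d _ ->]|].
  by rewrite /edge cards2 eq_sym opp_neq.
apply/and3P; split.
- rewrite eqEsubset subsetT /=; apply/subsetP=> d _.
  by apply/bigcupP; exists (edge d); rewrite ?imset_f // in_edge eqxx.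
- apply/trivIsetP=> A B /imsetP[d _ ->] /imsetP[e _ ->]; apply: contraNT.
  case/pred0Pn=> x /andP[/=]; rewrite !in_edge.
  by move=> /orP[]/eqP-> /orP[]/eqP e1; [rewrite e1|rewrite e1 edgeC
    |rewrite -e1 edgeC|rewrite -(edgeC d) e1 edgeC].
- by apply/imsetP=> -[d _ /setP/(_ d)]; rewrite inE in_edge eqxx.
Qed.

Lemma opp_closedU L d : opp_closed L -> opp_closed (L :|: edge d).
Proof.
by move=> cL x; rewrite !inE cL !opp_eq oppK [(_ == opp d) || _]orbC.
Qed.

Lemma cut_oppK L : opp_closed L -> involutive (cut_opp L).
Proof.
move=> cL d; rewrite /cut_opp; case: (boolP (d \in L)) => [->//|dL].
by rewrite cL (negbTE dL) oppK.
Qed.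

Lemma cut_face_inj L : opp_closed L -> injective (cut_face L).
Proof. by move=> cL x y /vrot_inj /(inv_inj (cut_oppK cL)). Qed.

Lemma cut_rel_sym L : opp_closed L -> connect_sym (cut_rel L).
Proof.
move=> cL x y; suff imp u v : connect (cut_rel L) u v -> connect (cut_rel L) v u.
  by apply/idP/idP; apply: imp.
apply: (connect_ind (P := (fun v => connect (cut_rel L) v u))) => // z z' zu.
case/orP=> /eqP <-.
  apply: connect_trans zu.
  have : fconnect (@vrot N) (vrot z) z by rewrite fconnect_sym // fconnect1.
  by apply: connect_sub => a b /eqP <-; apply: connect1; rewrite /cut_rel eqxx.
apply: connect_trans zu; apply: connect1.
by rewrite /cut_rel cut_oppK // eqxx orbT.
Qed.

Lemma connect_cut_vrot L x y : fconnect (@vrot N) x y -> connect (cut_rel L) x y.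
Proof. by apply: connect_sub => a b /eqP <-; apply: connect1; rewrite /cut_rel eqxx. Qed.

Lemma connect_cut_opp L x : x \notin L -> connect (cut_rel L) x (opp x).
Proof. by move=> /negbTE xL; apply: connect1; rewrite /cut_rel /cut_opp xL eqxx orbT. Qed.

Lemma connect_cutW L L' x y : L \subset L' ->
  connect (cut_rel L') x y -> connect (cut_rel L) x y.
Proof.
move=> sLL'; apply: connect_sub => a b; rewrite /cut_rel /cut_opp => /orP[/eqP<-|].
  by rewrite connect1 // eqxx.
case: ifP => [_ /eqP<- //|aL' /eqP <-].
apply: connect_cut_opp; apply: contraFN aL'; exact: (subsetP sLL').
Qed.

Lemma cut_opp_swap L d : opp_closed L -> d \notin L ->
  swap_of (cut_opp L) (cut_opp (L :|: edge d)) d (opp d).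
Proof.
move=> cL dL; rewrite /cut_opp; split=> [||z zd zod]; rewrite !inE.
- by rewrite eqxx /= orbT cL (negbTE dL) oppK.
- by rewrite eqxx !orbT (negbTE dL).
- by rewrite (negbTE zd) (negbTE zod) !orbF.
Qed.

Lemma cut_face_swap L d : opp_closed L -> d \notin L ->
  swap_of (cut_face L) (cut_face (L :|: edge d)) d (opp d).
Proof.
move=> cL dL; have [e1 e2 e3] := cut_opp_swap cL dL.
by split=> [||z zd zod]; rewrite /cut_face ?e1 ?e2 ?e3.
Qed.

(** * Genus of a cut map *)

Definition ncomp L := n_comp (cut_rel L) D.
(** Legs count as edges here, being fixed points of [cut_opp]. The sum of the three cycle counts is
    [#|D| + 2 * ncomp L] minus twice the total genus. *)
Definition euler L :=
  nclasses (frel (@vrot N)) + nclasses (frel (cut_opp L)) + nclasses (frel (cut_face L)).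

(* The quantity [2 * ncomp - euler], i.e. twice the genus up to a constant, grows
   when an edge is added, by 2 if both sides of the edge then lie in one face
   although its ends were already connected. *)
Lemma euler_step L d : opp_closed L -> d \notin L ->
  2 * ncomp (L :|: edge d) + euler L <= 2 * ncomp L + euler (L :|: edge d) /\
  (connect (cut_rel (L :|: edge d)) d (opp d) -> fconnect (cut_face L) d (opp d) ->
   2 * ncomp (L :|: edge d) + euler L + 2 <= 2 * ncomp L + euler (L :|: edge d)).
Proof.
move=> cL dL; have cL' := opp_closedU d cL; set L' := L :|: edge d.
have dod : d != opp d by rewrite eq_sym.
have inj_o := inv_inj (cut_oppK cL).
have := nclasses_swap inj_o dod (cut_opp_swap cL dL).
have := nclasses_swap (@cut_face_inj _ cL) dod (cut_face_swap cL dL).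
have -> : fconnect (cut_opp L) d (opp d).
  by have := fconnect1 (cut_opp L) d; rewrite {2}/cut_opp (negbTE dL).
rewrite /= -/L' /euler.
have sub_conn x y : connect (cut_rel L') x y -> connect (cut_rel L) x y.
  by apply: connect_cutW; apply: subsetUl.
have [con|ncon] := boolP (connect (cut_rel L') d (opp d)).
  have eqk : ncomp L = ncomp L'.
    apply: eq_n_comp => x y; apply/idP/idP; last exact: sub_conn.
    apply: connect_sub => a b; rewrite /cut_rel /cut_opp => /orP[/eqP<-|].
      by rewrite connect1 // eqxx.
    case: ifP => [_ /eqP<- //|aL /eqP <-].
    case: (boolP (a \in edge d)); rewrite in_edge; last first.
      by move=> ad; apply: connect_cut_opp; rewrite !inE aL.
    by case/orP=> /eqP-> //; rewrite oppK (cut_rel_sym cL').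
  rewrite eqk; case: (fconnect _ _ _) => /=; lia.
(* A face lies in one component, so after a separating cut [d] and [opp d] are in different faces;
   gluing them back merges these faces. *)
have fd : fconnect (cut_face L) d (opp d).
  have sw : swap_of (cut_face L') (cut_face L) d (opp d).
    by case: (cut_face_swap cL dL) => e1 e2 e3; split=> // z zd zo; rewrite e3.
  apply: fconnect_swap sw _; first exact: cut_face_inj.
  apply: contraNN ncon; apply: connect_sub => a b /eqP <-; rewrite /cut_face.
  by apply: (@connect_trans _ _ (cut_opp L' a)); apply: connect1; rewrite /cut_rel eqxx ?orbT.
have le_k : ncomp L' <= (ncomp L).+1.
  apply: (n_comp_add_edge (x := d) (y := opp d) (cut_rel_sym cL') (cut_rel_sym cL)).
  move=> a b /orP[/eqP<-|]; first by left; apply: connect1; rewrite /cut_rel eqxx.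
  case: (boolP (a \in edge d)); rewrite in_edge => ad.
    rewrite /cut_opp; case: ifP => [_ /eqP<-|_ /eqP<-]; first by left.
    by right; case/orP: ad => /eqP->; rewrite ?oppK !connect0 ?orbT.
  move=> eb; left; apply: connect1; apply/orP; right.
  by move: eb; rewrite /cut_opp inE in_edge (negbTE ad) orbF.
rewrite fd /=; split; lia.
Qed.

Lemma euler_sub L L' : opp_closed L -> opp_closed L' -> L \subset L' ->
  2 * ncomp L' + euler L <= 2 * ncomp L + euler L'.
Proof.
move=> cL cL'; have [n] := ubnP #|L' :\: L|; elim: n L cL => // n IHn L cL.
rewrite ltnS => le_n sLL'; have [sub|] := boolP (L' \subset L).
  by have -> : L = L' by apply/eqP; rewrite eqEsubset sLL'.
case/subsetPn=> d dL' dL; have [step _] := euler_step cL dL.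
have sU : L :|: edge d \subset L'.
  by rewrite subUset sLL' /=; apply/subsetP=> x; rewrite in_edge => /orP[]/eqP->; rewrite ?cL'.
have := IHn _ (opp_closedU d cL) _ sU.
have : #|L' :\: (L :|: edge d)| < n.
  apply: leq_trans le_n; apply: proper_card; apply/properP; split.
    by apply: setDS; apply: subsetUl.
  by exists d; rewrite !inE ?eqxx ?dL ?dL' ?orbT.
move=> lt /(_ lt); lia.
Qed.

(** With every edge cut, each component is a single vertex with a single face, of genus 0. *)
Lemma euler_setT : euler [set: D] = 2 * ncomp [set: D] + #|D|.
Proof.
rewrite /euler.
have e1 : cut_opp [set: D] =1 id by move=> d; rewrite /cut_opp inE.
have -> : nclasses (frel (cut_opp [set: D])) = #|D|.
  rewrite nclassesE; last by apply: fconnect_sym; apply: inv_inj => d; rewrite !e1.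
  by rewrite (eq_fcard e1) fcard_id; apply: eq_card.
have e2 : connect (frel (cut_face [set: D])) =2 fconnect (@vrot N).
  by apply: eq_connect => x y /=; rewrite /cut_face e1.
have e3 : connect (cut_rel [set: D]) =2 fconnect (@vrot N).
  move=> x y; apply/idP/idP; last exact: connect_cut_vrot.
  apply: connect_sub => a b; rewrite /cut_rel e1 => /orP[/eqP<-|/eqP<- //].
  exact: fconnect1.
have sv : connect_sym (frel (@vrot N)) by apply: fconnect_sym.
rewrite !nclassesE //; last by apply: fconnect_sym => x y; rewrite /cut_face !e1 => /vrot_inj.
by rewrite /ncomp (eq_n_comp e2) (eq_n_comp e3); lia.
Qed.

(** * Separation in planar maps *)

Hypothesis planar : #|vertices N| + #|faces N| = #|edges N| + 2.
Hypothesis connected : forall x y, connect (cut_rel set0) x y.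

Lemma euler_set0 : euler set0 = #|D| + 2 * ncomp set0.
Proof.
have c0 : opp_closed set0 by move=> d; rewrite !inE.
have e0 : cut_opp set0 =1 @opp N by move=> d; rewrite /cut_opp inE.
have fe d : [set y | fconnect (cut_opp set0) d y] = edge d.
  apply/setP=> y; rewrite inE in_edge (eq_fconnect e0).
  have cyc : fcycle (@opp N) [:: d; opp d] by rewrite /= oppK !eqxx.
  have un : uniq [:: d; opp d] by rewrite /= inE eq_sym opp_neq.
  by rewrite (fconnect_cycle cyc) ?inE // eqxx.
have ee : nclasses (frel (cut_opp set0)) = #|edges N|.
  by congr #|pred_of_set _|; apply: eq_imset.
have ef : nclasses (frel (cut_face set0)) = #|faces N|.
  congr #|pred_of_set _|; apply: eq_imset => d; apply/setP=> y; rewrite !inE.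
  by apply: eq_fconnect => x; rewrite /cut_face e0.
have e2 := card_edges.
(* Without half-edges Euler's relation would read [0 = 2]. *)
have [d0|noD] := pickP D; last first.
  have D0 : #|D| = 0 by apply: eq_card0.
  have eD (f : D -> D) : nclasses (frel f) = 0.
    by apply: eq_card0 => C; apply/imsetP=> -[x]; move: (noD x); rewrite inE.
  have := planar; rewrite -ee -ef !eD.
  have -> : #|vertices N| = 0; last lia.
  by apply: eq_card0 => C; apply/imsetP=> -[x]; move: (noD x); rewrite inE.
have k1 : ncomp set0 = 1.
  rewrite /ncomp -(n_comp_connect (cut_rel_sym c0) d0); apply: eq_n_comp_r => x.
  by rewrite !inE; apply/esym/connected.
rewrite k1 /euler ee ef; have -> : nclasses (frel (@vrot N)) = #|vertices N| by [].
lia.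
Qed.

(** A combinatorial Jordan theorem: the genus is 0 at [set0] and at [setT] and monotone in between,
    which leaves no room for the jump by 2 in [euler_step]. *)
Lemma sides_disconnected L d : opp_closed L -> d \notin L ->
  connect (cut_rel (L :|: edge d)) d (opp d) -> ~~ fconnect (cut_face L) d (opp d).
Proof.
move=> cL dL con; apply/negP=> fd.
have [_ /(_ con fd)] := euler_step cL dL.
have c0 : opp_closed set0 by move=> x; rewrite !inE.
have cT : opp_closed [set: D] by move=> x; rewrite !inE.
have := euler_sub c0 cL (sub0set L).
have := euler_sub (opp_closedU d cL) cT (subsetT _).
by rewrite euler_setT euler_set0; lia.
Qed.

(* Cutting the crossing edges other than those of [d1] and [d2] merges faces, so
   that [d1] and [d2] stay in one face; that face must come back to the side of
   [d2], which it can only do through [opp d1] or [opp d2]. *)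
Lemma bond_face L (B : pred D) d1 d2 : opp_closed L ->
  (forall d, B (vrot d) = B d) ->
  (forall x y, x \notin L -> y \notin L -> B x = B y ->
     connect (cut_rel (L :|: [set d | B d != B (opp d)])) x y) ->
  d1 \notin L -> B d1 -> ~~ B (opp d1) -> d2 \notin L -> B d2 -> ~~ B (opp d2) ->
  fconnect (cut_face L) d1 d2 -> d1 = d2.
Proof.
move=> cL Brot; set X := [set d | _].
have oX d : (opp d \in X) = (d \in X) by rewrite !inE oppK eq_sym.
have [n] := ubnP #|X :\: (L :|: edge d1 :|: edge d2)|.
elim: n L cL => // n IHn L cL; rewrite ltnS => le_n con d1L Bd1 nBd1 d2L Bd2 nBd2 f12.
apply/eqP/negPn/negP=> d12.
(* No crossing edge is a bridge as long as another one remains: the ends of [d'] stay joined through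
   [d], both sides being connected. *)
have crossing d : d \notin L -> B d -> ~~ B (opp d) ->
    forall d', d' \notin L -> d' \in X -> d \notin edge d' ->
    connect (cut_rel (L :|: edge d')) d' (opp d').
  move=> dL Bd nBd d' d'L d'X dd'.
  have cU := opp_closedU d' cL.
  have sU : L :|: edge d' \subset L :|: X.
    apply: setUS; apply/subsetP=> x; rewrite in_edge => /orP[]/eqP-> //.
    by rewrite oX.
  have cW x y : x \notin L -> y \notin L -> B x = B y ->
      connect (cut_rel (L :|: edge d')) x y.
    by move=> xL yL Bxy; apply: connect_cutW sU _; apply: con.
  have dd : connect (cut_rel (L :|: edge d')) d (opp d).
    by apply: connect_cut_opp; rewrite in_setU negb_or dL.
  have d'oL : opp d' \notin L by rewrite cL.
  have doL : opp d \notin L by rewrite cL.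
  move: d'X; rewrite inE; case Bd': (B d'); case Bod': (B (opp d')) => // _.
    apply: connect_trans (cW d' d d'L dL _) _; first by rewrite Bd' Bd.
    apply: connect_trans dd _; apply: cW => //.
    by rewrite Bod' (negbTE nBd).
  apply: connect_trans (cW d' (opp d) d'L doL _) _; first by rewrite Bd' (negbTE nBd).
  rewrite (cut_rel_sym cU) in dd; apply: connect_trans dd _; apply: cW => //.
  by rewrite Bod' Bd.
have cross B' d : B d = B' -> B (opp d) = ~~ B' -> d \in X.
  by rewrite inE => -> ->; case: B'.
have d1X : d1 \in X by apply: (cross true); rewrite // (negbTE nBd1).
have d2X : d2 \in X by apply: (cross true); rewrite // (negbTE nBd2).
have d2d1 : d2 \notin edge d1.
  rewrite in_edge negb_or eq_sym d12; apply: contraNneq nBd1 => <-; exact: Bd2.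
have d1d2 : d1 \notin edge d2.
  rewrite in_edge negb_or d12; apply: contraNneq nBd2 => <-; exact: Bd1.
have [sub|] := boolP (X \subset L :|: edge d1 :|: edge d2); last first.
  case/subsetPn=> d dX; rewrite 2!in_setU 2!negb_or => /andP[/andP[dL dd1] dd2].
  have d1d : d1 \notin edge d.
    by rewrite edge_sym.
  have d2d : d2 \notin edge d.
    by rewrite edge_sym.
  have nf := sides_disconnected cL dL (crossing d1 d1L Bd1 nBd1 d dL dX d1d).
  have f12u := fconnect_merge (@cut_face_inj _ cL) (cut_face_swap cL dL) nf f12.
  case/eqP: d12; apply: (IHn (L :|: edge d)) => //.
  - exact: opp_closedU.
  - apply: leq_trans le_n; apply: proper_card; apply/properP; split.
      by apply: setDS; do 2!apply: setSU; apply: subsetUl.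
    exists d; first by rewrite in_setD dX 2!in_setU (negbTE dL) (negbTE dd1) (negbTE dd2).
    by rewrite !inE eqxx !orbT.
  - move=> x y; rewrite in_setU negb_or => /andP[xL _].
    rewrite in_setU negb_or => /andP[yL _] Bxy.
    have -> : L :|: edge d :|: X = L :|: X.
      rewrite -setUA; congr (_ :|: _); apply/setUidPr/subsetP=> z.
      by rewrite in_edge => /orP[]/eqP->; rewrite ?oX.
    exact: con.
  - by rewrite in_setU negb_or d1L.
  - by rewrite in_setU negb_or d2L.
have n1 := sides_disconnected cL d1L (crossing d2 d2L Bd2 nBd2 d1 d1L d1X d2d1).
have n2 := sides_disconnected cL d2L (crossing d1 d1L Bd1 nBd1 d2 d2L d2X d1d2).
have f1 : cut_face L d1 = vrot (opp d1) by rewrite /cut_face /cut_opp (negbTE d1L).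
have inj_f := @cut_face_inj _ cL.
have f12' : fconnect (cut_face L) (cut_face L d1) d2.
  by rewrite -(same_fconnect1 inj_f).
have [||z [fz nBz]] := fconnect_exit (B := fun z => ~~ B z) f12'.
- by rewrite /= f1 Brot.
- by rewrite /= Bd2.
rewrite /cut_face Brot /cut_opp negbK; case: ifP => [_ Bz|zL Boz]; first by rewrite Bz in nBz.
have zX : z \in X by apply: (cross false); [exact: negbTE|].
have f1z : fconnect (cut_face L) d1 z.
  by apply: connect_trans (fconnect1 _ _) fz.
have : z \in L :|: edge d1 :|: edge d2 by apply: (subsetP sub).
rewrite !inE zL /= -orbA => /or4P[]/eqP ez; subst z.
- by rewrite Bd1 in nBz.
- by rewrite f1z in n1.
- by rewrite Bd2 in nBz.
- by case/negP: n2; rewrite (connect_trans _ f1z) // (fconnect_sym inj_f).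
Qed.

End Cut.

(** * Rooted trees *)

Lemma vertex_eq (M : hmap) (d e : dart M) : injective (@vrot M) ->
  (vertex d == vertex e) = fconnect (@vrot M) d e.
Proof.
move=> inj_v; apply/eqP/idP => [/setP/(_ e)|de]; first by rewrite !inE connect0.
by apply/setP=> x; rewrite !inE; apply: (same_connect (fconnect_sym inj_v)).
Qed.

Lemma uniq_map_inj (A B : eqType) (f : A -> B) (s : seq A) :
  uniq (map f s) -> {in s &, injective f}.
Proof.
elim: s => //= a s IHs /andP[fa us] x y; rewrite !inE.
case/predU1P=> [->|xs] /predU1P[->|ys] // fxy.
- by rewrite fxy map_f in fa.
- by rewrite -fxy map_f in fa.
- exact: IHs.
Qed.

Lemma adjacent_sym (M : hmap) (S : {set dart M}) : involutive (@opp M) ->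
  (forall d, d \in S -> opp d \in S) -> symmetric (adjacent S).
Proof.
move=> oppK So U V; apply/existsP/existsP => -[d /and3P[dS /eqP<- /eqP<-]];
  by exists (opp d); rewrite So ?oppK ?eqxx.
Qed.

(* [anc x y] says that the vertex of [x] is an ancestor of the vertex of [y], and
   [st d] is the half-edge leading from the vertex of [d] to its parent; nothing
   is said about [st] at the root-vertex. *)
Record tree_cert (M : tree_map) (anc : rel (dart M)) (st : dart M -> dart M) : Prop :=
  TreeCert {
    tc_sv : forall d e, anc d e && anc e d = fconnect (@vrot M) d e;
    tc_trans : transitive anc;
    tc_root : forall d, anc (root_dart M) d;
    tc_opp : forall d, d \in tree M -> opp d \in tree M;
    tc_st_sv : forall d, ~~ anc d (root_dart M) -> fconnect (@vrot M) d (st d);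
    tc_st_eq : forall d e, ~~ anc d (root_dart M) -> fconnect (@vrot M) d e -> st d = st e;
    tc_st_tree : forall d, ~~ anc d (root_dart M) -> st d \in tree M;
    tc_st_anc : forall d x, ~~ anc d (root_dart M) ->
      anc x d = fconnect (@vrot M) x d || anc x (opp (st d));
    tc_st_lt : forall d, ~~ anc d (root_dart M) -> ~~ anc d (opp (st d));
    tc_tree : forall d, d \in tree M ->
      (~~ anc d (root_dart M) /\ st d = d)
      \/ (~~ anc (opp d) (root_dart M) /\ st (opp d) = opp d) }.

Section TreeTheory.

Variables (M : tree_map) (anc : rel (dart M)) (st : dart M -> dart M).
Hypothesis vrot_inj : injective (@vrot M).
Hypothesis oppK : involutive (@opp M).
Hypothesis C : tree_cert anc st.

Notation sv := (fconnect (@vrot M)).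
Notation nonroot d := (~~ anc d (root_dart M)).

Lemma anc_sv d e : sv d e -> anc d e.
Proof. by rewrite -(tc_sv C) => /andP[]. Qed.

Lemma anc_refl d : anc d d.
Proof. by apply: anc_sv. Qed.

Lemma svC d e : sv d e = sv e d.
Proof. exact: fconnect_sym. Qed.

Lemma anc_svl d d' e : sv d d' -> anc d e = anc d' e.
Proof.
move=> dd'; apply/idP/idP; apply: (tc_trans C); apply: anc_sv => //.
by rewrite svC.
Qed.

Lemma anc_svr d e e' : sv e e' -> anc d e = anc d e'.
Proof.
move=> ee'; apply/idP/idP => de; apply: (tc_trans C) de _; apply: anc_sv => //.
by rewrite svC.
Qed.

Lemma anc_antisym d e : anc d e -> anc e d -> sv d e.
Proof. by rewrite -(tc_sv C) => -> ->. Qed.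

Lemma nonroot_sv d e : sv d e -> nonroot d = nonroot e.
Proof. by move/anc_svl->. Qed.

Lemma anc_par d : nonroot d -> anc (opp (st d)) d.
Proof. by move=> nd; rewrite (tc_st_anc C) // anc_refl orbT. Qed.

Lemma st_id d : nonroot d -> st (st d) = st d.
Proof. by move=> nd; rewrite -(tc_st_eq C nd (tc_st_sv C nd)). Qed.

Lemma nonroot_st d : nonroot d -> nonroot (st d).
Proof. by move=> nd; rewrite -(nonroot_sv (tc_st_sv C nd)). Qed.

Definition tree_rank d := #|[pred x | anc x d]|.

Lemma tree_rank_lt d e : anc d e -> ~~ anc e d -> tree_rank d < tree_rank e.
Proof.
move=> de ned; apply: proper_card; apply/properP; split.
  by apply/subsetP=> x; rewrite !inE => xd; apply: (tc_trans C) xd de.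
by exists e; rewrite !inE ?anc_refl.
Qed.

Lemma tree_ind (P : dart M -> Prop) :
  (forall d, (nonroot d -> P (opp (st d))) -> P d) -> forall d, P d.
Proof.
move=> IH d; have [n] := ubnP (tree_rank d); elim: n d => // n IHn d.
rewrite ltnS => le_n; apply: IH => nd; apply: IHn.
apply: leq_trans le_n; apply: tree_rank_lt; first exact: anc_par.
exact: (tc_st_lt C nd).
Qed.

Lemma anc_chain x y z : anc x z -> anc y z -> anc x y || anc y x.
Proof.
elim/tree_ind: z => z IHz; case: (boolP (nonroot z)) => [nz|/negPn rz].
  rewrite !(tc_st_anc C _ nz) => /orP[xz|xz] /orP[yz|yz].
  - by rewrite anc_sv //; apply: connect_trans xz _; rewrite svC.
  - by rewrite (anc_svr _ xz) (tc_st_anc C _ nz) yz !orbT.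
  - by rewrite (anc_svr _ yz) (tc_st_anc C _ nz) xz !orbT.
  - exact: IHz.
move=> xz _; have xr := tc_trans C xz rz.
by rewrite (tc_trans C xr (tc_root C y)).
Qed.

Lemma child_toward v y : anc v y -> ~~ anc y v ->
  exists c, [/\ nonroot c, st c = c, sv v (opp c) & anc c y].
Proof.
elim/tree_ind: y => y IHy vy yv.
have ny : nonroot y by apply: contra yv => yr; apply: (tc_trans C) yr (tc_root C v).
have vp : anc v (opp (st y)).
  by move: vy; rewrite (tc_st_anc C _ ny) => /orP[|//]; rewrite svC => /anc_sv; rewrite (negbTE yv).
have [pv|npv] := boolP (anc (opp (st y)) v).
  exists (st y); rewrite nonroot_st // st_id //; split=> //; first exact: anc_antisym.
  by rewrite (tc_st_anc C _ ny) svC (tc_st_sv C ny).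
have [c [nc sc vc cy]] := IHy ny vp npv.
by exists c; split=> //; rewrite (tc_st_anc C _ ny) cy orbT.
Qed.

Lemma adjacent_st d : nonroot d -> adjacent (tree M) (vertex (opp (st d))) (vertex d).
Proof.
move=> nd; apply/existsP; exists (opp (st d)).
rewrite (tc_opp C) ?(tc_st_tree C) // oppK eqxx /= vertex_eq // svC.
exact: (tc_st_sv C nd).
Qed.

Lemma cert_connected : connected_by (tree M).
Proof.
have sym : connect_sym (adjacent (tree M)).
  by apply: sym_connect_sym; apply: adjacent_sym => //; apply: (tc_opp C).
have to_root d : connect (adjacent (tree M)) (root_vertex M) (vertex d).
  elim/tree_ind: d => d IHd; have [nd|/negPn rd] := boolP (nonroot d).
    by apply: connect_trans (IHd nd) _; apply: connect1; apply: adjacent_st.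
  apply: eq_connect0; apply/eqP; rewrite vertex_eq //; apply: anc_antisym => //.
  exact: (tc_root C).
by move=> d e; apply: connect_trans (to_root e); rewrite sym.
Qed.

(* At a deepest vertex of a cycle both half-edges of the cycle would be the stem. *)
Lemma cert_acyclic (p : seq (dart M)) : {subset p <= tree M} -> ~ simple_cycle p.
Proof.
move=> pT [p0 cyc uv ue].
have up : uniq p := map_uniq uv.
have [d0 d0p] : exists d0, d0 \in p.
  by case: p p0 {pT cyc uv ue up} => // d ? _; exists d; rewrite mem_head.
have [d dp max_d] := arg_maxnP tree_rank (P := [in p]) d0p.
have svrank x y : sv x y -> tree_rank x = tree_rank y.
  by move=> xy; apply: eq_card => z; rewrite !inE (anc_svr _ xy).
have rank_par x : nonroot x -> tree_rank (opp (st x)) < tree_rank x.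
  by move=> nx; apply: tree_rank_lt; [exact: anc_par|exact: (tc_st_lt C nx)].
have std : nonroot d /\ st d = d.
  case: (tc_tree C (pT _ dp)) => // -[nod so]; have := next_cycle cyc dp.
  rewrite vertex_eq // => /svrank rn.
  have := rank_par _ nod; rewrite so oppK rn ltnNge.
  by have /= -> := max_d _ (_ : next p d \in p); rewrite ?mem_next.
have pq : prev p d \in p by rewrite mem_prev.
have := prev_cycle cyc dp; rewrite vertex_eq // => svq.
case: (tc_tree C (pT _ pq)) => -[nq sq].
  have := rank_par _ nq; rewrite sq (svrank _ _ svq) ltnNge.
  by have /= -> := max_d _ pq.
have oq : opp (prev p d) = d by rewrite -sq (tc_st_eq C nq svq) std.2.
have eqd : prev p d = d.
  apply: (uniq_map_inj ue) => //; rewrite /edge oq setUC; congr (_ :|: [set _]).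
  by rewrite -{2}oq oppK.
by have := tc_st_lt C std.1; rewrite std.2 -{2}eqd oq anc_refl.
Qed.

Lemma cert_spanning : spanning_tree (tree M).
Proof. by split; [exact: (tc_opp C)|exact: cert_connected|exact: cert_acyclic]. Qed.

(** A simple tree path from the root can only descend, since a step up would return to the parent,
    which is already on the path. Hence [ancestor] does not depend on the path that witnesses it. *)
Lemma simple_path_anc p e : path (adjacent (tree M)) (root_vertex M) p ->
  uniq (root_vertex M :: p) -> last (root_vertex M) p = vertex e ->
  forall x, (vertex x \in root_vertex M :: p) = anc x e.
Proof.
elim/last_ind: p e => [|p V IHp] e.
  move=> _ _ /= /eqP; rewrite vertex_eq // => re x.
  rewrite inE vertex_eq // -(anc_svr _ re).
  apply/idP/idP => [/anc_sv//|xr]; apply: anc_antisym => //; exact: (tc_root C).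
rewrite rcons_path -rcons_cons rcons_uniq last_rcons => /andP[pp aV] /andP[Vp up] eV x.
case/existsP: aV => d /and3P[dT /eqP ed /eqP eod]; subst V.
have IH := IHp d pp up (esym ed).
have ode : sv (opp d) e by rewrite -vertex_eq // eod.
have vx : (vertex x == vertex e) = sv x e by rewrite vertex_eq.
case: (tc_tree C dT) => -[nd sd].
  by case/negP: Vp; rewrite -eod IH -{1}sd anc_par.
rewrite mem_rcons in_cons vx IH -(anc_svr _ ode) (tc_st_anc C _ nd) sd oppK.
by congr (_ || _); rewrite !(svC x) (same_connect svC ode).
Qed.

Lemma ancestorP d e : ancestor (vertex d) (vertex e) <-> anc d e.
Proof.
split=> [[p [pp lp up dp]]|de]; first by rewrite -(simple_path_anc pp up lp).
suff [p [pp up lp]] : exists p, [/\ path (adjacent (tree M)) (root_vertex M) p,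
    uniq (root_vertex M :: p) & last (root_vertex M) p = vertex e].
  by exists p; split=> //; rewrite (simple_path_anc pp up lp).
clear de; elim/tree_ind: e => e IHe; have [ne|/negPn re] := boolP (nonroot e); last first.
  exists [::]; split=> //=; apply/eqP; rewrite vertex_eq //.
  by apply: anc_antisym => //; apply: (tc_root C).
have [p [pp up lp]] := IHe ne; exists (rcons p (vertex e)).
rewrite rcons_path pp lp adjacent_st // last_rcons -rcons_cons rcons_uniq up andbT.
by split=> //; rewrite (simple_path_anc pp up lp) (tc_st_lt C).
Qed.

(** Deleting an external edge leaves the tree intact. Deleting the stem of [u] leaves the subtree of
    [u] and its complement connected, and the external edge provided by the hypothesis joins
    them. *)
Lemma cert_bridgeless :
  (forall u, nonroot u -> exists e, [/\ e \notin tree M, anc u e & ~~ anc u (opp e)]) ->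
  bridgeless M.
Proof.
move=> crossing.
have adjS (S : {set dart M}) : (forall x, x \in S -> opp x \in S) ->
    connect_sym (adjacent S).
  by move=> So; apply/sym_connect_sym/adjacent_sym.
move=> d; have cE : connect_sym (adjacent (~: edge d)).
  apply: adjS => x; rewrite !in_setC !in_edge !(opp_eq oppK) oppK.
  by rewrite [(_ == _ d) || _]orbC.
suff to_root : forall x : dart M, connect (adjacent (~: edge d)) (vertex x) (root_vertex M).
  by move=> x y; apply: connect_trans (to_root x) _; rewrite cE.
have up (x : dart M) : ~~ anc x (root_dart M) -> st x \notin edge d ->
    connect (adjacent (~: edge d)) (vertex x) (vertex (opp (st x))).
  move=> nx sx; apply: connect1; apply/existsP; exists (st x).
  by rewrite inE sx eqxx andbT /= vertex_eq // svC (tc_st_sv C nx).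
have atroot (x : dart M) : anc x (root_dart M) -> vertex x = root_vertex M.
  move=> xr; apply/eqP; rewrite vertex_eq //.
  by apply: anc_antisym => //; apply: (tc_root C).
have [dT|dT] := boolP (d \in tree M); last first.
  apply: tree_ind => x IHx.
  have [nx|/negPn/atroot-> //] := boolP (~~ anc x (root_dart M)).
  apply: connect_trans (up x nx _) (IHx nx).
  apply: contra dT; rewrite in_edge => /orP[]/eqP e.
    by rewrite -e (tc_st_tree C nx).
  by rewrite -(oppK d) -e (tc_opp C) // (tc_st_tree C nx).
wlog [nd sd] : d dT cE up / ~~ anc d (root_dart M) /\ st d = d.
  move=> wl; case: (tc_tree C dT) => H; first exact: (wl d).
  have := wl (opp d); rewrite (edgeC oppK) => /(_ (tc_opp C dT) cE up H).
  exact.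
have below (x : dart M) : anc d x -> connect (adjacent (~: edge d)) (vertex x) (vertex d).
  move: x; apply: tree_ind => x IHx dx.
  have [xd|nxd] := boolP (anc x d).
    apply: eq_connect0; apply/eqP; rewrite vertex_eq //; exact: anc_antisym.
  have nx : ~~ anc x (root_dart M).
    by apply: contra nxd => xr; apply: (tc_trans C) xr (tc_root C d).
  have dp : anc d (opp (st x)).
    move: dx; rewrite (tc_st_anc C _ nx) svC => /orP[/anc_sv|//].
    by rewrite (negbTE nxd).
  apply: connect_trans (up x nx _) (IHx nx dp).
  rewrite in_edge negb_or; apply/andP; split; last first.
    apply: contraNneq nxd => e; rewrite (anc_svl _ (tc_st_sv C nx)) e -{1}sd.
    exact: (anc_par nd).
  by apply: contraNneq nxd => <-; rewrite anc_sv // (tc_st_sv C nx).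
have outside (x : dart M) : ~~ anc d x -> connect (adjacent (~: edge d)) (vertex x) (root_vertex M).
  move: x; apply: tree_ind => x IHx dx.
  have [nx|/negPn/atroot-> //] := boolP (~~ anc x (root_dart M)).
  apply: connect_trans (up x nx _) (IHx nx _); last first.
    by apply: contra dx => dp; apply: (tc_trans C) dp (anc_par nx).
  rewrite in_edge negb_or; apply/andP; split.
    apply: contraNneq dx => e; rewrite -{1}e -(anc_svl _ (tc_st_sv C nx)).
    exact: anc_refl.
  apply: contraNneq dx => e; have := anc_par nx.
  by rewrite e oppK.
have [e [eT de nde]] := crossing d nd.
move=> x; have [dx|] := boolP (anc d x); last exact: outside.
apply: connect_trans (below _ dx) _.
apply: (@connect_trans _ _ (vertex e)); first by rewrite cE; apply: below.
apply: connect_trans (outside _ nde); apply: connect1; apply/existsP; exists e.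
rewrite inE !eqxx !andbT /= in_edge negb_or; apply/andP; split.
  by apply: contraNneq eT => ->.
by apply: contraNneq eT => ->; apply: (tc_opp C).
Qed.

End TreeTheory.

(** * Orienting a spanning tree towards the root *)

Section SpanningTreeCert.

Variable M : tree_map.
Hypothesis vrot_inj : injective (@vrot M).
Hypothesis oppK : involutive (@opp M).
Hypothesis T_tree : spanning_tree (tree M).

Notation T := (tree M).
Notation sv := (fconnect (@vrot M)).
Notation without d := (connect (adjacent (T :\: edge d))).

Let T_opp : forall d, d \in T -> opp d \in T.
Proof. by case: T_tree. Qed.

Let withoutC d : connect_sym (adjacent (T :\: edge d)).
Proof.
apply/sym_connect_sym/adjacent_sym => // x; rewrite !in_setD !in_edge.
case/andP=> xd /T_opp->; rewrite !opp_eq // oppK andbT.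
by rewrite orbC.
Qed.

Lemma lift_path (S : {set dart M}) U p : path (adjacent S) U p ->
  exists q, [/\ {subset q <= S}, map (@vertex M) q = belast U p
              & map (fun d : dart M => vertex (opp d)) q = p].
Proof.
elim: p U => [|V p IHp] U /=; first by exists [::].
case/andP=> /existsP[d /and3P[dS /eqP eU /eqP eV]] /IHp[q [qS q1 q2]].
exists (d :: q); split; rewrite /= ?eU ?eV ?q1 ?q2 //.
by move=> x; rewrite inE => /predU1P[->//|/qS].
Qed.

(** A simple tree path between the ends of [d] that avoids [edge d] would close up with [d] to a
    simple cycle. *)
Lemma tree_edge_bridge d : d \in T -> ~~ without d (vertex (opp d)) (vertex d).
Proof.
move=> dT; apply/negP => /connectP[p0 pp0]; case/shortenP: pp0 => p pp up _ lp.
have [q [qS q1 q2]] := lift_path pp.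
have szq : size q = size p by rewrite -q2 size_map.
case: T_tree => _ _ /(_ (d :: q)); case.
  by move=> x; rewrite inE => /predU1P[-> //|/qS]; rewrite inE => /andP[].
split=> //.
- have pathI y s : map (fun x : dart M => vertex (opp x)) (belast y s) = map (@vertex M) s ->
      path (fun d e : dart M => vertex (opp d) == vertex e) y s.
    by elim: s y => //= x s IHs y [-> e2]; rewrite eqxx IHs.
  by apply: pathI; rewrite belast_rcons /= q2 map_rcons q1 lp -lastI.
- by rewrite /= q1 lp -rcons_uniq -lastI.
- rewrite /=; apply/andP; split.
    apply/mapP=> -[x /qS]; rewrite inE => /andP[/negP xd _] ed; apply: xd.
    by rewrite ed in_edge eqxx.
  apply/(uniqP (edge d)) => i j; rewrite !inE !size_map => iq jq.
  rewrite !(nth_map d) // => eij.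
  set U := vertex (opp d) in pp up q1.
  have v1 k : k < size q -> vertex (nth d q k) = nth U (U :: p) k.
    move=> kq; rewrite -(nth_map d U) // q1 lastI nth_rcons size_belast -szq kq //.
  have v2 k : k < size q -> vertex (opp (nth d q k)) = nth U (U :: p) k.+1.
    by move=> kq; rewrite -q2 /= (nth_map d).
  have inj a b : a <= size q -> b <= size q -> nth U (U :: p) a = nth U (U :: p) b -> a = b.
    by move=> aq bq /eqP; rewrite nth_uniq //= ?ltnS -?szq // => /eqP.
  (* Two steps along one edge in opposite directions would each be the successor of the other, as
     the path visits every vertex once. *)
  have : nth d q j \in edge (nth d q i) by rewrite eij in_edge eqxx.
  rewrite in_edge => /orP[]/eqP e.
    by apply: inj; try exact: ltnW; rewrite -!v1 // e.
  have e1 : j = i.+1 by apply: inj; [exact: ltnW|exact: iq|rewrite -(v1 j) // -(v2 i) // e].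
  have e2 : j.+1 = i by apply: inj; [exact: jq|exact: ltnW|rewrite -(v1 i) // -(v2 j) // e oppK].
  by lia.
Qed.

(** Follow the path until it first uses [edge d]: it has then reached an end of [d]. *)
Lemma connect_without (S : {set dart M}) d U V : connect (adjacent S) U V ->
  [\/ connect (adjacent (S :\: edge d)) U V,
      connect (adjacent (S :\: edge d)) U (vertex d)
    | connect (adjacent (S :\: edge d)) U (vertex (opp d))].
Proof.
apply: (connect_ind (P := fun V => [\/ connect (adjacent (S :\: edge d)) U V,
      connect (adjacent (S :\: edge d)) U (vertex d)
    | connect (adjacent (S :\: edge d)) U (vertex (opp d))])).
  by constructor 1.
move=> z z' [|cd _|cd _] ; [|by constructor 2|by constructor 3].
move=> uz /existsP[e /and3P[eS /eqP ez /eqP ez']].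
case: (boolP (e \in edge d)) => [|ed].
  rewrite in_edge => /orP[]/eqP ee; subst e z.
    by constructor 2.
  by constructor 3.
constructor 1; apply: connect_trans uz _; apply: connect1; apply/existsP; exists e.
by rewrite inE ed eS ez ez' !eqxx.
Qed.

(** Direction towards the root, expressed by deletion: the far end of [d] is still joined to the
    root without [edge d]. No tree path has to be chosen. *)
Definition is_stem d := (d \in T) && without d (root_vertex M) (vertex (opp d)).

Lemma is_stem_or d : d \in T -> is_stem d || is_stem (opp d).
Proof.
move=> dT; rewrite /is_stem dT T_opp // edgeC // oppK /=.
have [_ con _] := T_tree.
by case: (connect_without d (con (root_dart M) d)) => ->; rewrite ?orbT.
Qed.

Lemma is_stem_root d : is_stem d -> vertex d != root_vertex M.
Proof.
case/andP=> dT c; apply: contraTneq c => ed; rewrite -ed withoutC.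
exact: tree_edge_bridge.
Qed.

(** Take the connection from the far end of [e] to the root that avoids [e]. Whether or not it meets
    [d], it can be completed to a connection between the ends of [d] or of [e] that avoids that very
    edge. *)
Lemma is_stem_uniq d e : is_stem d -> is_stem e -> vertex d = vertex e -> d = e.
Proof.
move=> /andP[dT cd] /andP[eT ce] de; apply/eqP/negPn/negP => nde.
have ed : e \notin edge d.
  rewrite in_edge negb_or eq_sym nde /=; apply: contraTneq isT => eo.
  by have := tree_edge_bridge dT; rewrite -eo -de connect0.
have step : adjacent (T :\: edge d) (vertex d) (vertex (opp e)).
  by apply/existsP; exists e; rewrite inE ed eT de !eqxx.
have subTe U V : connect (adjacent (T :\: edge e :\: edge d)) U V -> without d U V.
  apply: connect_sub => a b /existsP[x /and3P[xS xa xb]]; apply: connect1.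
  apply/existsP; exists x; rewrite xa xb !andbT.
  by move: xS; rewrite !in_setD => /and3P[-> _ ->].
have subTd U V : connect (adjacent (T :\: edge e :\: edge d)) U V -> without e U V.
  apply: connect_sub => a b /existsP[x /and3P[xS xa xb]]; apply: connect1.
  apply/existsP; exists x; rewrite xa xb !andbT.
  by move: xS; rewrite !in_setD => /and3P[_ -> ->].
have bd : ~~ without d (vertex d) (vertex (opp d)).
  by rewrite withoutC tree_edge_bridge.
rewrite withoutC in ce.
case: (connect_without d ce) => c.
- case/negP: bd; apply: connect_trans (connect1 step) _.
  by apply: connect_trans (subTe _ _ c) _.
- by move: c => /subTd; rewrite de (negbTE (tree_edge_bridge eT)).
- by case/negP: bd; apply: connect_trans (connect1 step) (subTe _ _ c).
Qed.

(** The root-vertex has no stem and is a fixed point, so that the ancestors of a vertex are its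
    iterates under this map. *)
Definition par_vertex (V : {set dart M}) : {set dart M} :=
  if [pick e | is_stem e && (vertex e == V)] is Some e then vertex (opp e) else V.
Definition stem_of (d : dart M) : dart M :=
  if [pick e | is_stem e && (vertex e == vertex d)] is Some e then e else d.
Definition stem_anc : rel (dart M) :=
  fun x d => fconnect par_vertex (vertex d) (vertex x).

Lemma par_stem d : is_stem d -> par_vertex (vertex d) = vertex (opp d).
Proof.
rewrite /par_vertex => sd; case: pickP => [e /andP[se /eqP ed]|/(_ d)].
  by rewrite (is_stem_uniq se sd ed).
by rewrite sd eqxx.
Qed.

Lemma par_root : par_vertex (root_vertex M) = root_vertex M.
Proof.
by rewrite /par_vertex; case: pickP => // e /andP[/is_stem_root/negbTE->].
Qed.

Lemma iter_par_root k : iter k par_vertex (root_vertex M) = root_vertex M.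
Proof. by elim: k => //= k ->; apply: par_root. Qed.

Lemma par_to_root d : fconnect par_vertex (vertex d) (root_vertex M).
Proof.
have [_ con _] := T_tree.
apply: (connect_ind (P := fun V => fconnect par_vertex V (root_vertex M)) _ _
          (con (root_dart M) d)) => // z z' cz /existsP[e /and3P[eT /eqP ez /eqP ez']].
case/orP: (is_stem_or eT) => se.
  move: cz; rewrite fconnect_eqVf -ez (negbTE (is_stem_root se)) /=.
  by rewrite par_stem // ez'.
by apply: connect_trans cz; rewrite -ez' -ez -{2}(oppK e) -(par_stem se) fconnect1.
Qed.

(** A vertex without a stem would be fixed by [par_vertex], although its iterates reach the root. *)
Lemma stem_ex d : vertex d != root_vertex M -> is_stem (stem_of d) /\ vertex (stem_of d) = vertex d.
Proof.
rewrite /stem_of; case: pickP => [e /andP[? /eqP]//|no nr]; case/negP: nr.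
have fixV : par_vertex (vertex d) = vertex d.
  by rewrite /par_vertex; case: pickP => // e; rewrite no.
rewrite -(iter_findex (par_to_root d)).
by elim: findex => //= k /eqP <-; rewrite fixV.
Qed.

(** Going around a cycle of [par_vertex] often enough exceeds the distance to the root; the root
    being fixed, the cycle consists of it alone. *)
Lemma par_antisym d V : fconnect par_vertex (vertex d) V -> fconnect par_vertex V (vertex d) ->
  vertex d = V.
Proof.
set U := vertex d => /iter_findex; set a := findex _ _ _ => ea /iter_findex.
set b := findex _ _ _ => eb; case: (posnP a) => [a0|a_gt0]; first by rewrite -ea a0.
have /iter_findex := par_to_root d; set n := findex _ _ _; rewrite -/U => en.
have per k : iter (k * (b + a)) par_vertex U = U.
  by elim: k => //= k IHk; rewrite mulSn iterD IHk iterD ea eb.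
have Ur : U = root_vertex M.
  rewrite -(per n) -(subnK (_ : n <= n * (b + a))); first by rewrite iterD en iter_par_root.
  by rewrite -{1}(muln1 n) leq_mul2l addn_gt0 a_gt0 !orbT.
by rewrite -ea Ur iter_par_root.
Qed.

Lemma spanning_tree_cert : tree_cert stem_anc stem_of.
Proof.
have nr d : ~~ stem_anc d (root_dart M) = (vertex d != root_vertex M).
  congr (~~ _); rewrite /stem_anc -/(root_vertex M).
  apply/idP/eqP => [/iter_findex <-|->]; first exact: iter_par_root.
  exact: connect0.
split.
- move=> d e; rewrite -vertex_eq //; apply/andP/eqP => [[de ed]|de].
    exact: par_antisym.
  by rewrite /stem_anc de connect0.
- by move=> x y z yx xz; apply: connect_trans xz yx.
- by move=> d; apply: par_to_root.
- exact: T_opp.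
- by move=> d; rewrite nr => /stem_ex[_ e]; rewrite -vertex_eq // e.
- by move=> d e; rewrite -vertex_eq // nr => dr /eqP de; rewrite /stem_of de;
    case: pickP => // /(_ (stem_of d)); have [-> ->] := stem_ex dr; rewrite de eqxx.
- by move=> d; rewrite nr => /stem_ex[/andP[]].
- move=> d x; rewrite nr => /stem_ex[sd ed].
  have eV : par_vertex (vertex d) = vertex (opp (stem_of d)) by rewrite -ed par_stem.
  by rewrite /stem_anc -eV -vertex_eq // [vertex x == _]eq_sym -fconnect_eqVf.
- move=> d; rewrite nr => /[dup] dr /stem_ex[sd ed].
  have eV : par_vertex (vertex d) = vertex (opp (stem_of d)) by rewrite -ed par_stem.
  apply: contra dr; rewrite /stem_anc -eV => c.
  have e : vertex d = par_vertex (vertex d).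
    by apply: par_antisym c; apply: fconnect1.
  have it k : iter k par_vertex (vertex d) = vertex d by elim: k => //= k ->.
  by rewrite -(iter_findex (par_to_root d)) it.
- move=> d dT; have stE x : is_stem x -> vertex x != root_vertex M /\ stem_of x = x.
    move=> sx; have xr := is_stem_root sx; split=> //; have [sx' e] := stem_ex xr.
    exact: is_stem_uniq.
  by rewrite !nr; case/orP: (is_stem_or dT) => /stE; [left|right].
Qed.

End SpanningTreeCert.

(** * The growing maps of the suffixes of an excursion *)

Notation na w := (count_mem La w).
Notation nb w := (count_mem Lb w).
Notation nc w := (count_mem Lc w).

(** The last letter acts first, so the intermediate growing maps belong to suffixes. Given the
    equality of the totals, the inequalities on prefixes turn into reversed inequalities on
    suffixes. *)
Fixpoint suffix_exc (w : word) : bool :=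
  if w is x :: w' then (2 * nc w <= na w + nb w) && suffix_exc w' else true.

Fixpoint suffix_kreweras (w : word) : bool :=
  if w is x :: w' then [&& nc w <= na w, nc w <= nb w & suffix_kreweras w'] else true.

Lemma count_La w : (na (La :: w) = (na w).+1) * (nb (La :: w) = nb w) * (nc (La :: w) = nc w).
Proof. by []. Qed.

Lemma count_Lb w : (na (Lb :: w) = na w) * (nb (Lb :: w) = (nb w).+1) * (nc (Lb :: w) = nc w).
Proof. by []. Qed.

Lemma count_Lc w : (na (Lc :: w) = na w) * (nb (Lc :: w) = nb w) * (nc (Lc :: w) = (nc w).+1).
Proof. by []. Qed.

Definition count_letter := (count_La, count_Lb, count_Lc).

Lemma suffix_exc_cons x w :
  suffix_exc (x :: w) = (2 * nc (x :: w) <= na (x :: w) + nb (x :: w)) && suffix_exc w.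
Proof. by []. Qed.

Lemma suffix_kreweras_cons x w : suffix_kreweras (x :: w) =
  [&& nc (x :: w) <= na (x :: w), nc (x :: w) <= nb (x :: w) & suffix_kreweras w].
Proof. by []. Qed.

Lemma suffix_krewerasP w : suffix_kreweras w -> (nc w <= na w) && (nc w <= nb w).
Proof. by case: w => //= x w /and3P[-> ->]. Qed.

Lemma suffix_kreweras_exc w : suffix_kreweras w -> suffix_exc w.
Proof. by elim: w => //= x w IHw /and3P[? ? /IHw->]; rewrite andbT; lia. Qed.

(* [fw_valley] says that depths first decrease, then increase along the tour. *)
Record forward (w : word) (G : growing_map) (anc : rel (dart G)) (st : dart G -> dart G) :
  Prop := Forward {
    fw_vinj : injective (@vrot G);
    fw_oppK : involutive (@opp G);
    fw_cert : tree_cert anc st;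
    fw_rootdeg : #|root_vertex G| = 2;
    fw_deg : forall d : dart G, vertex d != root_vertex G -> #|vertex d| = 3;
    fw_head : is_leg (head_leg G);
    fw_head_root : head_leg G != root_dart G;
    fw_head_nonroot : w != [::] -> ~~ anc (head_leg G) (root_dart G);
    fw_face : forall d, is_leg d -> fconnect (@face_next G) (head_leg G) d;
    fw_tree : forall d, d \in tree G -> ~~ is_leg d;
    fw_root_tree : root_dart G \notin tree G;
    fw_anc : forall d, is_leg d -> anc d (head_leg G);
    fw_legs : forall d e, is_leg d -> is_leg e -> d != head_leg G -> e != head_leg G ->
      fconnect (@vrot G) d e -> d = e;
    fw_valley : forall x y z, subseq [:: x; y; z] (tour_legs G) -> anc y x || anc y z;
    fw_comp : forall d, d \notin tree G -> anc d (opp d) || anc (opp d) d;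
    fw_bridge : forall u, ~~ anc u (root_dart G) -> ~~ anc u (head_leg G) ->
      exists d, [/\ ~~ is_leg d, d \notin tree G, anc u d & ~~ anc u (opp d)];
    fw_root : if suffix_kreweras w
      then exists F B, [/\ tour_legs G = F ++ root_dart G :: B,
                           size F + nc w = na w & size B + nc w = nb w]
      else ~~ is_leg (root_dart G);
    fw_size : size (tour_legs G) + 2 * nc w = (na w + nb w).+1;
    fw_darts : #|dart G| = 2 + 3 * (na w + nb w);
    fw_faces : #|faces G| = (nc w).+1 }.

Lemma orbit_behead (T : finType) (f : T -> T) x : orbit f x = x :: behead (orbit f x).
Proof. by rewrite /orbit -orderSpred. Qed.

Lemma mem_tour (G : growing_map) d :
  (d \in tour_legs G) =
  [&& is_leg d, d != head_leg G & fconnect (@face_next G) (head_leg G) d].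
Proof.
rewrite mem_filter fconnect_orbit (orbit_behead _ (head_leg G)).
have := orbit_uniq (@face_next G) (head_leg G); rewrite orbit_behead /= inE => /andP[hn _].
by case: (eqVneq d) => [->|]; rewrite ?(negbTE hn) ?andbF.
Qed.

Lemma uniq_tour (G : growing_map) : uniq (tour_legs G).
Proof.
apply: filter_uniq; have := orbit_uniq (@face_next G) (head_leg G).
by rewrite orbit_behead => /andP[].
Qed.

Lemma subseq_mapP (A B : eqType) (f : A -> B) s l :
  subseq s (map f l) -> exists2 s0, s = map f s0 & subseq s0 l.
Proof.
case/subseqP=> m sz ->; exists (mask m l); first by rewrite map_mask.
exact: mask_subseq.
Qed.

Lemma card_imset_same (A B C : finType) (f : A -> B) (g : A -> C) :
  (forall x y, (f x == f y) = (g x == g y)) ->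
  #|[set f x | x : A]| = #|[set g x | x : A]|.
Proof.
move=> fg; have [x0|no] := pickP A; last first.
  by rewrite !eq_card0 // => y; apply/imsetP=> -[x]; move: (no x); rewrite inE.
pose h y := g (odflt x0 [pick x | f x == y]).
have hf x : h (f x) = g x.
  rewrite /h; case: pickP => [z|/(_ x)]; last by rewrite eqxx.
  by rewrite fg => /eqP.
have <- : h @: [set f x | x : A] = [set g x | x : A].
  rewrite -imset_comp; apply: eq_imset => x /=; exact: hf.
rewrite card_in_imset // => _ _ /imsetP[x _ ->] /imsetP[y _ ->]; rewrite !hf => /eqP.
by rewrite -fg => /eqP.
Qed.

Lemma path_frel_agree (T : eqType) (f g : T -> T) x p :
  path (frel f) x p -> {in belast x p, g =1 f} -> path (frel g) x p.
Proof.
elim: p x => //= y p IHp x /andP[/eqP<- pp] gf.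
by rewrite gf ?mem_head //= eqxx; apply: IHp => // z zp; apply: gf; rewrite inE zp orbT.
Qed.

Lemma face_eq (M : hmap) (f_inj : injective (@face_next M)) (d e : dart M) :
  (face d == face e) = fconnect (@face_next M) d e.
Proof.
apply/eqP/idP => [/setP/(_ e)|de]; first by rewrite !inE connect0.
by apply/setP=> x; rewrite !inE; apply: (same_connect (fconnect_sym f_inj)).
Qed.

(** * Adding a vertex: the letters [a] and [b] *)

Section Grow.

Variables (w : word) (G : growing_map) (anc : rel (dart G)) (st : dart G -> dart G).
Variable r : new_dart -> new_dart.
Hypothesis Fw : forward w anc st.
Hypothesis r_lr : r = rot_left \/ r = rot_right.

Let G' := grow r G.
Notation h := (head_leg G).
Implicit Types (d e : dart G) (y z : new_dart).

Definition grow_anc : rel (dart G') := fun x x' =>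
  match x, x' with
  | inl d, inl e => anc d e
  | inl d, inr _ => anc d h
  | inr _, inl _ => false
  | inr _, inr _ => true
  end.

Definition grow_st (x : dart G') : dart G' :=
  match x with inl d => inl (st d) | inr _ => inr NStem end.

Lemma grow_vrot_inj : injective (@vrot G').
Proof.
case=> [d|y] [e|z] //= [].
  by move/(fw_vinj Fw)->.
by case: r_lr => ->; case: y; case: z.
Qed.

Lemma grow_oppE d : @opp G' (inl d) = if d == h then inr NStem else inl (opp d).
Proof. by []. Qed.

Lemma head_opp : opp h = h.
Proof. exact/eqP/(fw_head Fw). Qed.

Lemma opp_eq_head d : (opp d == h) = (d == h).
Proof. by rewrite -{1}head_opp (inj_eq (inv_inj (fw_oppK Fw))). Qed.

Lemma grow_oppK : involutive (@opp G').
Proof.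
case=> [d|[]] //=; last by rewrite eqxx.
case: ifP => [/eqP-> //|dh].
by rewrite /= opp_eq_head dh (fw_oppK Fw).
Qed.

Lemma grow_sv_ll d e : fconnect (@vrot G') (inl d) (inl e) = fconnect (@vrot G) d e.
Proof.
apply/idP/idP => c.
  pose P (x : dart G') := if x is inl e' then fconnect (@vrot G) d e' : Prop else False.
  apply: (fconnect_ind (P := P) _ _ c) => //= -[e'|//] _ /= de.
  by apply: connect_trans de (fconnect1 _ _).
apply: (fconnect_ind (P := fun e => fconnect (@vrot G') (inl d) (inl e)) _ _ c) => // z _ dz.
exact: connect_trans dz (fconnect1 (@vrot G') (inl z)).
Qed.

Lemma grow_sv_lr d z : fconnect (@vrot G') (inl d) (inr z) = false.
Proof.
apply/negP => c; pose P (x : dart G') := if x is inl e' then True else False.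
by have := @fconnect_ind _ (@vrot G') P (inl d) (inr z) I; apply=> // -[].
Qed.

Lemma grow_sv_rr y z : fconnect (@vrot G') (inr y) (inr z).
Proof.
have s1 u : fconnect (@vrot G') (inr u) (inr (r u)) by apply: (fconnect1 (@vrot G')).
have st' u : u = z \/ r u = z \/ r (r u) = z.
  by case: r_lr => ->; case: u; case: z; auto.
case: (st' y) => [->//|[<-|<-]]; first exact: s1.
exact: connect_trans (s1 _) (s1 _).
Qed.

Lemma grow_sv_rl d z : fconnect (@vrot G') (inr z) (inl d) = false.
Proof. by rewrite (fconnect_sym grow_vrot_inj) grow_sv_lr. Qed.

Lemma grow_tree_l d : (inl d \in tree G') = (d \in tree G) || (d == h).
Proof.
rewrite !inE /= orbF; congr (_ || _).
by rewrite mem_imset // => a b [].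
Qed.

Lemma grow_tree_r z : (inr z \in tree G') = (z == NStem).
Proof.
rewrite !inE /=; have -> : inr z \in [set inl d | d in tree G] = false.
  by apply/imsetP=> -[].
by [].
Qed.

Lemma tree_neq_head d : d \in tree G -> (d == h) = false.
Proof. by move/(fw_tree Fw); apply: contraNF => /eqP->; apply: fw_head Fw. Qed.

Lemma grow_cert : tree_cert grow_anc grow_st.
Proof.
have C := fw_cert Fw; split.
- case=> [d|y] [e|z] /=; rewrite ?grow_sv_ll ?grow_sv_lr ?grow_sv_rl ?grow_sv_rr ?andbF //.
  exact: tc_sv C d e.
- case=> [d|y] [e|z] [f|u] //=; try by [].
  + exact: (tc_trans C).
  + exact: (tc_trans C).
- by case=> [d|y] /=; apply: (tc_root C).
- case=> [d|y]; rewrite ?grow_tree_l ?grow_tree_r; last first.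
    by move/eqP->; rewrite grow_tree_l eqxx orbT.
  rewrite grow_oppE; case: eqP => [_ _|_]; first by rewrite grow_tree_r.
  by rewrite orbF grow_tree_l => /(tc_opp C)->.
- by case=> [d|y] /= nd; rewrite ?grow_sv_rr // grow_sv_ll (tc_st_sv C).
- case=> [d|y] [e|z] //= nd; rewrite ?grow_sv_ll ?grow_sv_lr ?grow_sv_rl //.
  by move/(tc_st_eq C nd)->.
- by case=> [d|y] /= nd; rewrite ?grow_tree_l ?grow_tree_r ?(tc_st_tree C nd).
- case=> [d|y] [e|z] //= nd; rewrite ?grow_sv_ll ?grow_sv_lr ?grow_sv_rl ?grow_sv_rr //.
    by rewrite (tree_neq_head (tc_st_tree C nd)) (tc_st_anc C _ nd).
  by rewrite (tree_neq_head (tc_st_tree C nd)).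
- case=> [d|y] //= nd.
  by rewrite (tree_neq_head (tc_st_tree C nd)) (tc_st_lt C nd).
- case=> [d|y]; rewrite ?grow_tree_l ?grow_tree_r; last by move/eqP->; left.
  case: eqP => [-> _|dh].
    by right; rewrite grow_oppE eqxx.
  rewrite orbF grow_oppE => /[dup] /(tree_neq_head) -> /(tc_tree C).
  by case=> -[nd sd] /=; [left|right]; rewrite sd.
Qed.

Lemma grow_leg_l d : @is_leg G' (inl d) = is_leg d && (d != h).
Proof.
rewrite /is_leg grow_oppE; case: (eqVneq d h) => [->|dh]; first by rewrite andbF.
by rewrite andbT.
Qed.

Lemma grow_vertex_l d : vertex (inl d : dart G') = inl @: vertex d.
Proof.
apply/setP=> -[e|z]; rewrite inE.
  rewrite grow_sv_ll; apply/idP/imsetP => [de|[e' + [->]]]; last by rewrite inE.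
  by exists e; rewrite ?inE.
by rewrite grow_sv_lr; apply/esym/imsetP=> -[].
Qed.

Lemma grow_vertex_r z : vertex (inr z : dart G') = inr @: [set: new_dart].
Proof.
apply/setP=> -[e|u]; rewrite inE ?grow_sv_rl ?grow_sv_rr.
  by apply/esym/imsetP=> -[].
by apply/esym/imsetP; exists u.
Qed.

Lemma card_new_dart : #|{: new_dart}| = 3.
Proof.
rewrite -(@card_in_image _ _ new_dart_code) => [|x y _ _]; last by case: x; case: y.
rewrite (eq_card (B := {: option bool})) ?card_option ?card_bool // => -[[]|]; rewrite inE;
  apply/imageP; [by exists NHead|by exists NLeg|by exists NStem].
Qed.

Lemma grow_face_l d : d != h -> @face_next G' (inl d) = inl (face_next d).
Proof. by rewrite /face_next grow_oppE => /negbTE->. Qed.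

Lemma grow_face_h : @face_next G' (inl h) = inr (r NStem).
Proof. by rewrite /face_next grow_oppE eqxx. Qed.

Lemma grow_face_r z : @face_next G' (inr z) =
  if z is NStem then inl (face_next h) else inr (r z).
Proof. by rewrite /face_next head_opp; case: z. Qed.

Lemma grow_face_to z : fconnect (@face_next G') (inl h) (inr z).
Proof.
have hs : fconnect (@face_next G') (inl h) (inr (r NStem)).
  by rewrite -grow_face_h; apply: fconnect1.
have f1 u : u != NStem -> fconnect (@face_next G') (inr u) (inr (r u)).
  by move=> us; have := fconnect1 (@face_next G') (inr u); rewrite grow_face_r; case: u us.
have rs : r NStem != NStem by case: r_lr => ->.
have rrs : r (r NStem) != NStem by case: r_lr => ->.
have : [|| z == r NStem, z == r (r NStem) | z == r (r (r NStem))].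
  by case: r_lr => ->; case: (z).
case/or3P=> /eqP->; first exact: hs.
  exact: connect_trans hs (f1 _ rs).
exact: connect_trans hs (connect_trans (f1 _ rs) (f1 _ rrs)).
Qed.

Lemma grow_face_ll d e :
  fconnect (@face_next G') (inl d) (inl e) = fconnect (@face_next G) d e.
Proof.
(* Contracting the detour around the new vertex to [h] turns a walk along a face of the grown map
   into one of [G]. *)
pose pr (x : dart G') := if x is inl d then d else h.
apply/idP/idP => c.
  apply: (fconnect_ind (P := fun x => fconnect (@face_next G) d (pr x)) _ _ c) => //.
  case=> [u|z] _ du.
    case: (eqVneq u h) du => [->|uh] du; first by rewrite grow_face_h.
    by rewrite grow_face_l //; apply: connect_trans du (fconnect1 _ _).
  rewrite grow_face_r; case: z du => //= du.
  exact: connect_trans du (fconnect1 _ _).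
apply: (fconnect_ind (P := fun e => fconnect (@face_next G') (inl d) (inl e)) _ _ c) => //.
move=> u _ du; apply: connect_trans du _.
case: (eqVneq u h) => [->|uh]; last by rewrite -grow_face_l // fconnect1.
apply: connect_trans (grow_face_to NStem) _.
by have := fconnect1 (@face_next G') (inr NStem); rewrite grow_face_r.
Qed.

Lemma grow_face_inj : injective (@face_next G').
Proof. by move=> x y /grow_vrot_inj/(inv_inj grow_oppK). Qed.

Lemma face_inj : injective (@face_next G).
Proof. by move=> x y /(fw_vinj Fw)/(inv_inj (fw_oppK Fw)). Qed.

Lemma grow_faces : #|faces G'| = #|faces G|.
Proof.
have -> : faces G' = [set face (inl d : dart G') | d : dart G].
  apply/setP=> A; apply/imsetP/imsetP => [[[d|z] _ ->]|[d _ ->]]; first by exists d.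
    exists h => //; apply/eqP; rewrite (face_eq grow_face_inj).
    by rewrite (fconnect_sym grow_face_inj) grow_face_to.
  by exists (inl d).
apply: card_imset_same => d e.
by rewrite (face_eq grow_face_inj) (face_eq face_inj) grow_face_ll.
Qed.

Let X := behead (orbit (@face_next G) h).

(** The stretch common to both growth steps: from the stem through the whole former tour to the
    former head. Only the place of the new leg relative to it differs. *)
Lemma grow_path : path (frel (@face_next G')) (inr NStem) (map inl (rcons X h)).
Proof.
have cyc : path (frel (@face_next G)) h (rcons X h).
  by have := cycle_orbit face_inj h; rewrite orbit_behead.
have uX : h \notin X.
  by have := orbit_uniq (@face_next G) h; rewrite orbit_behead => /andP[].
have inl_path a Y : path (frel (@face_next G)) a Y -> h \notin belast a Y ->
    path (frel (@face_next G')) (inl a) (map inl Y).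
  elim: Y a => // b Y IHY a /andP[/eqP ab pY]; rewrite inE negb_or => /andP[ha hY].
  by apply/andP; split; [rewrite /= -ab -grow_face_l // eq_sym|exact: IHY].
case E: (rcons X h) cyc => [|a Y] cyc; first by case: (X) E.
case/andP: cyc => /eqP ha pY; apply/andP; split.
  by apply/eqP; rewrite -ha; exact: (grow_face_r NStem).
apply: inl_path => //; apply: contra uX.
have -> : belast a Y = behead (belast a (rcons X h)) by rewrite E.
by rewrite belast_rcons.
Qed.

Lemma grow_tour_filter : [seq x <- map inl (rcons X h) | @is_leg G' x] = map inl (tour_legs G).
Proof.
rewrite filter_map; congr map; rewrite filter_rcons /= grow_leg_l eqxx andbF.
apply: eq_in_filter => d dX /=; rewrite grow_leg_l.
have := orbit_uniq (@face_next G) h; rewrite orbit_behead /= => /andP[hX _].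
by case: eqP dX => [->|]; rewrite ?andbT // (negbTE hX).
Qed.

Lemma uniq_inl_rcons : uniq (map inl (rcons X h) : seq (dart G')).
Proof.
rewrite map_inj_uniq => [|a b []//]; rewrite rcons_uniq.
by have := orbit_uniq (@face_next G) h; rewrite orbit_behead.
Qed.

Lemma inr_inl z (s : seq (dart G)) : (inr z : dart G') \in map inl s = false.
Proof. by apply/mapP=> -[]. Qed.

(** All old legs hang from ancestors of the new vertex, so the new leg is the deepest, and at an end
    of the tour it prolongs the valley. *)
Lemma grow_valley :
  tour_legs G' = inr NLeg :: map inl (tour_legs G) \/
  tour_legs G' = rcons (map inl (tour_legs G)) (inr NLeg) ->
  forall x y z : dart G', subseq [:: x; y; z] (tour_legs G') -> grow_anc y x || grow_anc y z.
Proof.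
have old (x y z : dart G') : subseq [:: x; y; z] (map inl (tour_legs G)) ->
    grow_anc y x || grow_anc y z.
  case/subseq_mapP=> -[|a [|b [|c [|]]]] // [-> -> ->]; exact: (fw_valley Fw).
have new (y : dart G') : y \in map inl (tour_legs G) -> grow_anc y (inr NLeg).
  case/mapP=> d; rewrite mem_tour => /and3P[ld _ _] ->; exact: (fw_anc Fw).
case=> -> x y z.
  rewrite [subseq _ _]/=; case: eqP => [-> s|_]; last exact: old.
  by rewrite new // (mem_subseq s) ?mem_head.
rewrite -subseq_rev rev_rcons [rev [:: _; _; _]]/= [subseq _ _]/=.
case: eqP => [-> s|_ s].
  by rewrite [X in _ || X]new ?orbT // -mem_rev (mem_subseq s) ?mem_head.
by apply: old; rewrite -subseq_rev.
Qed.

Lemma grow_forward x :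
  (x = La /\ tour_legs G' = inr NLeg :: map inl (tour_legs G)) \/
  (x = Lb /\ tour_legs G' = rcons (map inl (tour_legs G)) (inr NLeg)) ->
  forward (x :: w) grow_anc grow_st.
Proof.
move=> tx; have C := fw_cert Fw.
have h_nr : ~~ grow_anc (inr NHead) (root_dart G') by [].
split=> //.
- exact: grow_vrot_inj.
- exact: grow_oppK.
- exact: grow_cert.
- by rewrite /root_vertex grow_vertex_l card_imset ?(fw_rootdeg Fw) // => a b [].
- case=> [d|z]; rewrite /root_vertex ?grow_vertex_l ?grow_vertex_r => ne.
    rewrite card_imset ?(fw_deg Fw) //; last by move=> a b [].
    by apply: contraNneq ne => ->.
  by rewrite card_imset ?cardsT ?card_new_dart // => a b [].
- case=> [d|z].
    rewrite grow_leg_l => /andP[/(fw_face Fw) hd dh]; rewrite -grow_face_ll in hd.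
    by apply: connect_trans hd; rewrite (fconnect_sym grow_face_inj) grow_face_to.
  move=> _; apply: (@connect_trans _ _ (inl h)); last exact: grow_face_to.
  by rewrite (fconnect_sym grow_face_inj) grow_face_to.
- case=> [d|z]; last by rewrite grow_tree_r => /eqP->.
  by rewrite grow_tree_l grow_leg_l negb_and negbK => /orP[/(fw_tree Fw)->|->]; rewrite ?orbT.
- by rewrite grow_tree_l (negbTE (fw_root_tree Fw)) eq_sym (fw_head_root Fw).
- case=> [d|z] //; rewrite grow_leg_l => /andP[+ _]; exact: (fw_anc Fw).
- case=> [d|y] [e|z]; rewrite ?grow_sv_lr ?grow_sv_rl // ?grow_leg_l ?grow_sv_ll.
    by move=> /andP[ld dh] /andP[le eh] _ _ de; rewrite (fw_legs Fw ld le dh eh de).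
  by case: y; case: z.
- by apply: grow_valley; case: tx => -[_ ->]; [left|right].
- case=> [d|z]; rewrite ?grow_tree_l ?grow_tree_r; last by case: z.
  by rewrite negb_or grow_oppE => /andP[dT /negbTE->]; apply: (fw_comp Fw).
- case=> [u|//] nu nh; have [d [ld dT ud uod]] := fw_bridge Fw nu nh.
  exists (inl d); have dh : d != h by apply: contraNneq ld => ->; apply: (fw_head Fw).
  by rewrite grow_leg_l grow_oppE grow_tree_l (negbTE ld) (negbTE dT) (negbTE dh).
(* A letter [a] or [b] cannot break the Kreweras inequalities; it lengthens one of the two blocks
   around the root. *)
- have := fw_root Fw; have kx : suffix_kreweras (x :: w) = suffix_kreweras w.
    rewrite suffix_kreweras_cons; case: (boolP (suffix_kreweras w)); last by rewrite !andbF.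
    by move/suffix_krewerasP; case: tx => -[-> _]; rewrite !count_letter; lia.
  rewrite kx; case: ifP => _; last by rewrite grow_leg_l negb_and => ->.
  case=> F [B [tG sF sB]]; case: tx => -[-> ->]; rewrite tG map_cat !count_letter.
    exists (inr NLeg :: map inl F), (map inl B).
    by split; rewrite /= ?size_map //= addSn sF.
  exists (map inl F), (rcons (map inl B) (inr NLeg)).
  by split; rewrite ?rcons_cat ?size_rcons ?size_map //= addSn sB.
- have := fw_size Fw; case: tx => -[-> ->]; rewrite !count_letter /= ?size_rcons size_map; lia.
- rewrite card_sum card_new_dart (fw_darts Fw).
  by case: tx => -[-> _]; rewrite !count_letter; lia.
- by rewrite grow_faces (fw_faces Fw); case: tx => -[-> _].
Qed.

End Grow.

(** With [rot_left] the tour meets the new leg right after the head and only then goes down the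
    stem: a push at the front. *)
Lemma phi_a_tour w G anc st : @forward w G anc st ->
  tour_legs (phi_a G) = inr NLeg :: map inl (tour_legs G).
Proof.
move=> Fw; have pX := grow_path rot_left Fw; have uX := uniq_inl_rcons G rot_left.
have fX := grow_tour_filter G rot_left.
have lX : last (inr NStem : dart (phi_a G)) (map inl (rcons (behead (orbit (@face_next G)
    (head_leg G))) (head_leg G))) = inl (head_leg G) by rewrite map_rcons last_rcons.
move: (rcons _ _) pX uX fX lX => X pX uX fX lX.
have E : orbit (@face_next (phi_a G)) (inr NHead)
         = inr NHead :: inr NLeg :: inr NStem :: map inl X.
  apply: orbit_fcycle; last by rewrite /= !inE !(inr_inl rot_left).
  have p1 : path (frel (@face_next (phi_a G))) (inr NStem) (rcons (map inl X) (inr NHead)).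
    rewrite rcons_path lX; apply/andP; split; first exact: pX.
    by apply/eqP; exact: (grow_face_h G rot_left).
  apply/andP; split; first by apply/eqP; exact: (grow_face_r rot_left Fw NHead).
  apply/andP; split; first by apply/eqP; exact: (grow_face_r rot_left Fw NLeg).
  exact: p1.
rewrite -fX /tour_legs [head_leg (phi_a G)]/= E; exact: erefl.
Qed.

(** With [rot_right] the stem comes first and the new leg last: a push at the back. *)
Lemma phi_b_tour w G anc st : @forward w G anc st ->
  tour_legs (phi_b G) = rcons (map inl (tour_legs G)) (inr NLeg).
Proof.
move=> Fw; have pX := grow_path rot_right Fw; have uX := uniq_inl_rcons G rot_right.
have fX := grow_tour_filter G rot_right.
have lX : last (inr NStem : dart (phi_b G)) (map inl (rcons (behead (orbit (@face_next G)
    (head_leg G))) (head_leg G))) = inl (head_leg G) by rewrite map_rcons last_rcons.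
move: (rcons (behead _) _) pX uX fX lX => X pX uX fX lX.
have E : orbit (@face_next (phi_b G)) (inr NHead)
         = inr NHead :: inr NStem :: rcons (map inl X) (inr NLeg).
  apply: orbit_fcycle.
    have p1 : path (frel (@face_next (phi_b G))) (inr NStem)
                   (rcons (rcons (map inl X) (inr NLeg)) (inr NHead)).
      rewrite rcons_path last_rcons; apply/andP; split; last first.
        by apply/eqP; exact: (grow_face_r rot_right Fw NLeg).
      rewrite rcons_path lX; apply/andP; split; first exact: pX.
      by apply/eqP; exact: (grow_face_h G rot_right).
    apply/andP; split; first by apply/eqP; exact: (grow_face_r rot_right Fw NHead).
    exact: p1.
  by rewrite /= !inE !mem_rcons !inE !(inr_inl rot_right) rcons_uniq (inr_inl rot_right).
rewrite -fX /tour_legs [head_leg (phi_b G)]/= E.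
by rewrite [behead _]/= [filter _ (_ :: _)]/= filter_rcons.
Qed.

Lemma forward_a w G anc st : @forward w G anc st ->
  forward (La :: w) (grow_anc anc (r := rot_left)) (grow_st st (r := rot_left)).
Proof.
by move=> Fw; apply: (grow_forward Fw); left=> //; split=> //; apply: phi_a_tour Fw.
Qed.

Lemma forward_b w G anc st : @forward w G anc st ->
  forward (Lb :: w) (grow_anc anc (r := rot_right)) (grow_st st (r := rot_right)).
Proof.
by move=> Fw; apply: (grow_forward Fw); right=> //; split=> //; apply: phi_b_tour Fw.
Qed.

(** * Gluing the head to a leg: the letter [c] *)

Lemma fcycle_swap (T : eqType) (f g : T -> T) h s X Y :
  g h = f s -> g s = f h -> (forall z, z != h -> z != s -> g z = f z) ->
  fcycle f (h :: X ++ s :: Y) -> uniq (h :: X ++ s :: Y) ->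
  fcycle g (h :: Y) /\ fcycle g (s :: X).
Proof.
move=> gh gs gz; rewrite /cycle rcons_cat rcons_cons -cat_rcons cat_path last_rcons.
case/andP=> pX pY; rewrite cons_uniq mem_cat inE !negb_or cat_uniq => /andP[/and3P[hX hs hY]].
case/and3P=> _ /hasPn sX /andP[sY _].
have sX' : s \notin X by apply: (sX s); rewrite mem_head.
have reroute a b Z c : g a = f b -> h \notin Z -> s \notin Z ->
    path (frel f) b (rcons Z c) -> path (frel g) a (rcons Z c).
  move=> gab; case: Z => [|z Z] /=; first by rewrite gab.
  rewrite !inE !negb_or => /andP[hz hZ] /andP[sz sZ] /andP[/eqP e p]; rewrite gab e eqxx.
  apply: path_frel_agree p _ => u; rewrite belast_rcons inE => /predU1P[->|uZ].
    by apply: gz; rewrite eq_sym.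
  by apply: gz; [apply: contraNneq hZ => <-|apply: contraNneq sZ => <-].
by split; [apply: reroute gh _ _ pY|apply: reroute gs _ _ pX].
Qed.

Lemma filter_cons_split (T : Type) (a : pred T) (X : seq T) x r : filter a X = x :: r ->
  exists X1 X2, [/\ X = X1 ++ x :: X2, filter a X1 = [::] & filter a X2 = r].
Proof.
elim: X => //= y X IHX; case: ifP => [ay [-> <-]|ay /IHX[X1 [X2 [-> f1 f2]]]].
  by exists [::], X.
by exists (y :: X1), X2; rewrite /= ay.
Qed.

Lemma filter_rcons_split (T : Type) (a : pred T) (X : seq T) x r : filter a X = rcons r x ->
  exists X1 X2, [/\ X = X1 ++ x :: X2, filter a X1 = r & filter a X2 = [::]].
Proof.
move/(congr1 rev); rewrite rev_rcons -filter_rev => e.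
have [X1 [X2 [eX f1 f2]]] := filter_cons_split e.
exists (rev X2), (rev X1); rewrite !filter_rev f1 f2 revK; split=> //.
by rewrite -(revK X) eX rev_cat rev_cons cat_rcons.
Qed.

Section Glue.

Variables (w : word) (G : growing_map) (anc : rel (dart G)) (st : dart G -> dart G).
Hypothesis Fw : forward w anc st.
Variables s t : dart G.
Hypothesis ls : is_leg s.
Hypothesis sh : s != head_leg G.

Let G' := glue_and_move s t.
Notation h := (head_leg G).
Implicit Types d e : dart G.

Lemma glue_oppE d : @opp G' d = if d == h then s else if d == s then h else opp d.
Proof. by []. Qed.

Lemma glue_oppK : involutive (@opp G').
Proof.
have oi := inv_inj (fw_oppK Fw); have oh : opp h = h := head_opp Fw.
have os : opp s = s := eqP ls.
move=> d; rewrite !glue_oppE; case: (eqVneq d h) => [->|dh].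
  by rewrite (negbTE sh) eqxx.
case: (eqVneq d s) => [->|ds]; first by rewrite eqxx.
by rewrite -{1}oh -{2}os !(inj_eq oi) (negbTE dh) (negbTE ds) (fw_oppK Fw).
Qed.

Lemma glue_leg d : @is_leg G' d = [&& is_leg d, d != h & d != s].
Proof.
rewrite /is_leg glue_oppE; case: (eqVneq d h) => [->|dh]; first by rewrite andbF (negbTE sh).
by case: (eqVneq d s) => [->|ds]; rewrite ?andbF ?andbT // eq_sym (negbTE sh).
Qed.

Lemma glue_opp_tree d : d \in tree G -> @opp G' d = opp d.
Proof.
move=> dT; have ld := fw_tree Fw dT.
by rewrite glue_oppE !ifN //; apply: contraNneq ld => ->; [exact: ls|exact: fw_head Fw].
Qed.

Lemma glue_cert : @tree_cert G' anc st.
Proof.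
have C := fw_cert Fw; split.
- exact: tc_sv C.
- exact: (tc_trans C).
- exact: (tc_root C).
- by move=> d dT; rewrite glue_opp_tree //; apply: (tc_opp C).
- exact: (tc_st_sv C).
- exact: (tc_st_eq C).
- exact: (tc_st_tree C).
- by move=> d x nd; rewrite glue_opp_tree ?(tc_st_tree C nd) //; apply: (tc_st_anc C).
- by move=> d nd; rewrite glue_opp_tree ?(tc_st_tree C nd) //; apply: (tc_st_lt C).
- by move=> d dT; rewrite glue_opp_tree //; apply: (tc_tree C).
Qed.

Lemma glue_face_swap : swap_of (@face_next G) (@face_next G') h s.
Proof.
rewrite /face_next; split=> [||z zh zs]; rewrite glue_oppE ?eqxx.
- by rewrite (eqP ls).
- by rewrite (negbTE sh) (head_opp Fw).
- by rewrite (negbTE zh) (negbTE zs).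
Qed.

(** Both [h] and [s] lie on the head-face, which the new edge therefore splits in two. *)
Lemma glue_faces : #|faces G'| = #|faces G|.+1.
Proof.
have hs : h != s by rewrite eq_sym.
have := nclasses_swap (face_inj Fw) hs glue_face_swap.
rewrite (fw_face Fw ls) addn0 addn1; exact.
Qed.

Section Move.

Variable m : seq (dart G).
Hypothesis tourG : tour_legs G = s :: rcons m t \/ tour_legs G = t :: rcons m s.
Hypothesis anc_st : anc s t.
Hypothesis nanc_ts : ~~ anc t s.

Let t_end : t \in tour_legs G.
Proof. by case: tourG => ->; rewrite inE mem_rcons !inE eqxx ?orbT. Qed.

Let th : t != h. Proof. by move: t_end; rewrite mem_tour => /and3P[]. Qed.
Let lt : is_leg t. Proof. by move: t_end; rewrite mem_tour => /and3P[]. Qed.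

Let ts : t != s.
Proof. by apply: contraNneq nanc_ts => ->; apply: (anc_refl (fw_cert Fw)). Qed.

(** The head-face splits at [h] and [s]; the part through [t] keeps exactly the legs between [s] and
    [t], and it contains [h] or [s] according to whether [s] came first or last. The third clause
    records that the new edge borders the new head-face, which later identifies it as a
    [crossing]. *)
Lemma glue_orbit : exists Y,
  [/\ orbit (@face_next G') t = t :: Y, [seq d <- Y | @is_leg G' d] = m
    & (h \in Y) || (s \in Y)].
Proof.
set X := behead (orbit (@face_next G) h).
have oX : orbit (@face_next G) h = h :: X := orbit_behead _ _.
have cX : fcycle (@face_next G) (h :: X) by rewrite -oX; apply: cycle_orbit; apply: face_inj Fw.
have uX : uniq (h :: X) by rewrite -oX orbit_uniq.
have fX : filter (@is_leg G) X = tour_legs G by [].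
have [gh gs gz] := glue_face_swap.
have nolegs Z : filter (@is_leg G) Z = [::] -> filter (@is_leg G') Z = [::].
  move=> fZ; apply/eqP; rewrite -[_ == _]negbK -has_filter; apply/hasPn => z zZ.
  rewrite glue_leg negb_and; apply/orP; left.
  apply/negP=> lz; have : z \in filter (@is_leg G) Z by rewrite mem_filter lz.
  by rewrite fZ.
have oldlegs Z : h \notin Z -> s \notin Z -> filter (@is_leg G') Z = filter (@is_leg G) Z.
  move=> hZ sZ; apply: eq_in_filter => z zZ; rewrite glue_leg.
  by rewrite (contraNneq _ hZ) ?(contraNneq _ sZ) ?andbT // => <-.
case: tourG => tG; rewrite tG in fX.
  have [X1 [R [eX f1]]] := filter_cons_split fX.
  move=> fR; have [X2 [X3 [eR f2 f3]]] := filter_rcons_split fR; rewrite eX eR in cX uX.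
  have [cY _] := fcycle_swap gh gs gz cX uX.
  have uY : uniq (h :: X2 ++ t :: X3).
    move: uX; rewrite /= mem_cat cat_uniq inE !negb_or => /and3P[/and3P[_ _ ->] _].
    by case/andP=> _ /andP[].
  have sX2 : s \notin X2.
    move: uX; rewrite /= cat_uniq => /and4P[_ _ _ /andP[+ _]].
    by rewrite mem_cat negb_or => /andP[].
  have hX2 : h \notin X2.
    by move: uY; rewrite /= mem_cat negb_or => /andP[/andP[]].
  exists (X3 ++ h :: X2); split.
  - have rc : rot (size (h :: X2)) (h :: X2 ++ t :: X3) = t :: X3 ++ h :: X2.
      by rewrite -cat_cons rot_size_cat.
    by apply: orbit_fcycle; rewrite -rc ?rot_cycle ?rot_uniq.
  - rewrite filter_cat (nolegs X3) //= glue_leg eqxx andbF /= oldlegs //.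
  - by rewrite mem_cat mem_head orbT.
have [X1 [R [eX f1]]] := filter_cons_split fX.
move=> fR; have [X2 [X3 [eR f2 f3]]] := filter_rcons_split fR.
have eX' : X = (X1 ++ t :: X2) ++ s :: X3 by rewrite eX eR -catA.
rewrite eX' in cX uX.
have [_ cY] := fcycle_swap gh gs gz cX uX.
have uY : uniq (s :: X1 ++ t :: X2).
  move: uX; rewrite /= cat_uniq => /and4P[_ uY /hasPn/(_ s) sX _].
  by rewrite uY sX ?mem_head.
have sX2 : s \notin X2.
  by move: uY; rewrite /= mem_cat inE !negb_or => /andP[/and3P[]].
have hX2 : h \notin X2.
  by move: uX; rewrite /= !mem_cat inE !negb_or => /andP[/andP[/and3P[]]].
exists (X2 ++ s :: X1); split.
- have rc : rot (size (s :: X1)) (s :: X1 ++ t :: X2) = t :: X2 ++ s :: X1.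
    by rewrite -cat_cons rot_size_cat.
  by apply: orbit_fcycle; rewrite -rc ?rot_cycle ?rot_uniq.
- by rewrite filter_cat /= glue_leg eqxx !andbF /= (nolegs X1) // cats0 oldlegs.
- by rewrite !mem_cat !inE eqxx !orbT.
Qed.

Lemma glue_tour : tour_legs G' = m.
Proof. by have [Y [oY fY _]] := glue_orbit; rewrite /tour_legs [head_leg G']/= oY. Qed.

Lemma glue_face_hs :
  fconnect (@face_next G') t h || fconnect (@face_next G') t s.
Proof.
have [Y [oY _ hsY]] := glue_orbit; rewrite !fconnect_orbit oY !inE.
by case/orP: hsY => ->; rewrite !orbT.
Qed.

Let leg_m d : @is_leg G' d -> d = t \/ d \in m.
Proof.
rewrite glue_leg => /and3P[ld dh ds]; have : d \in tour_legs G.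
  by rewrite mem_tour ld dh (fw_face Fw ld).
by case: tourG => ->; rewrite inE mem_rcons inE (negbTE ds) /=;
  case: (eqVneq d t); rewrite ?orbF; auto.
Qed.

(** By the valley property a leg between [s] and [t] hangs above one of them, hence above [t], the
    deeper one. *)
Let m_anc d : d \in m -> anc d t.
Proof.
move=> dm; suff : anc d s || anc d t.
  by case/orP=> // ds; apply: (tc_trans (fw_cert Fw)) ds anc_st.
have sub a b : subseq [:: a; d; b] (a :: rcons m b).
  by rewrite /= eqxx -cats1 (cat_subseq (s1 := [:: d])) // ?sub1seq.
have := fw_valley Fw; case: tourG => ->.
  exact.
by move=> val; rewrite orbC; apply: val.
Qed.

Lemma glue_forward : forward (Lc :: w) (G := G') anc st.
Proof.
have C := fw_cert Fw.
have t_nonroot : ~~ anc t (root_dart G).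
  by apply: contra nanc_ts => tr; apply: (tc_trans C) tr (tc_root C s).
split.
- exact: (fw_vinj Fw).
- exact: glue_oppK.
- exact: glue_cert.
- exact: (fw_rootdeg Fw).
- exact: (fw_deg Fw).
- by rewrite glue_leg lt th ts.
- by apply: contraNneq t_nonroot => tr; have -> : t = root_dart G := tr; apply: (tc_root C).
- by [].
- move=> d ld; have [Y [oY fY _]] := glue_orbit.
  rewrite fconnect_orbit oY inE; case: (leg_m ld) => [->|]; first by rewrite eqxx.
  by rewrite -fY mem_filter => /andP[_ ->]; rewrite orbT.
- by move=> d dT; rewrite glue_leg negb_and (fw_tree Fw dT).
- exact: (fw_root_tree Fw).
- move=> d /leg_m[->|]; [exact: (anc_refl C)|exact: m_anc].
- move=> d e; rewrite !glue_leg => /and3P[ld dh _] /and3P[le eh _] _ _.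
  exact: (fw_legs Fw).
- move=> x y z; rewrite glue_tour => sub; apply: (fw_valley Fw).
  apply: subseq_trans sub _; case: tourG => ->;
    by rewrite -cats1 -cat1s catA; apply: subseq_trans (prefix_subseq _ _); apply: suffix_subseq.
- move=> d dT; rewrite glue_oppE; case: (eqVneq d h) => [->|dh].
    by rewrite (fw_anc Fw ls) orbT.
  by case: (eqVneq d s) => [->|ds]; rewrite ?(fw_anc Fw ls) // (fw_comp Fw dT).
(* The subtree of a vertex not above the new head [t] will not grow any more. If the vertex was
   above the former head, the new edge from [h] to [s] leaves its subtree, as an ancestor of [s] is
   one of [t]. *)
- move=> u nu nt; have [uh|nuh] := boolP (anc u h).
    exists h; rewrite glue_leg eqxx andbF glue_oppE eqxx uh; split=> //.
      by apply/negP=> /(fw_tree Fw); rewrite (fw_head Fw).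
    by apply: contra nt => us; apply: (tc_trans C) us anc_st.
  have [d [ld dT ud uod]] := fw_bridge Fw nu nuh; exists d.
  rewrite glue_leg (negbTE ld) glue_oppE !ifN //; apply: contraNneq ld => ->.
    exact: ls.
  exact: (fw_head Fw).
- have := fw_root Fw; rewrite suffix_kreweras_cons !count_letter.
  case: ifP => kw; last by rewrite !andbF glue_leg negb_and => ->.
  case=> F [B [tG sF sB]]; rewrite andbT.
  have rt : root_dart G != t by apply: contraNneq t_nonroot => <-; apply: (tc_root C).
  have rs_notleg : root_dart G = s -> ~~ @is_leg G' (root_dart G').
    by move=> rs; rewrite glue_leg /= rs eqxx !andbF.
  (* If the front block is empty, the root is the first leg. It cannot be [t], which is not at the
     root-vertex, so it is [s] and gets glued, at the very letter where the count of [c] overtakes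
     that of [a]. *)
  case: F tG sF => [|x F] tG sF.
    rewrite -sF ltnn; apply: rs_notleg.
    by case: tourG tG => -> [e _] //; rewrite e eqxx in rt.
  have {}sF : (size F).+1 + nc w = na w := sF.
  case/lastP: B tG sB => [|B y] tG sB.
    rewrite -sB ltnn andbF; apply: rs_notleg.
    move: tG; rewrite cats1 rcons_cons; case: tourG => -> [_ /rcons_inj[_ e]] //.
    by rewrite e eqxx in rt.
  have -> : (nc w < na w) && (nc w < nb w).
    by move: sF sB; rewrite size_rcons; lia.
  exists F, B; rewrite glue_tour; split; last 2 first.
  + by rewrite addnS -addSn.
  + by move: sB; rewrite size_rcons addnS -addSn.
  move: tG; rewrite -rcons_cons -rcons_cat /=.
  by case: tourG => -> [_ /rcons_inj[->]].
- have := fw_size Fw; rewrite glue_tour !count_letter.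
  by case: tourG => ->; rewrite /= size_rcons; lia.
- by rewrite !count_letter; apply: (fw_darts Fw).
- by rewrite glue_faces !count_letter (fw_faces Fw).
Qed.

End Move.

End Glue.

(** The ancestors of the head-vertex form a chain, and distinct legs other than the head hang from
    distinct vertices, so the two end legs are always comparable and [phi_c] is defined. *)
Lemma phi_c_glue w G anc st : @forward w G anc st -> 1 < size (tour_legs G) ->
  exists s t m, [/\ is_leg s && (s != head_leg G),
    tour_legs G = s :: rcons m t \/ tour_legs G = t :: rcons m s,
    anc s t, ~~ anc t s & phi_c G = Some (glue_and_move s t)].
Proof.
move=> Fw; have C := fw_cert Fw; rewrite /phi_c.
have inT d : d \in tour_legs G -> [/\ is_leg d, d != head_leg G & anc d (head_leg G)].
  by rewrite mem_tour => /and3P[ld dh _]; split=> //; apply: (fw_anc Fw).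
have := uniq_tour G; case E: (tour_legs G) inT => [|x l] //.
case/lastP: l E => // m y E inT; rewrite last_rcons => /andP[xm _] _.
have [lx xh ax] := inT x (mem_head _ _).
have [ly yh ay] : [/\ is_leg y, y != head_leg G & anc y (head_leg G)].
  by apply: inT; rewrite inE mem_rcons mem_head orbT.
have nxy : x != y by apply: contraNneq xm => ->; rewrite mem_rcons mem_head.
have nsv : ~~ fconnect (@vrot G) x y.
  by apply: contraNN nxy => /(fw_legs Fw lx ly xh yh)->.
rewrite (vertex_eq _ _ (fw_vinj Fw)) (negbTE nsv).
have A d e := asbool_equiv_eq (ancestorP (fw_vinj Fw) (fw_oppK Fw) C d e).
rewrite !A !asboolb; have [xy|nxy'] := boolP (anc x y).
  exists x, y, m; split=> //; [by rewrite lx|by left|].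
  by apply: contra nsv => yx; apply: (anc_antisym C).
have yx : anc y x by have := anc_chain (fw_vinj Fw) C ax ay; rewrite (negbTE nxy').
by exists y, x, m; rewrite yx; split=> //; [rewrite ly|right].
Qed.

(** * The initial map and the maps of all suffixes *)

Lemma init_forward : @forward [::] init_map (fun _ _ => true) id.
Proof.
have fv (d e : bool) : fconnect negb d e.
  case: d; case: e; rewrite ?connect0 //.
    exact: (fconnect1 negb true).
  exact: (fconnect1 negb false).
have vE (d : dart init_map) : vertex d = setT by apply/setP=> e; rewrite !inE; apply: fv.
have fE (d e : bool) : fconnect (@face_next init_map) d e.
  by rewrite (@eq_fconnect _ _ negb) //; case.
have tE : tour_legs init_map = [:: false].
  rewrite /tour_legs (@orbit_fcycle _ _ (true : dart init_map) [:: false]) //=.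
split=> //.
- exact: (inv_inj negbK).
- split=> // [d e|d]; first by apply/esym/fv.
  by rewrite inE.
- by rewrite /root_vertex vE cardsT card_bool.
- by move=> d; rewrite /root_vertex !vE eqxx.
- by move=> d; rewrite inE.
- by rewrite inE.
- by case; case.
- by exists [::], [::].
- by rewrite tE.
- by rewrite card_bool.
- rewrite /faces (_ : [set face d | d : dart init_map] = [set setT]) ?cards1 //.
  apply/setP=> A; rewrite inE; apply/imsetP/eqP => [[d _ ->]|->].
    by apply/setP=> e; rewrite !inE fE.
  by exists true => //; apply/setP=> e; rewrite !inE fE.
Qed.

Lemma forward_word w : suffix_exc w ->
  exists G anc st, phi_word w init_map = Some G /\ @forward w G anc st.
Proof.
elim: w => [|x w IHw].
  by exists init_map, (fun _ _ => true), id; split=> //; apply: init_forward.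
rewrite suffix_exc_cons => /andP[cw /IHw[G [anc [st [Gw Fw]]]]].
rewrite /phi_word /= -/(phi_word w init_map) Gw /=.
case: x cw => cw /=.
- by eexists _, _, _; split; first reflexivity; apply: forward_a Fw.
- by eexists _, _, _; split; first reflexivity; apply: forward_b Fw.
- have [|s [t [m [/andP[ls sh] tG st1 nts ->]]]] := phi_c_glue Fw.
    by move: (fw_size Fw) cw; rewrite !count_letter; lia.
  by exists (glue_and_move s t), anc, st; split=> //; apply: (glue_forward Fw ls sh tG).
Qed.

(** The [+ 1] compensates for the root-vertex, of degree 2 instead of 3. *)
Lemma card_darts_near_cubic (M : hmap) : injective (@vrot M) -> near_cubic2 M ->
  #|dart M| + 1 = 3 * #|vertices M|.
Proof.
move=> vinj [r2 d3]; rewrite -cardsT.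
have part : partition (vertices M) [set: dart M].
  apply/and3P; split.
  - rewrite eqEsubset subsetT /=; apply/subsetP=> d _.
    by apply/bigcupP; exists (vertex d); rewrite ?imset_f // inE connect0.
  - apply/trivIsetP=> A B /imsetP[d _ ->] /imsetP[e _ ->]; apply: contraNT.
    case/pred0Pn=> x /andP[/=]; rewrite !inE => dx ex; rewrite vertex_eq //.
    by apply: connect_trans dx _; rewrite fconnect_sym.
  - by apply/imsetP=> -[d _ /setP/(_ d)]; rewrite !inE connect0.
have rV : root_vertex M \in vertices M by rewrite imset_f.
rewrite (card_partition part) (big_setD1 _ rV) /= r2 (cardsD1 (root_vertex M)) rV.
rewrite (eq_bigr (fun=> 3)) => [|A]; first by rewrite sum_nat_const; lia.
by rewrite !inE => /andP[nr /imsetP[d _ eA]]; rewrite eA in nr *; apply: d3.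
Qed.

(** * Closing the last two legs *)

Section Closed.

Variables (w : word) (G : growing_map) (anc : rel (dart G)) (st : dart G -> dart G).
Hypothesis Fw : forward w anc st.
Variable s : dart G.
Hypothesis tourG : tour_legs G = [:: s].

Notation M := (glue s).
Notation h := (head_leg G).

Let s_end : s \in tour_legs G. Proof. by rewrite tourG mem_head. Qed.
Let sh : s != h. Proof. by move: s_end; rewrite mem_tour => /and3P[]. Qed.
Let ls : is_leg s. Proof. by move: s_end; rewrite mem_tour => /and3P[]. Qed.

Lemma closed_noleg (d : dart M) : ~~ is_leg d.
Proof.
rewrite (@glue_leg _ s s sh); apply/and3P=> -[ld dh ds].
have : d \in tour_legs G by rewrite mem_tour ld dh (fw_face Fw ld).
by rewrite tourG inE (negbTE ds).
Qed.

Lemma closed_oppK : involutive (@opp M).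
Proof. exact (glue_oppK Fw (t := s) ls sh). Qed.

Lemma closed_cert : @tree_cert M anc st.
Proof. exact: (glue_cert Fw s ls). Qed.

Lemma closed_vinj : injective (@vrot M).
Proof. exact: (fw_vinj Fw). Qed.

Lemma closed_near_cubic : near_cubic2 M.
Proof. by split; [exact: (fw_rootdeg Fw)|exact: (fw_deg Fw)]. Qed.

Lemma closed_edges : #|edges M| = 3 * nc w + 1.
Proof.
have := card_edges closed_oppK closed_noleg; have := fw_size Fw; rewrite tourG.
have e : #|dart M| = 2 + 3 * (na w + nb w) := fw_darts Fw.
by rewrite e /=; lia.
Qed.

Lemma connected_byW (N : hmap) (S S' : {set dart N}) :
  S \subset S' -> connected_by S -> connected_by S'.
Proof.
move=> sub con d e; apply: connect_sub (con d e) => U V /existsP[x /and3P[xS xU xV]].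
by apply: connect1; apply/existsP; exists x; rewrite xU xV (subsetP sub).
Qed.

(** Writing [c] for [nc w], there are [2c + 1] vertices, [3c + 1] edges and [c + 2] faces: the
    initial face and one more for each gluing, the closing one included. *)
Lemma closed_planar : planar_map M.
Proof.
have cT := cert_connected closed_vinj closed_oppK closed_cert.
split; first exact: closed_vinj; first by split; [exact: closed_oppK|exact: closed_noleg].
  by apply: connected_byW cT; apply: subsetT.
have := card_darts_near_cubic closed_vinj closed_near_cubic.
have fE : #|faces M| = (nc w).+2 by rewrite (glue_faces Fw s ls sh) (fw_faces Fw).
rewrite closed_edges fE.
have e : #|dart M| = 2 + 3 * (na w + nb w) := fw_darts Fw.
have := fw_size Fw; rewrite tourG e [size _]/=; lia.
Qed.

Lemma closed_comp (d : dart M) : d \notin tree M -> anc d (opp d) || anc (opp d) d.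
Proof.
move=> dT; rewrite (glue_oppE s s); case: (eqVneq d h) => [->|dh].
  by rewrite (fw_anc Fw ls) orbT.
by case: (eqVneq d s) => [->|ds]; rewrite ?(fw_anc Fw ls) // (fw_comp Fw dT).
Qed.

Lemma closed_depth : depth_map M.
Proof.
split; first exact: closed_planar.
have C := closed_cert; split.
- exact: (cert_spanning closed_vinj closed_oppK C).
- move=> d dT; have aP := ancestorP closed_vinj closed_oppK C.
  by case/orP: (closed_comp dT) => /aP; [left|right].
- exact: (fw_root_tree Fw).
Qed.

Lemma closed_marked : marked_depth_map (@MarkedMap M [set h; s]).
Proof.
split; first exact: closed_depth.
exists h; first by apply/negP=> /(fw_tree Fw); rewrite (fw_head Fw).
by rewrite /edge [opp _](glue_oppE s s) eqxx.
Qed.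

Lemma closed_root_edge : [set h; s] = root_edge M <-> s = root_dart G.
Proof.
split=> [E|->].
  have : root_dart G \in [set h; s] by rewrite E; exact: set21.
  by rewrite !inE eq_sym (negbTE (fw_head_root Fw)) => /eqP.
rewrite /root_edge /edge [opp _](glue_oppE (root_dart G) s).
by rewrite eq_sym (negbTE (fw_head_root Fw)) eqxx setUC.
Qed.

(** The subtree of a nonroot vertex above the last head is left by the closing edge, whose other end
    is at the root-vertex; for the other vertices [fw_bridge] has already supplied an edge. *)
Lemma closed_bridgeless : s = root_dart G -> bridgeless M.
Proof.
move=> sr; apply: (cert_bridgeless closed_vinj closed_oppK closed_cert) => u nu.
have [uh|nuh] := boolP (anc u h).
  exists h; rewrite (glue_oppE s s) eqxx sr; split=> //.
  by apply/negP=> /(fw_tree Fw); rewrite (fw_head Fw).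
have [e [le eT ue nue]] := fw_bridge Fw nu nuh; exists e.
by rewrite (glue_oppE s s) !ifN //; apply: contraNneq le => ->; [exact: ls|exact: (fw_head Fw)].
Qed.

End Closed.

Lemma PhiE w G s : phi_word w init_map = Some G -> tour_legs G = [:: s] ->
  Phi w = Some (@MarkedMap (glue s) [set head_leg G; s]).
Proof. by rewrite /Phi => -> /= E; rewrite /close E. Qed.

(** * From prefix conditions to suffix conditions *)

Lemma suffix_excP w : suffix_exc w <-> forall u v, w = u ++ v -> 2 * nc v <= na v + nb v.
Proof.
split.
  elim: w => [|x w IHw]; first by move=> _ [|? ?] [|? ?].
  rewrite suffix_exc_cons => /andP[xw /IHw{}IHw] [|y u] v; first by move=> /= <-.
  by case=> _ /IHw.
elim: w => // x w IHw H; rewrite suffix_exc_cons (H [::]) //= IHw // => u v e.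
by apply: (H (x :: u)); rewrite e.
Qed.

Lemma suffix_krewerasE w : suffix_kreweras w <->
  forall u v, w = u ++ v -> nc v <= na v /\ nc v <= nb v.
Proof.
split.
  elim: w => [|x w IHw]; first by move=> _ [|? ?] [|? ?].
  rewrite suffix_kreweras_cons => /and3P[xa xb /IHw{}IHw] [|y u] v; first by move=> /= <-.
  by case=> _ /IHw.
elim: w => // x w IHw H; have [xa xb] := H [::] (x :: w) erefl.
rewrite suffix_kreweras_cons xa xb IHw // => u v e.
by apply: (H (x :: u)); rewrite e.
Qed.

Lemma excursionE w : excursion w <-> suffix_exc w /\ na w + nb w = 2 * nc w.
Proof.
split=> [[pre tot]|[/suffix_excP suf tot]]; split=> //.
  apply/suffix_excP => u v e; have := pre u; rewrite e prefix_prefix => /(_ isT).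
  by move: tot; rewrite e !count_cat; lia.
move=> u /prefixP[v e]; have := suf u v e; move: tot; rewrite e !count_cat; lia.
Qed.

Lemma krewerasE w : kreweras w <-> [/\ suffix_kreweras w, na w = nc w & nb w = nc w].
Proof.
split=> [[pre ta tb]|[/suffix_krewerasE suf ta tb]]; split=> //.
  apply/suffix_krewerasE => u v e; have := pre u; rewrite e prefix_prefix => /(_ isT).
  by move: ta tb; rewrite e !count_cat; lia.
move=> u /prefixP[v e]; have := suf u v e; move: ta tb; rewrite e !count_cat; lia.
Qed.

Lemma size_word w : size w = na w + nb w + nc w.
Proof.
elim: w => // x w IHw; rewrite -[size (x :: w)]/(size w).+1 IHw.
by case: x; rewrite !count_letter; lia.
Qed.

(** One leg remains at the end. If it is the root, both blocks of [fw_root] are empty, which yields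
    the two equalities of a Kreweras walk; conversely a Kreweras walk never consumes the root. *)
Lemma excursion_Phi w : excursion w -> exists G anc st s,
  [/\ phi_word w init_map = Some G, @forward w G anc st, tour_legs G = [:: s]
    & s = root_dart G <-> kreweras w].
Proof.
move=> /excursionE[/forward_word[G [anc [st [Gw Fw]]]] tot].
have := fw_size Fw; case E: (tour_legs G) => [|s [|s' l]]; rewrite [size _]/= => sz; try lia.
exists G, anc, st, s; split=> //.
split=> [sr|/krewerasE[kw ta tb]]; have := fw_root Fw.
  have lr : is_leg (root_dart G).
    have : s \in tour_legs G by rewrite E mem_head.
    by rewrite mem_tour sr => /and3P[].
  case: ifP => [kw|_]; last by rewrite lr.
  case=> F [B [tG sF sB]]; apply/krewerasE.
  by move: tG; rewrite E; case: F sF => [|? []] //= sF [_ B0]; rewrite -B0 /= in sB; split=> //.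
rewrite kw => -[F [B [tG sF sB]]]; move: tG; rewrite E.
by case: F sF => [|? F] sF; [case|move: sF; rewrite ta => /=; lia].
Qed.

(** * Undoing the growth inside a fixed depth-map *)

Section Undo.

Variables (N : tree_map) (anc : rel (dart N)) (st : dart N -> dart N).
Hypothesis vrot_inj : injective (@vrot N).
Hypothesis oppK : involutive (@opp N).
Hypothesis opp_neq : forall d : dart N, opp d != d.
Hypothesis C : tree_cert anc st.
Hypothesis planar : #|vertices N| + #|faces N| = #|edges N| + 2.
Hypothesis cubic : near_cubic2 N.
Hypothesis root_ext : root_dart N \notin tree N.
Hypothesis comp : forall d, d \notin tree N -> anc d (opp d) || anc (opp d) d.

Notation D := (dart N).
Notation T := (tree N).
Notation sv := (fconnect (@vrot N)).
Notation root := (root_dart N).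
Notation nonroot d := (~~ anc d root).
Implicit Types (L : {set D}) (d x y h u v : D).

(* [L] is the set of the half-edges of the edges cut so far; the part of the map
   that remains attached to the root-vertex consists of the active half-edges. *)
Definition active L d := anc d root || (st d \notin L).

(** Counterpart of [forward] inside [N], with no word involved. By [va_st] a vertex whose stem is
    cut has lost all its edges; [va_root] keeps the root a leg at every stage, and [va_bridge] is
    what allows a letter [c] to be undone. *)
Record valid L h : Prop := Valid {
  va_opp : opp_closed L;
  va_root : root \in L;
  va_head : h \in L;
  va_head_root : h != root;
  va_st : forall d, nonroot d -> st d \in L -> d \in L;
  va_act : active L h;
  va_anc : forall l, active L l -> l \in L -> anc l h;
  va_face : forall l, active L l -> l \in L -> fconnect (cut_face L) h l;
  va_bridge : forall u, nonroot u -> active L u -> ~~ anc u h ->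
    exists d, [/\ d \notin L, d \notin T, anc u d & ~~ anc u (opp d)] }.

Let svC := svC vrot_inj.

Lemma T_oppE d : (opp d \in T) = (d \in T).
Proof. by apply/idP/idP => [/(tc_opp C)|/(tc_opp C)//]; rewrite oppK. Qed.

Lemma nonroot_card d : nonroot d -> #|vertex d| = 3.
Proof.
move=> nd; apply: cubic.2; apply: contra nd => /eqP e.
have : sv root d by rewrite -vertex_eq // e.
by rewrite svC => /(anc_sv C).
Qed.

Lemma nonroot_darts d : nonroot d ->
  [/\ vrot (vrot (vrot d)) = d, uniq [:: d; vrot d; vrot (vrot d)]
    & forall e, sv d e = (e \in [:: d; vrot d; vrot (vrot d)])].
Proof.
move=> nd; have o3 : order (@vrot N) d = 3.
  by rewrite -(nonroot_card nd) /vertex cardsE; apply: eq_card => e; rewrite inE.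
have oE : orbit (@vrot N) d = [:: d; vrot d; vrot (vrot d)] by rewrite /orbit o3.
split=> [||e]; last by rewrite -oE fconnect_orbit.
  by have := iter_order vrot_inj d; rewrite o3.
by rewrite -oE orbit_uniq.
Qed.

Lemma root_darts d : anc d root -> d = root \/ d = vrot root.
Proof.
move=> dr; have o2 : order (@vrot N) root = 2.
  by rewrite -cubic.1 /root_vertex /vertex cardsE; apply: eq_card => e; rewrite inE.
have : sv root d by apply: (anc_antisym C) => //; apply: (tc_root C).
by rewrite fconnect_orbit /orbit o2 !inE => /orP[]/eqP; auto.
Qed.

Lemma active_sv L d e : sv d e -> active L d = active L e.
Proof.
move=> de; rewrite /active (anc_svl vrot_inj C _ de).
have [//|ne] := boolP (anc e root); rewrite -(nonroot_sv vrot_inj C de) in ne.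
by rewrite (tc_st_eq C ne de).
Qed.

Lemma connect_up L u x : anc u x ->
  (forall y, anc y x -> ~~ anc y u -> st y \notin L) -> connect (cut_rel L) x u.
Proof.
elim/(tree_ind C): x => x IHx ux H; have [xu|nxu] := boolP (anc x u).
  by apply: connect_cut_vrot; apply: (anc_antisym C).
have nx : nonroot x.
  by apply: contra nxu => xr; apply: (tc_trans C) xr (tc_root C u).
have up : anc u (opp (st x)).
  move: ux; rewrite (tc_st_anc C _ nx) svC => /orP[/(anc_sv C)|//].
  by rewrite (negbTE nxu).
apply: connect_trans (connect_cut_vrot _ (tc_st_sv C nx)) _.
apply: connect_trans (connect_cut_opp (H x (anc_refl C x) nxu)) _.
apply: IHx => // y yp; apply: H; apply: (tc_trans C) yp (anc_par C nx).
Qed.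

Lemma connected0 x y : connect (cut_rel set0) x y.
Proof.
have c0 : opp_closed (set0 : {set D}) by move=> d; rewrite !inE.
have up z : connect (cut_rel set0) z root.
  by apply: connect_up => [|y' _ _]; [apply: (tc_root C)|rewrite inE].
by apply: connect_trans (up x) _; rewrite (cut_rel_sym vrot_inj oppK c0).
Qed.

Lemma stem_crossing v d : d \in T -> anc v d -> ~~ anc v (opp d) -> nonroot v /\ st v = d.
Proof.
move=> dT vd nvd; case: (tc_tree C dT) => -[nd sd]; last first.
  by case/negP: nvd; rewrite (tc_st_anc C _ nd) sd oppK vd orbT.
move: vd; rewrite (tc_st_anc C _ nd) sd (negbTE nvd) orbF => vd.
by split; [rewrite (nonroot_sv vrot_inj C vd)|rewrite -(tc_st_eq C nd) // svC].
Qed.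

(** * One step backwards from a valid state *)

Section State.

Variables (L : {set D}) (h : D).
Hypothesis V : valid L h.

Let cL := va_opp V.

Lemma active_notin d : d \notin L -> active L d.
Proof.
move=> dL; rewrite /active; have [//|nd /=] := boolP (anc d root).
by apply: contra dL; apply: (va_st V).
Qed.

(** [active] tests only the stem of the vertex itself. This suffices: a cut stem forces, by [va_st]
    and closure under [opp], the stems of the children to be cut. *)
Lemma active_anc x d : anc x d -> active L d -> active L x.
Proof.
elim/(tree_ind C): d => d IHd xd ad; have [rd|nd] := boolP (anc d root).
  by rewrite /active (tc_trans C xd rd).
move: xd; rewrite (tc_st_anc C _ nd) => /orP[xd|xd]; first by rewrite (active_sv _ xd).
apply: IHd => //; apply: active_notin; rewrite cL.
by move: ad; rewrite /active (negbTE nd).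
Qed.

Lemma active_st d : nonroot d -> active L d -> st d \notin L.
Proof. by move=> nd; rewrite /active (negbTE nd). Qed.

Lemma connect_root x L' : L \subset L' -> (forall y, nonroot y -> st y \in L' -> st y \in L) ->
  active L x -> connect (cut_rel L') x root.
Proof.
move=> sL stL ax; apply: connect_up => [|y yx ny]; first exact: (tc_root C).
by apply: contra (active_st ny (active_anc yx ax)); apply: stL.
Qed.

(** The tree still joins every active vertex to the root when an external edge is cut. *)
Lemma connect_ext d : d \notin L -> d \notin T ->
  connect (cut_rel (L :|: edge d)) d (opp d).
Proof.
move=> dL dT; have cLd := opp_closedU oppK d cL.
have H x : x \notin L -> connect (cut_rel (L :|: edge d)) x root.
  move=> xL; apply: connect_root; [exact: subsetUl| |exact: active_notin].
  move=> y ny; rewrite in_setU in_edge => /or3P[//|/eqP e|/eqP e].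
    by rewrite -e (tc_st_tree C ny) in dT.
  by rewrite -T_oppE -e (tc_st_tree C ny) in dT.
by apply: connect_trans (H d dL) _; rewrite (cut_rel_sym vrot_inj oppK cLd) H ?cL.
Qed.

Section Subtree.

Variable v : D.

(** Tree paths connect the subtree of [v] within itself, and its complement to the root; so the
    edges leaving the subtree form a bond, as [bond_face] requires. *)
Lemma subtree_connected x y : x \notin L -> y \notin L -> anc v x = anc v y ->
  connect (cut_rel (L :|: [set d | anc v d != anc v (opp d)])) x y.
Proof.
move=> xL yL vxy; set X := [set d | _].
have cLX : opp_closed (L :|: X) by move=> d; rewrite !inE cL oppK eq_sym.
have below z : z \notin L -> anc v z -> connect (cut_rel (L :|: X)) z v.
  move=> zL vz; apply: connect_up => // y' yz nyv.
  have vy : anc v y' by have := anc_chain vrot_inj C vz yz; rewrite (negbTE nyv) orbF.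
  have ny : nonroot y' by apply: contra nyv => yr; apply: (tc_trans C) yr (tc_root C v).
  have vp : anc v (opp (st y')).
    move: (vy); rewrite (tc_st_anc C _ ny) svC => /orP[/(anc_sv C)|//].
    by rewrite (negbTE nyv).
  rewrite !inE vp -(anc_svr vrot_inj C _ (tc_st_sv C ny)) vy eqxx orbF.
  by apply: active_st => //; apply: active_anc yz _; apply: active_notin.
have outside z : z \notin L -> ~~ anc v z -> connect (cut_rel (L :|: X)) z root.
  move=> zL vz; apply: connect_up => [|y' yz ny]; first exact: (tc_root C).
  have vy : ~~ anc v y' by apply: contra vz => vy; apply: (tc_trans C) vy yz.
  have vp : ~~ anc v (opp (st y')).
    by apply: contra vy => vp; apply: (tc_trans C) vp (anc_par C ny).
  rewrite !inE (negbTE vp) -(anc_svr vrot_inj C _ (tc_st_sv C ny)) (negbTE vy) eqxx orbF.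
  by apply: active_st => //; apply: active_anc yz _; apply: active_notin.
have [vx|nvx] := boolP (anc v x).
  apply: connect_trans (below x xL vx) _.
  by rewrite (cut_rel_sym vrot_inj oppK cLX) below // -vxy.
apply: connect_trans (outside x xL nvx) _.
by rewrite (cut_rel_sym vrot_inj oppK cLX) outside // -vxy.
Qed.

Lemma out_unique d1 d2 : d1 \notin L -> anc v d1 -> ~~ anc v (opp d1) ->
  d2 \notin L -> anc v d2 -> ~~ anc v (opp d2) -> fconnect (cut_face L) d1 d2 -> d1 = d2.
Proof.
apply: (@bond_face N vrot_inj oppK opp_neq planar connected0 L (anc v)) => //.
  by move=> d; rewrite (anc_svr vrot_inj C _ (fconnect1 _ d)).
exact: subtree_connected.
Qed.

Lemma in_unique d1 d2 : d1 \notin L -> ~~ anc v d1 -> anc v (opp d1) ->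
  d2 \notin L -> ~~ anc v d2 -> anc v (opp d2) -> fconnect (cut_face L) d1 d2 -> d1 = d2.
Proof.
move=> d1L v1 vo1 d2L v2 vo2.
apply: (@bond_face N vrot_inj oppK opp_neq planar connected0 L (fun d => ~~ anc v d));
  rewrite ?negbK //.
  by move=> d; rewrite (anc_svr vrot_inj C _ (fconnect1 _ d)).
move=> x y xL yL /negb_inj vxy.
rewrite (_ : [set d | _] = [set d | anc v d != anc v (opp d)]); first exact: subtree_connected.
by apply/setP=> d; rewrite !inE (inj_eq negb_inj).
Qed.

End Subtree.

Hypothesis nh : nonroot h.
Notation p := (st h).

Let svp : sv h p := tc_st_sv C nh.
Let pT : p \in T := tc_st_tree C nh.
Let pL : p \notin L := active_st nh (va_act V).
Let nhp : ~~ anc h (opp p) := tc_st_lt C nh.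
Let hp : anc h p := anc_sv C svp.

(** The cyclic order of head, stem and third half-edge distinguishes [a] from [b]; for [c] it
    decides which side of the stem borders the head-face next to the head. *)
Lemma head_darts :
  (vrot h = p /\ vrot (vrot p) = h /\ (forall e, sv h e -> [|| e == h, e == p | e == vrot p])) \/
  (vrot (vrot h) = p /\ vrot p = h /\ (forall e, sv h e -> [|| e == h, e == p | e == vrot h])).
Proof.
have [v3 un svE] := nonroot_darts nh.
have: p \in [:: h; vrot h; vrot (vrot h)] by rewrite -svE.
have ph : (p == h) = false by apply: contraNF pL => /eqP->; apply: va_head V.
rewrite !inE ph /= => /orP[]/eqP ep; [left|right]; rewrite ep; split=> //; split=> // e;
  rewrite svE !inE //.
by case/or3P=> ->; rewrite ?orbT.
Qed.

(** The two half-edges other than the stem being cut already, cutting the stem detaches the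
    head-vertex entirely. This undoes [a] or [b]. *)
Lemma undo_leg x : x \in L -> sv h x -> x != h -> valid (L :|: edge p) (opp p).
Proof.
move=> xL hx xh.
have cL' := opp_closedU oppK p cL.
have opp_p_st y : nonroot y -> st y != opp p.
  move=> ny; apply: contraTneq (anc_par C ny) => e; rewrite e oppK.
  apply: contra nhp => py.
  rewrite (anc_svl vrot_inj C _ svp) -e -(anc_svr vrot_inj C _ (tc_st_sv C ny)) //.
have ap : active L (opp p) by apply: active_notin; rewrite cL.
have act' d : active (L :|: edge p) d -> active L d /\ ~~ sv h d.
  rewrite /active !inE; have [rd _|nd /=] := boolP (anc d root).
    by split=> //; apply: contra nh => hd; rewrite (anc_svl vrot_inj C _ hd).
  rewrite !negb_or => /and3P[-> np _]; split=> //.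
  by apply: contra np => hd; rewrite (tc_st_eq C nh hd).
have actI d : active L d -> ~~ sv h d -> active (L :|: edge p) d.
  move=> ad hd; rewrite /active; have [//|nd] := boolP (anc d root).
  rewrite !inE (negbTE (active_st nd ad)) (negbTE (opp_p_st d nd)) orbF /=.
  apply: contra hd => /eqP e; apply: connect_trans svp _.
  by rewrite -e svC (tc_st_sv C nd).
have nsvp : ~~ sv h (opp p) by apply: contra nhp => /(anc_sv C).
have ap' : active (L :|: edge p) (opp p) by apply: actI.
have hdarts e : sv h e -> [|| e == h, e == p | e == x].
  have [_ un svE] := nonroot_darts nh; move: svp hx; rewrite !svE !inE.
  have ph : (p == h) = false by apply: contraNF pL => /eqP->; apply: va_head V.
  have px : p != x by apply: contraNneq pL => ->.
  rewrite ph (negbTE xh) /=.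
  by move=> /orP[]/eqP ep /orP[]/eqP ex; move: px; rewrite ?ep ?ex ?eqxx // => _;
    case/or3P=> ->; rewrite ?orbT.
split=> //.
- by rewrite !inE (va_root V).
- by rewrite !inE eqxx !orbT.
- by apply: contraNneq root_ext => <-; rewrite T_oppE.
- move=> d nd; rewrite !inE (negbTE (opp_p_st d nd)) orbF => /orP[/(va_st V nd)->//|/eqP e].
  have hd : sv h d.
    by apply: connect_trans svp _; rewrite -e svC (tc_st_sv C nd).
  by case/or3P: (hdarts d hd) => /eqP->; rewrite ?eqxx ?orbT ?(va_head V) ?xL.
- move=> l /act'[al nl]; rewrite !inE => /or3P[lL|/eqP e|/eqP e].
  + have := va_anc V al lL; rewrite (tc_st_anc C _ nh) svC (negbTE nl); exact.
  + by rewrite e svp in nl.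
  + by rewrite e (anc_refl C).
(* Follow the former head-face from [h]: away from the detached vertex the walk stays on the new
   head-face. *)
- move=> l al'; have [al nl] := act' l al'.
  rewrite !inE => /or3P[lL|/eqP e|/eqP->//]; last by rewrite e svp in nl.
  have := va_face V al lL => hl.
  suff : sv h l \/ fconnect (cut_face (L :|: edge p)) (opp p) l by case=> //; rewrite (negbTE nl).
  have [fp fop fz] := cut_face_swap oppK cL pL.
  apply: (fconnect_ind
    (P := fun z => sv h z \/ fconnect (cut_face (L :|: edge p)) (opp p) z) _ _ hl).
    by left.
  move=> z _ [hz|oz].
    case/or3P: (hdarts z hz) => /eqP ez; subst z.
    + by left; rewrite /cut_face /cut_opp (va_head V) fconnect1.
    + by right; rewrite -fop fconnect1.
    + left; rewrite /cut_face /cut_opp xL; exact: connect_trans hx (fconnect1 _ _).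
  have [zp|zp] := eqVneq z (opp p).
    left; rewrite zp /cut_face /cut_opp cL (negbTE pL) oppK.
    exact: connect_trans svp (fconnect1 _ _).
  have [zp'|zp'] := eqVneq z p.
    by right; rewrite zp' -fop fconnect1.
  by right; rewrite -fz //; apply: connect_trans oz (fconnect1 _ _).
- move=> u nu au' nup; have [au nhu] := act' u au'.
  have nuh : ~~ anc u h.
    by rewrite (tc_st_anc C _ nh) negb_or nup andbT svC.
  have [d [dL dT ud nud]] := va_bridge V nu au nuh.
  exists d; split=> //; rewrite !inE !negb_or dL /=; apply/andP; split.
    by apply: contraNneq dT => ->.
  by apply: contraNneq dT => ->; rewrite T_oppE.
Qed.

(** The candidate edges for undoing [c]. The half-edge [d] below the head-vertex becomes the head,
    and at least one side of the edge must border the current head-face. *)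
Definition crossing d :=
  [/\ d \notin L, d \notin T, anc h d, ~~ anc h (opp d)
    & fconnect (cut_face L) h d || fconnect (cut_face L) h (opp d)].

Let inj_f := cut_face_inj vrot_inj oppK cL.
Let fsym := fconnect_sym inj_f.

(** The edge is not a bridge, so its sides belong to two faces, which the cut merges; all legs thus
    remain on one face. *)
Lemma undo_glue d : crossing d -> valid (L :|: edge d) d.
Proof.
case=> dL dT hd nhd fd.
have nf := sides_disconnected vrot_inj oppK opp_neq planar connected0 cL dL (connect_ext dL dT).
have sw := cut_face_swap oppK cL dL.
have inj_f' := cut_face_inj vrot_inj oppK (opp_closedU oppK d cL).
have stE y : nonroot y -> (st y \in L :|: edge d) = (st y \in L).
  move=> ny; rewrite !inE; case: eqP => [e|_].
    by rewrite -e (tc_st_tree C ny) in dT.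
  case: eqP => [e|_]; last by rewrite !orbF.
  by rewrite -T_oppE -e (tc_st_tree C ny) in dT.
have act' y : active (L :|: edge d) y = active L y.
  by rewrite /active; have [//|ny] := boolP (anc y root); rewrite stE.
have odh : anc (opp d) d.
  have := comp dT; case/orP=> // dod.
  by case/negP: nhd; apply: (tc_trans C) hd dod.
split.
- exact: opp_closedU.
- by rewrite inE (va_root V).
- by rewrite !inE eqxx orbT.
- by apply: contraNneq dL => ->; apply: (va_root V).
- by move=> y ny; rewrite stE // inE => /(va_st V ny)->.
- by rewrite act' active_notin.
- move=> l; rewrite act' !inE => al /or3P[lL|/eqP->|/eqP->//].
    by apply: (tc_trans C) (va_anc V al lL) hd.
  exact: (anc_refl C).
- have dod : fconnect (cut_face (L :|: edge d)) d (opp d) by apply: fconnect_swap nf.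
  have hd' : fconnect (cut_face (L :|: edge d)) d h.
    case/orP: fd => /(fconnect_merge inj_f sw nf); rewrite (fconnect_sym inj_f') //.
    exact: connect_trans dod.
  move=> l; rewrite act' !inE => al /or3P[lL|/eqP->|/eqP->] //.
  by apply: connect_trans hd' _; apply: fconnect_merge inj_f sw nf _; apply: (va_face V).
- move=> u nu; rewrite act' => au nud.
  have nuh : ~~ anc u h by apply: contra nud => uh; apply: (tc_trans C) uh hd.
  have [e [eL eT ue nue]] := va_bridge V nu au nuh.
  exists e; split=> //; rewrite !inE !negb_or eL /=; apply/andP; split.
    by apply: contraNneq nud => <-.
  by apply: contraNneq nud => eo; apply: (tc_trans C) ue _; rewrite eo.
Qed.

(** One side of the stem is either the successor of the head along its face or its predecessor. *)
Let p_side : fconnect (cut_face L) h p \/ fconnect (cut_face L) h (opp p).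
Proof.
have f1 := fconnect1 (cut_face L) h.
case: head_darts => [[hp' _]|[_ [ph _]]].
  by left; move: f1; rewrite {2}/cut_face /cut_opp (va_head V) hp'.
right; rewrite fsym; have := fconnect1 (cut_face L) (opp p).
by rewrite {2}/cut_face /cut_opp cL (negbTE pL) oppK ph.
Qed.

(** The stem uses up one direction. If it leaves the subtree along the head-face, a crossing edge
    can border that face only by its entering side, and conversely; uniqueness in that remaining
    direction finishes. *)
Lemma crossing_unique d1 d2 : crossing d1 -> crossing d2 -> d1 = d2.
Proof.
case=> d1L d1T hd1 nhd1 f1 [d2L d2T hd2 nhd2 f2].
have pneq d : d \notin T -> d <> p by move=> dT e; rewrite e pT in dT.
have popneq d : d \notin T -> opp d <> opp p.
  by move=> dT /(inv_inj oppK) e; rewrite e pT in dT.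
have oL d : d \notin L -> opp d \notin L by rewrite cL.
have tr x y : fconnect (cut_face L) h x -> fconnect (cut_face L) h y -> fconnect (cut_face L) x y.
  by rewrite fsym => xh hy; apply: connect_trans xh hy.
case: p_side => fp.
  have no d : d \notin L -> d \notin T -> anc h d -> ~~ anc h (opp d) ->
      fconnect (cut_face L) h d = false.
    move=> dL dT hd nhd; apply/negP=> fd; apply: (pneq d dT).
    exact: (out_unique (v := h) dL hd nhd pL hp nhp (tr _ _ fd fp)).
  move: f1 f2; rewrite (no d1) // (no d2) //= => f1 f2; apply: (inv_inj oppK).
  by apply: (in_unique (v := h)) (tr _ _ f1 f2); rewrite ?oppK ?cL.
have no d : d \notin L -> d \notin T -> anc h d -> ~~ anc h (opp d) ->
    fconnect (cut_face L) h (opp d) = false.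
  move=> dL dT hd nhd; apply/negP=> fd; apply: (popneq d dT).
  by apply: (in_unique (v := h)) (tr _ _ fd fp); rewrite ?oppK ?cL.
move: f1 f2; rewrite (no d1) // (no d2) // !orbF => f1 f2.
exact: (out_unique (v := h)) (tr _ _ f1 f2).
Qed.

Hypothesis no_leg : forall x, sv h x -> x \in L -> x = h.

(** This is what prevents the stem from being a bridge. The third half-edge [x] at the head-vertex
    either is external, and then leaves the subtree itself, or leads to a child, to which
    [va_bridge] applies. *)
Lemma other_crossing : exists d, [/\ d \notin L, d \notin T, anc h d & ~~ anc h (opp d)].
Proof.
have [x [hx xh xp hdarts]] : exists x,
    [/\ sv h x, x != h, x != p & forall e, sv h e -> [|| e == h, e == p | e == x]].
  have [_ un svE] := nonroot_darts nh; have ph : p != h.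
    by apply: contraNneq pL => ->; apply: (va_head V).
  case: head_darts => [[e1 [e2 H]]|[e1 [e2 H]]].
    exists (vrot p); split=> //; first exact: connect_trans svp (fconnect1 _ _).
      by apply: contraTneq un => e; rewrite e1 e /= !inE ?eqxx ?orbT ?andbF.
    by apply: contraTneq un => e; rewrite e1 e /= !inE ?eqxx ?orbT ?andbF.
  exists (vrot h); split=> //; first exact: fconnect1.
    by apply: contraTneq un => e; rewrite e /= !inE ?eqxx ?orbT ?andbF.
  by apply: contraTneq un => e; rewrite e1 e /= !inE ?eqxx ?orbT ?andbF.
have xL : x \notin L by apply: contraNN xh => xL; apply/eqP/no_leg.
have oxL : opp x \notin L by rewrite cL.
have vertex_h e : e \notin L -> e \notin T -> sv h e -> e = x.
  move=> eL eT he; case/or3P: (hdarts e he) => /eqP // ee.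
    by rewrite ee (va_head V) in eL.
  by rewrite ee pT in eT.
have [xT|xT] := boolP (x \in T).
  case: (tc_tree C xT) => -[nx sx].
    by rewrite -sx -(tc_st_eq C nh hx) eqxx in xp.
  have hox : anc h (opp x).
    by rewrite (anc_svl vrot_inj C _ hx) -{1}(oppK x) -{1}sx anc_par.
  have noxh : ~~ anc (opp x) h.
    by rewrite (anc_svr vrot_inj C _ hx); have := tc_st_lt C nx; rewrite sx oppK.
  have [d [dL dT cd ncd]] := va_bridge V nx (active_notin oxL) noxh.
  exists d; split=> //; first exact: (tc_trans C) hox cd.
  (* If the edge did not leave the subtree of [h], its upper end would be above the child and below
     [h], hence at the head-vertex, whose uncut half-edges are both in the tree. *)
  apply/negP=> hod.
  have odd : anc (opp d) d.
    by have := comp dT; case/orP=> // dod; case/negP: ncd; apply: (tc_trans C) cd dod.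
  have := anc_chain vrot_inj C odd cd; rewrite (negbTE ncd) orbF.
  rewrite (tc_st_anc C _ nx) => /orP[|].
    by rewrite svC => /(anc_sv C); rewrite (negbTE ncd).
  rewrite sx oppK -(anc_svr vrot_inj C _ hx) => odh.
  have e : opp d = x by apply: vertex_h; rewrite ?cL ?T_oppE //; apply: (anc_antisym C).
  by rewrite -T_oppE e xT in dT.
exists x; split=> //; first exact: (anc_sv C).
apply/negP=> hox; have [oxh|noxh] := boolP (anc (opp x) h).
  have := vertex_h _ oxL _ (anc_antisym C hox oxh); rewrite T_oppE => /(_ xT) e.
  by have := opp_neq x; rewrite e eqxx.
(* If [x] ended strictly below the head-vertex, the half-edge leading to the child in that direction
   would have to be [h], the stem or [x]: one is cut, one leads upwards, one is external. *)
have [c [nc sc hc cx]] := child_toward vrot_inj C hox noxh.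
have cL' : c \notin L.
  by rewrite -sc; apply: active_st nc _; apply: active_anc cx (active_notin oxL).
have cT : c \in T by rewrite -sc (tc_st_tree C nc).
case/or3P: (hdarts _ hc) => /eqP e.
- by have := va_head V; rewrite -e cL (negbTE cL').
- have := anc_par C nc; rewrite sc => ocp.
  case/negP: nhp; rewrite -e oppK; apply: (tc_trans C) (anc_sv C hc) ocp.
- by rewrite -e T_oppE cT in xT.
Qed.

(** A second edge leaves the subtree by [other_crossing], so the stem is not a bridge. *)
Lemma stem_sides : ~~ fconnect (cut_face L) p (opp p).
Proof.
have [d [dL dT hd nhd]] := other_crossing.
apply: (sides_disconnected vrot_inj oppK opp_neq planar connected0 cL pL).
have sub : L :|: edge p \subset L :|: [set d | anc h d != anc h (opp d)].
  apply: setUS; apply/subsetP=> x; rewrite in_edge inE => /orP[]/eqP->.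
    by rewrite hp (negbTE nhp).
  by rewrite oppK hp (negbTE nhp).
have con x y : x \notin L -> y \notin L -> anc h x = anc h y ->
    connect (cut_rel (L :|: edge p)) x y.
  by move=> xL yL e; apply: connect_cutW sub _; apply: subtree_connected.
apply: connect_trans (con p d pL dL _) _; first by rewrite hp hd.
apply: connect_trans (connect_cut_opp (_ : d \notin L :|: edge p)) _.
  rewrite !inE !negb_or dL /=; apply/andP; split.
    by apply: contraNneq dT => ->.
  by apply: contraNneq dT => ->; rewrite T_oppE.
by apply: con; rewrite ?cL // (negbTE nhd) (negbTE nhp).
Qed.

(** The head-face visits both sides of the bond because of the stem, so its tour must cross the bond
    again in the other direction. By [stem_sides] this is not the other side of the stem, and no
    other tree edge leaves the subtree. *)
Lemma crossing_exists : exists d, crossing d.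
Proof.
case: p_side => fp.
  have fph : fconnect (cut_face L) (cut_face L p) h by rewrite -(same_fconnect1 inj_f) fsym.
  have [||z [fz nhz]] := fconnect_exit (B := fun z => ~~ anc h z) fph.
  - rewrite /= /cut_face /cut_opp (negbTE pL).
    by rewrite -(anc_svr vrot_inj C _ (fconnect1 _ _)).
  - by rewrite /= (anc_refl C).
  rewrite negbK /cut_face -(anc_svr vrot_inj C _ (fconnect1 _ _)) /cut_opp.
  case: ifP => [_|/negbT zL hoz]; first by rewrite (negbTE nhz).
  have fhz : fconnect (cut_face L) p z by apply: connect_trans (fconnect1 _ _) fz.
  have zop : z <> opp p by move=> e; have := stem_sides; rewrite -e fhz.
  exists (opp z); split; rewrite ?cL ?T_oppE ?oppK //.
    apply/negP=> zT; have ozT : opp z \in T by rewrite T_oppE.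
    have nhz' : ~~ anc h (opp (opp z)) by rewrite oppK.
    by have [_ e] := stem_crossing ozT hoz nhz'; apply: zop; rewrite e oppK.
  by rewrite (connect_trans fp fhz) orbT.
have [||z [fz hz]] := fconnect_exit (B := anc h) fp.
- exact: (anc_refl C).
- by [].
rewrite /cut_face -(anc_svr vrot_inj C _ (fconnect1 _ _)) /cut_opp.
case: ifP => [_|/negbT zL nhoz]; first by rewrite hz.
exists z; split=> //; last by rewrite fz.
apply/negP=> zT; have [_ e] := stem_crossing zT hz nhoz.
by case/negP: stem_sides; apply: connect_trans fp; rewrite e fsym.
Qed.

End State.

(** * Growing maps embedded in a state *)

Record emb (G : growing_map) L h (f : dart G -> D) : Prop := Emb {
  em_inj : injective f;
  em_vrot : forall d : dart G, f (vrot d) = vrot (f d);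
  em_opp : forall d : dart G, f (opp d) = cut_opp L (f d);
  em_root : f (root_dart G) = root;
  em_head : f (head_leg G) = h;
  em_tree : forall d : dart G, (d \in tree G) = (f d \in T) && (f d \notin L) }.

Section EmbTheory.

Variables (G : growing_map) (L : {set D}) (h : D) (f : dart G -> D).
Hypothesis E : emb L h f.

Lemma em_leg (d : dart G) : is_leg d = (f d \in L).
Proof.
rewrite /is_leg -(inj_eq (em_inj E)) (em_opp E) /cut_opp; case: ifP => _; first by rewrite eqxx.
exact/negbTE/opp_neq.
Qed.

Lemma em_face (d : dart G) : f (face_next d) = cut_face L (f d).
Proof. by rewrite /face_next (em_vrot E) (em_opp E). Qed.

Lemma em_face_connect (d e : dart G) :
  fconnect (@face_next G) d e -> fconnect (cut_face L) (f d) (f e).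
Proof.
apply: (fconnect_ind (P := fun e => fconnect (cut_face L) (f d) (f e))) => // z _ dz.
by rewrite em_face; apply: connect_trans dz (fconnect1 _ _).
Qed.

Lemma em_orbit (d : dart G) y : sv (f d) y -> exists2 e : dart G, fconnect (@vrot G) d e & f e = y.
Proof.
apply: (fconnect_ind (P := fun y => exists2 e : dart G, fconnect (@vrot G) d e & f e = y)).
  by exists d.
move=> z _ [e de <-]; exists (vrot e); last exact: (em_vrot E).
exact: connect_trans de (fconnect1 _ _).
Qed.

Lemma em_sv (d e : dart G) : fconnect (@vrot G) d e = sv (f d) (f e).
Proof.
apply/idP/idP => [|/em_orbit[e' de /(em_inj E) <-] //].
apply: (fconnect_ind (P := fun e => sv (f d) (f e))) => // z _ dz.
by rewrite (em_vrot E); apply: connect_trans dz (fconnect1 _ _).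
Qed.

Variables (w : word) (ancG : rel (dart G)) (stG : dart G -> dart G).
Hypothesis Fw : forward w ancG stG.
Let CG := fw_cert Fw.

Lemma em_nonroot (d : dart G) : ~~ ancG d (root_dart G) = nonroot (f d).
Proof.
have imp (x : D) : anc x root = sv root x.
  apply/idP/idP => [xr|]; last by rewrite svC => /(anc_sv C).
  by apply: (anc_antisym C) => //; apply: (tc_root C).
rewrite imp -(em_root E) -em_sv; congr (~~ _); apply/idP/idP => [dr|].
  by apply: (anc_antisym CG) => //; apply: (tc_root CG).
by rewrite (fconnect_sym (fw_vinj Fw)) => /(anc_sv CG).
Qed.

(** Compatibility with stems is automatic. If the tree edge above [d] pointed the other way in [N],
    then by induction from the root it would also be the stem of the parent of [d], making each of
    the two vertices the parent of the other. *)
Lemma em_st (d : dart G) : ~~ ancG d (root_dart G) -> st (f d) = f (stG d).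
Proof.
elim/(tree_ind CG): d => d IHd nd; set s := stG d.
have sT : s \in tree G := tc_st_tree CG nd.
have ds := tc_st_sv CG nd; rewrite -/s in ds.
have /andP[fsT fsL] : (f s \in T) && (f s \notin L) by rewrite -(em_tree E).
have fo : f (opp s) = opp (f s) by rewrite (em_opp E) /cut_opp (negbTE fsL).
have nfd : nonroot (f d) by rewrite -em_nonroot.
case: (tc_tree C fsT) => -[ns ss].
  by rewrite (tc_st_eq C nfd (_ : sv (f d) (f s))) // -em_sv.
have nos : ~~ ancG (opp s) (root_dart G) by rewrite em_nonroot fo.
have := IHd nd nos; rewrite -/s fo ss -fo => /(em_inj E) os.
have := tc_st_lt CG nos; rewrite -os (fw_oppK Fw).
by rewrite -(anc_svr (fw_vinj Fw) CG _ ds) (anc_par CG nd).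
Qed.

Lemma em_anc (d e : dart G) : ancG d e -> anc (f d) (f e).
Proof.
elim/(tree_ind CG): e => e IHe; have [re|ne] := boolP (ancG e (root_dart G)).
  move=> de; apply: (anc_sv C); rewrite -em_sv; apply: (anc_antisym CG) => //.
  by apply: (tc_trans CG) re (tc_root CG d).
rewrite (tc_st_anc CG _ ne) => /orP[|/(IHe ne) de]; first by rewrite em_sv => /(anc_sv C).
have nfe : nonroot (f e) by rewrite -em_nonroot.
apply: (tc_trans C) de _.
have /andP[_ fsL] : (f (stG e) \in T) && (f (stG e) \notin L).
  by rewrite -(em_tree E) (tc_st_tree CG ne).
by rewrite (em_opp E) /cut_opp (negbTE fsL) -(em_st ne) (anc_par C nfe).
Qed.

Lemma em_active (d : dart G) : active L (f d).
Proof.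
rewrite /active; have [//|/= nd] := boolP (anc (f d) root).
rewrite -em_nonroot in nd; rewrite em_st //.
by have := tc_st_tree CG nd; rewrite (em_tree E) => /andP[].
Qed.

Hypothesis cL : opp_closed L.
Hypothesis stL : forall d, nonroot d -> st d \in L -> d \in L.

Lemma em_surj y : active L y -> exists d : dart G, f d = y.
Proof.
elim/(tree_ind C): y => y IHy ay; have [ry|ny] := boolP (anc y root).
  have : sv (f (root_dart G)) y.
    by rewrite (em_root E); apply: (anc_antisym C) => //; apply: (tc_root C).
  by case/em_orbit=> e _ <-; exists e.
have sL : st y \notin L by move: ay; rewrite /active (negbTE ny).
have [|d fd] := IHy ny.
  have osL : opp (st y) \notin L by rewrite cL.
  by rewrite /active; have [//|no /=] := boolP (anc _ root); apply: contra osL; apply: stL.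
have fod : f (opp d) = st y by rewrite (em_opp E) fd /cut_opp cL (negbTE sL) oppK.
have : sv (f (opp d)) y by rewrite fod svC (tc_st_sv C ny).
by case/em_orbit=> e _ <-; exists e.
Qed.

End EmbTheory.

(** * Embeddings through one growth step *)

Lemma emb_init L h : valid L h -> anc h root ->
  @emb init_map L h (fun b : bool => if b then h else root).
Proof.
move=> V hr; have hE : h = vrot root.
  by case: (root_darts hr) => // e; have := va_head_root V; rewrite e eqxx.
have v2 : vrot (vrot root) = root.
  have o2 : order (@vrot N) root = 2.
    by rewrite -cubic.1 /root_vertex /vertex cardsE; apply: eq_card => e; rewrite inE.
  by have := iter_order vrot_inj root; rewrite o2.
split=> //.
- have hn := va_head_root V; case; case=> //= e; first by rewrite e eqxx in hn.
  by rewrite -e eqxx in hn.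
- by case; rewrite /= hE.
- by case; rewrite /cut_opp /= ?(va_head V) ?(va_root V).
- by case; rewrite inE ?(va_head V) ?(va_root V) andbF.
Qed.

Lemma emb_grow w (G : growing_map) ancG stG L h f r (g : new_dart -> D) :
  @forward w G ancG stG -> valid L h -> nonroot h ->
  emb (L :|: edge (st h)) (opp (st h)) f ->
  g NStem = st h -> g NHead = h -> g NLeg \in L -> g NLeg != h ->
  (forall z, g (r z) = vrot (g z)) -> (forall z, sv h (g z)) ->
  emb (G := grow r G) L h (fun q => match q with inl e => f e | inr z => g z end).
Proof.
move=> Fw V nh E gs gh xL xh gr gsv; have cL := va_opp V.
set p := st h in E gs *.
have pL : p \notin L := active_st nh (va_act V).
have pT : p \in T := tc_st_tree C nh.
have opL : opp p \notin L by rewrite cL.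
(* A half-edge of [G] sent to the head-vertex would have a stem in the tree of [G] that is sent to
   [st h], an edge already cut. *)
have disj (d : dart G) z : f d <> g z.
  move=> e; have hfd : sv h (f d) by rewrite e.
  have nd : ~~ ancG d (root_dart G).
    by rewrite (em_nonroot E Fw) -(nonroot_sv vrot_inj C hfd).
  have := tc_st_tree (fw_cert Fw) nd.
  by rewrite (em_tree E) -(em_st E Fw nd) -(tc_st_eq C nh hfd) !inE eqxx orbT andbF.
have fdp (d : dart G) : f d != p by apply/eqP; rewrite -gs; apply: disj.
have g_inj : injective g.
  have ph : p != h by apply: contraNneq pL => ->; apply: (va_head V).
  have px : p != g NLeg by apply: contraNneq pL => ->.
  by case; case=> //; rewrite ?gs ?gh => e; move: ph px xh; rewrite ?e -?e eqxx.
split.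
- case=> [d|z] [d'|z'] e; first by rewrite (em_inj E e).
  + by case: (disj d z').
  + by case: (disj d' z).
  + by rewrite (g_inj _ _ e).
- by case=> [d|z] /=; [apply: (em_vrot E)|apply: gr].
- case=> [d|z] /=.
    have [->|dh] := eqVneq d (head_leg G).
      by rewrite gs (em_head E) /cut_opp (negbTE opL) oppK.
    rewrite (em_opp E) /cut_opp !inE (negbTE (fdp d)) /=.
    by rewrite -(em_head E) (inj_eq (em_inj E)) (negbTE dh) orbF.
  case: z => /=; rewrite ?gs ?gh /cut_opp ?(negbTE pL) ?(va_head V) ?xL //.
  by rewrite (em_head E).
- exact: (em_root E).
- exact: gh.
- case=> [d|z]; rewrite ?grow_tree_l ?grow_tree_r.
    have [->|dh] := eqVneq d (head_leg G).
      by rewrite orbT (em_head E) T_oppE pT opL.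
    rewrite orbF (em_tree E) !inE (negbTE (fdp d)) /=.
    by rewrite -(em_head E) (inj_eq (em_inj E)) (negbTE dh) !orbF.
  by case: z => /=; rewrite ?gs ?gh ?pT ?pL ?(va_head V) ?xL ?andbF.
Qed.

Lemma emb_grow_inv w (G : growing_map) ancG stG (a : letter) L h r (f : dart (grow r G) -> D) :
  @forward w G ancG stG -> valid L h -> emb L h f ->
  forward (a :: w) (grow_anc ancG (r := r)) (grow_st stG (r := r)) ->
  emb (L :|: edge (st h)) (opp (st h)) (fun d : dart G => f (inl d)).
Proof.
move=> Fw V E Fw'; have cL := va_opp V.
have pE : st h = f (inr NStem) by rewrite -(em_head E); apply: (em_st E Fw').
have nh : nonroot h by rewrite -(em_head E) -(em_nonroot E Fw').
have pL : st h \notin L := active_st nh (va_act V).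
have fh : f (inl (head_leg G)) = opp (st h).
  by have := em_opp E (inr NStem); rewrite /cut_opp -pE (negbTE pL).
have edgeE (d : dart G) : (f (inl d) \in edge (st h)) = (d == head_leg G).
  by rewrite in_edge -fh pE !(inj_eq (em_inj E)).
split.
- by move=> d e /(em_inj E)[].
- by move=> d; apply: (em_vrot E (inl d)).
- move=> d; rewrite /cut_opp in_setU edgeE.
  have [->|dh] := eqVneq d (head_leg G); first by rewrite orbT (head_opp Fw).
  by rewrite orbF -/(cut_opp L _) -(em_opp E) grow_oppE (negbTE dh).
- exact: (em_root E).
- exact: fh.
- move=> d; rewrite in_setU edgeE negb_or andbA -(em_tree E) grow_tree_l.
  have [->|dh] := eqVneq d (head_leg G); last by rewrite orbF andbT.
  by rewrite andbF; apply: contraTF (fw_head Fw); apply: (fw_tree Fw).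
Qed.

Lemma emb_glue w (G : growing_map) ancG stG L h d (f : dart G -> D) s t :
  @forward w G ancG stG -> opp_closed L -> d \notin L -> d \notin T ->
  emb (L :|: edge d) d f -> f s = opp d -> f t = h ->
  emb (G := glue_and_move s t) L h f.
Proof.
move=> Fw cL dL dT E fs ft; split.
- exact: (em_inj E).
- exact: (em_vrot E).
- move=> x; rewrite (glue_oppE s t); have [->|xh] := eqVneq x (head_leg G).
    by rewrite (em_head E) fs /cut_opp (negbTE dL).
  have [->|xs] := eqVneq x s.
    by rewrite fs (em_head E) /cut_opp cL (negbTE dL) oppK.
  rewrite (em_opp E) /cut_opp in_setU in_edge -{1}(em_head E) -fs.
  by rewrite !(inj_eq (em_inj E)) (negbTE xh) (negbTE xs) !orbF.
- exact: (em_root E).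
- exact: ft.
- move=> x; rewrite [x \in _](em_tree E) in_setU in_edge !negb_or.
  have [fT|//] := boolP (f x \in T).
  have -> : f x != d by apply: contraNneq dT => <-.
  have -> : f x != opp d by apply: contraNneq dT => e; rewrite -T_oppE -e.
  by rewrite !andbT.
Qed.

Lemma emb_glue_inv w (G : growing_map) ancG stG L h (s t : dart G)
    (f : dart (glue_and_move s t) -> D) :
  @forward w G ancG stG -> opp_closed L -> is_leg s -> s != head_leg G -> emb L h f ->
  [/\ emb (G := G) (L :|: edge (f (head_leg G))) (f (head_leg G)) f,
      f (head_leg G) \notin L & opp (f (head_leg G)) = f s].
Proof.
move=> Fw cL ls sh E; set d := f (head_leg G).
have dL : d \notin L.
  by rewrite -(em_leg E) (@glue_leg G s t sh) eqxx andbF.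
have os : opp d = f s.
  by have := em_opp E (head_leg G); rewrite (glue_oppE s t) eqxx /cut_opp (negbTE dL).
have edgeE (x : dart G) : (f x \in edge d) = (x == head_leg G) || (x == s).
  by rewrite in_edge os !(inj_eq (em_inj E)).
split=> //; split=> //.
- exact: (em_inj E).
- exact: (em_vrot E).
- move=> x; rewrite /cut_opp in_setU edgeE.
  have [->|xh] := eqVneq x (head_leg G); first by rewrite orbT (head_opp Fw).
  have [->|xs] := eqVneq x s; first by rewrite /= orbT (eqP ls).
  by rewrite /= orbF -/(cut_opp L _) -(em_opp E) (glue_oppE s t) (negbTE xh) (negbTE xs).
- exact: (em_root E).
- move=> x; rewrite in_setU edgeE negb_or andbA -(em_tree E).
  have [->|xh] := eqVneq x (head_leg G).
    by rewrite andbF; apply: contraTF (fw_head Fw); apply: (fw_tree Fw).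
  have [->|xs] := eqVneq x s; last by rewrite andbT.
  by rewrite andbF; apply: contraTF ls; apply: (fw_tree Fw).
Qed.

(** The edge made by [phi_c] fits the description [crossing], which refers to the state only; with
    [crossing_unique] the state determines it. *)
Lemma emb_glue_crossing w (G : growing_map) ancG stG L h (s t : dart G) m
    (f : dart (glue_and_move s t) -> D) :
  @forward w G ancG stG -> valid L h -> is_leg s -> s != head_leg G ->
  tour_legs G = s :: rcons m t \/ tour_legs G = t :: rcons m s ->
  ancG s t -> ~~ ancG t s -> emb L h f -> crossing L h (f (head_leg G)).
Proof.
move=> Fw V ls sh tG ast nts E; have cL := va_opp V.
have [E1 dL os] := emb_glue_inv Fw cL ls sh E.
have lt : is_leg t.
  have : t \in tour_legs G by case: tG => ->; rewrite inE mem_rcons !inE eqxx ?orbT.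
  by rewrite mem_tour => /and3P[].
have ft : f t = h := em_head E.
split=> //.
- apply: contraTN (fw_head Fw) => dT; apply: (fw_tree Fw).
  by rewrite [_ \in tree G](em_tree E) dT dL.
- by rewrite -ft; apply: (em_anc E1 Fw); apply: (fw_anc Fw).
- rewrite os -ft; apply: contra nts => ts.
  have : sv (f t) (f s) by apply: (anc_antisym C) => //; apply: (em_anc E1 Fw).
  by rewrite -(em_sv E1) => /(anc_sv (fw_cert Fw)).
- rewrite os -ft.
  by case/orP: (glue_face_hs Fw ls sh tG) => /(em_face_connect E) ->; rewrite ?orbT.
Qed.

(** Used in [tour_ends], as is the next lemma, with regions of [N] that the face walk cannot leave
    before it meets a leg. *)
Lemma path_first_leg (G : growing_map) L h f (P : pred D) (x l : dart G) X1 X2 : emb L h f ->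
  (forall y, P y -> y \notin L -> P (cut_face L y)) -> P (cut_face L (f x)) ->
  path (frel (@face_next G)) x (X1 ++ l :: X2) -> filter (@is_leg G) X1 = [::] -> P (f l).
Proof.
move=> E step; elim: X1 x => [|z X1 IHX] x Px.
  by case/andP=> /eqP <- _; rewrite (em_face E).
case/andP=> /eqP xz pX /=; case: ifP => // lz fX; apply: IHX pX fX.
by apply: step; rewrite -?(em_leg E) ?lz // -xz (em_face E).
Qed.

Lemma path_no_leg (G : growing_map) L h f (P : pred D) (x : dart G) X : emb L h f ->
  (forall y, P y -> y \notin L -> P (cut_face L y)) -> P (cut_face L (f x)) ->
  path (frel (@face_next G)) x X -> (forall z, z \in X -> P (f z) -> ~~ is_leg z) ->
  filter (@is_leg G) X = [::].
Proof.
move=> E step; elim: X x => // z X IHX x Px /andP[/eqP xz pX] noleg.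
have Pz : P (f z) by rewrite -xz (em_face E).
have lz : ~~ is_leg z by apply: noleg Pz; rewrite mem_head.
rewrite /= (negbTE lz); apply: IHX pX _; last first.
  by move=> u uX; apply: noleg; rewrite inE uX orbT.
by apply: step => //; rewrite -(em_leg E).
Qed.

(** After the cut, [phi_c] must pick exactly the legs [h] and [opp d]. Next to one side of [d] the
    tour stays in the subtree of [h], whose only leg is [h]; next to the other it follows the second
    face bordering the edge, which carries no leg of [L]. *)
Lemma tour_ends w (G : growing_map) ancG stG L h d (f : dart G -> D) (l1 l2 : dart G) m :
  @forward w G ancG stG -> valid L h -> nonroot h ->
  (forall x, sv h x -> x \in L -> x = h) -> crossing L h d ->
  emb (L :|: edge d) d f -> tour_legs G = l1 :: rcons m l2 ->
  (f l1 = h /\ f l2 = opp d) \/ (f l1 = opp d /\ f l2 = h).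
Proof.
move=> Fw V nh no_leg cr E tG; have cL := va_opp V.
have V1 := undo_glue V cr; have cL1 := va_opp V1.
have [dL dT hd nhd fd] := cr.
have nf := sides_disconnected vrot_inj oppK opp_neq planar connected0 cL dL (connect_ext V dL dT).
have inj_f := cut_face_inj vrot_inj oppK cL.
have fsym := fconnect_sym inj_f.
set L1 := L :|: edge d in V1 cL1 E.
have dL1 : d \in L1 by rewrite !inE eqxx orbT.
have odL1 : opp d \in L1 by rewrite cL1.
have hL1 : h \in L1 by rewrite inE (va_head V).
have f1E y : y \notin L1 -> cut_face L1 y = cut_face L y.
  move=> yL1; rewrite /cut_face /cut_opp (negbTE yL1) ifN //.
  by apply: contra yL1 => yL; rewrite inE yL.
have legE z : is_leg z -> z != head_leg G ->
    f z = opp d \/ [/\ f z \in L, active L (f z) & fconnect (cut_face L) h (f z)].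
  rewrite (em_leg E) -(inj_eq (em_inj E)) (em_head E) !inE => /or3P[zL|/eqP->|/eqP->] zd.
  - have az : active L (f z).
      have := em_active E Fw z; rewrite /active => /orP[->//|].
      by rewrite inE negb_or => /andP[-> _]; rewrite orbT.
    by right; split=> //; apply: (va_face V).
  - by rewrite eqxx in zd.
  - by left.
(* The legs of [L] hang above [h], so one in the subtree is at the head-vertex, where [h] is the
   only leg. *)
have leg_sub z : is_leg z -> z != head_leg G -> anc h (f z) -> f z = h.
  move=> lz zh hz; case: (legE z lz zh) => [e|[zL az _]]; first by rewrite -e hz in nhd.
  by apply: no_leg => //; apply: (anc_antisym C) => //; apply: (va_anc V).
pose X := behead (orbit (@face_next G) (head_leg G)).
have oX : orbit (@face_next G) (head_leg G) = head_leg G :: X := orbit_behead _ _.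
have cX : path (frel (@face_next G)) (head_leg G) X.
  have := cycle_orbit (face_inj Fw) (head_leg G); rewrite oX /= rcons_path.
  by case/andP.
have uX : uniq (head_leg G :: X) by rewrite -oX orbit_uniq.
have hX : head_leg G \notin X by case/andP: uX.
have fX : filter (@is_leg G) X = l1 :: rcons m l2 by [].
have [X1 [X2 [eX f1 _]]] := filter_cons_split fX.
have l1P : is_leg l1 /\ l1 != head_leg G.
  have : l1 \in tour_legs G by rewrite tG mem_head.
  by rewrite mem_tour => /and3P[].
have first_P (P : pred D) : (forall y, P y -> y \notin L1 -> P (cut_face L y)) ->
    P (vrot d) -> P (f l1).
  move=> step Pd; rewrite eX in cX.
  apply: (path_first_leg E _ _ cX f1) => [y Py yL1|]; first by rewrite f1E //; apply: step.
  by rewrite (em_head E) /cut_face /cut_opp dL1.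
have last_P (P : pred D) l : f l \in L1 -> f l != d ->
    (forall y, P y -> y \notin L1 -> P (cut_face L y)) -> P (vrot (f l)) ->
    (forall z, z != l -> z != head_leg G -> is_leg z -> P (f z) -> False) -> l2 = l.
  move=> lL1 ld step Pl noP.
  have lX : l \in X.
    have : l \in tour_legs G.
      have ll : is_leg l by rewrite (em_leg E).
      by rewrite mem_tour ll (fw_face Fw ll) andbT -(inj_eq (em_inj E)) (em_head E).
    by rewrite mem_filter => /andP[].
  case/splitPr: lX fX cX uX hX => Z1 Z2 fX; rewrite cat_path => /andP[_ /andP[_ pZ]] uX hX.
  have f2 : filter (@is_leg G) Z2 = [::].
    apply: (path_no_leg E _ _ pZ) => [y Py yL1||z zZ Pz].
    - by rewrite f1E //; apply: step.
    - by rewrite /cut_face /cut_opp lL1.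
    apply/negP=> lz; apply: (noP z) Pz => //.
      apply: contraTneq uX => ez; rewrite /= cat_uniq /= -ez zZ /= !andbF //.
    by apply: contraNneq hX => <-; rewrite mem_cat inE zZ !orbT.
  move: fX; rewrite filter_cat /= (em_leg E) lL1 f2 cats1 -rcons_cons.
  by case/rcons_inj.
have [s0 fs0] : exists s0, f s0 = opp d.
  apply: (em_surj E cL1 (va_st V1)).
  apply: (active_anc V1 _ (va_act V1)).
  by have := comp dT; case/orP=> // dod; case/negP: nhd; apply: (tc_trans C) hd dod.
have [t0 ft0] : exists t0, f t0 = h.
  apply: (em_surj E cL1 (va_st V1)).
  exact: (active_anc V1 hd (va_act V1)).
have pL : st h \notin L := active_st nh (va_act V).
have pT : st h \in T := tc_st_tree C nh.
have hp : anc h (st h) := anc_sv C (tc_st_sv C nh).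
have nhp : ~~ anc h (opp (st h)) := tc_st_lt C nh.
have dp : d <> st h by move=> e; rewrite e pT in dT.
have tr x y : fconnect (cut_face L) h x -> fconnect (cut_face L) h y ->
    fconnect (cut_face L) x y by rewrite fsym => xh; apply: connect_trans xh.
have ancv y : anc h (vrot y) = anc h y by rewrite -(anc_svr vrot_inj C _ (fconnect1 _ y)).
have fE y : y \notin L -> cut_face L y = vrot (opp y).
  by move=> yL; rewrite /cut_face /cut_opp (negbTE yL).
have subL y : y \notin L1 -> y \notin L by rewrite inE negb_or => /andP[].
have stepf y : fconnect (cut_face L) h y -> fconnect (cut_face L) h (cut_face L y).
  by move=> hy; apply: connect_trans hy (fconnect1 _ _).
have face_of e y : fconnect (cut_face L) e y -> fconnect (cut_face L) e (cut_face L y).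
  by move=> ey; apply: connect_trans ey (fconnect1 _ _).
(* Which of the two legs comes first depends on whether the stem follows or precedes the head. *)
case: (head_darts V nh) => [[hp' _]|[_ [ph' _]]]; [left|right].
  have fp : fconnect (cut_face L) h (st h).
    by have := fconnect1 (cut_face L) h; rewrite {2}/cut_face /cut_opp (va_head V) hp'.
  have out y : y \notin L -> anc h y -> ~~ anc h (opp y) -> fconnect (cut_face L) h y -> y = st h.
    by move=> yL hy nhy fy; apply: (out_unique V yL hy nhy pL hp nhp); apply: tr.
  have fod : fconnect (cut_face L) h (opp d).
    by case/orP: fd => // fd; case: dp; apply: out.
  split.
    have /and3P[hl _ _] : [&& anc h (f l1), fconnect (cut_face L) h (f l1) & f l1 != st h].
      (* Along the head-face the subtree can be left only through the stem, by [out_unique], and the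
         predecessor of the stem on that face is the leg [h]. *)
      apply: (first_P (fun y => [&& anc h y, fconnect (cut_face L) h y & y != st h])).
        move=> y /and3P[hy fy yp] yL1; have yL := subL y yL1.
        rewrite stepf // fE // ancv; apply/and3P; split=> //.
          by apply: contraNT yp => nhy; apply/eqP/out.
        apply: contra yL => /eqP e; rewrite -cL; rewrite -hp' in e.
        by rewrite (vrot_inj e) (va_head V).
      rewrite ancv hd; apply/and3P; split=> //.
        by rewrite -{1}(oppK d) -fE ?cL //; apply: stepf.
      by apply: contraNneq dL; rewrite -hp' => /vrot_inj ->; apply: (va_head V).
    by apply: leg_sub; case: l1P.
  suff -> : l2 = s0 by [].
  apply: (last_P (fconnect (cut_face L) d)); rewrite ?fs0 //.
  - by move=> y dy yL1; apply: face_of.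
  - by rewrite -fE // fconnect1.
  move=> z _ zh lz dz; case: (legE z lz zh) => [e|[_ _ hz]].
    by rewrite -e dz in nf.
  by case/negP: nf; apply: connect_trans dz _; apply: tr.
have fp : fconnect (cut_face L) h (opp (st h)).
  rewrite fsym; have := fconnect1 (cut_face L) (opp (st h)).
  by rewrite {2}/cut_face /cut_opp cL (negbTE pL) oppK ph'.
have fhd : fconnect (cut_face L) h d.
  case/orP: fd => // fod; case: dp; apply: (inv_inj oppK).
  by apply: (in_unique V (v := h)) (tr _ _ fod fp); rewrite ?oppK ?cL.
split.
  have : fconnect (cut_face L) (opp d) (f l1).
    apply: (first_P (fconnect (cut_face L) (opp d))) => [y dy yL1|]; first exact: face_of.
    by rewrite -{2}(oppK d) -fE ?cL // fconnect1.
  case: l1P => ll lh dz; case: (legE _ ll lh) => [//|[_ _ hz]].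
  by case/negP: nf; rewrite fsym; apply: connect_trans dz _; apply: tr.
suff -> : l2 = t0 by [].
(* Here the exit from the subtree along the head-face is [d], the head itself, so the tour meets no
   leg after [h]. *)
apply: (last_P (fun y => anc h y && fconnect (cut_face L) h y)); rewrite ?ft0 //.
- by apply: contraNneq dL => <-; apply: (va_head V).
- move=> y /andP[hy fy] yL1; have yL := subL y yL1.
  rewrite stepf // fE // ancv andbT; apply: contraTT yL1 => nhy.
  have -> : y = d by apply: (out_unique V yL hy nhy dL hd nhd); apply: tr.
  by rewrite dL1.
- rewrite ancv (anc_refl C) /=; have := fconnect1 (cut_face L) h.
  by rewrite {2}/cut_face /cut_opp (va_head V).
move=> z zt zh lz /andP[hz _]; case/eqP: zt; apply: (em_inj E).
by rewrite ft0; apply: leg_sub.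
Qed.

(** * Reading the word off the states *)

Lemma suffix_kreweras_a w : suffix_kreweras w -> suffix_kreweras (La :: w).
Proof.
move=> kw; have := suffix_krewerasP kw.
by rewrite suffix_kreweras_cons kw !count_letter; lia.
Qed.

Lemma suffix_kreweras_b w : suffix_kreweras w -> suffix_kreweras (Lb :: w).
Proof.
move=> kw; have := suffix_krewerasP kw.
by rewrite suffix_kreweras_cons kw !count_letter; lia.
Qed.

(** The root is at neither end of the tour, so both blocks around it are non-empty. The Kreweras
    condition on the recovered word thus comes from the root remaining a leg. *)
Lemma suffix_kreweras_c w (G : growing_map) ancG stG (l1 l2 : dart G) m :
  @forward w G ancG stG -> suffix_kreweras w -> tour_legs G = l1 :: rcons m l2 ->
  root_dart G != l1 -> root_dart G != l2 -> suffix_kreweras (Lc :: w).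
Proof.
move=> Fw kw tG r1 r2; have := fw_root Fw; rewrite kw => -[F [B [tG' sF sB]]].
rewrite suffix_kreweras_cons kw !count_letter andbT; rewrite tG in tG'.
case: F tG' sF => [[e _]|x' F tG' <-]; first by rewrite e eqxx in r1.
case/lastP: B tG' sB => [|B y' _ <-]; last by rewrite size_rcons /=; lia.
by rewrite cats1 -rcons_cons => /rcons_inj[_ _ e]; rewrite e eqxx in r2.
Qed.

(** Induction on the number of uncut half-edges; the first letter of the word is the first one
    undone. *)
Lemma exists_word L h : valid L h -> exists w (G : growing_map) ancG stG (f : dart G -> D),
  [/\ suffix_kreweras w, phi_word w init_map = Some G, @forward w G ancG stG & emb L h f].
Proof.
have [n] := ubnP #|~: L|; elim: n L h => // n IHn L h; rewrite ltnS => le_n V.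
have [rh|nh] := boolP (anc h root).
  exists [::], init_map, (fun _ _ => true), id, (fun b : bool => if b then h else root).
  by split=> //; [exact: init_forward|exact: emb_init].
have smaller d : d \notin L -> #|~: (L :|: edge d)| < n.
  move=> dL; apply: leq_trans le_n; apply: proper_card; apply/properP; split.
    by rewrite setCS; apply: subsetUl.
  by exists d; rewrite !inE ?eqxx ?dL ?orbT.
have pL : st h \notin L := active_st nh (va_act V).
have [[x [xL hx xh]]|no_leg] := EM (exists x, [/\ x \in L, sv h x & x != h]); last first.
  have {}no_leg x : sv h x -> x \in L -> x = h.
    by move=> hx xL; apply/eqP/negPn/negP=> xh; apply: no_leg; exists x.
  have [d cr] := crossing_exists V nh no_leg.
  have [dL dT hd nhd fd] := cr; have V1 := undo_glue V cr.
  have [w [G [ancG [stG [f [kw Gw Fw E]]]]]] := IHn _ _ (smaller d dL) V1.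
  have cL1 := va_opp V1; have st1 := va_st V1.
  have odd : anc (opp d) d.
    by have := comp dT; case/orP=> // dod; case/negP: nhd; apply: (tc_trans C) hd dod.
  have [s0 fs0] : exists s0 : dart G, f s0 = opp d.
    by apply: (em_surj E cL1 st1); apply: (active_anc V1 odd (va_act V1)).
  have [t0 ft0] : exists t0 : dart G, f t0 = h.
    by apply: (em_surj E cL1 st1); apply: (active_anc V1 hd (va_act V1)).
  have inT (z : dart G) : f z \in L :|: edge d -> f z != d -> z \in tour_legs G.
    rewrite -(em_leg E) -(em_head E) (inj_eq (em_inj E)) => lz zh.
    by rewrite mem_tour lz zh (fw_face Fw lz).
  have st0 : s0 != t0.
    by apply: contraNneq nhd => e; rewrite -fs0 e ft0 (anc_refl C).
  have szT : 1 < size (tour_legs G).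
    have <- : size [:: s0; t0] = 2 by [].
    apply: uniq_leq_size; first by rewrite /= inE st0.
    move=> z; rewrite !inE => /orP[]/eqP->; apply: inT; rewrite ?fs0 ?ft0 ?opp_neq //.
    - by rewrite !inE eqxx !orbT.
    - by rewrite inE (va_head V).
    - by apply: contraNneq dL => <-; apply: (va_head V).
  have [s [t [m [/andP[ls sh] tG ast nts Gc]]]] := phi_c_glue Fw szT.
  have odh : anc (opp d) h.
    by have := anc_chain vrot_inj C odd hd; rewrite (negbTE nhd) orbF.
  (* [tour_ends] leaves two orders open; since [h] is not above [opp d], the ancestor relation
     between [s] and [t] tells which leg is which. *)
  have [fs ft] : f s = opp d /\ f t = h.
    have fst := em_anc E Fw ast.
    by case: tG => tG; case: (tour_ends Fw V nh no_leg cr E tG) => -[e1 e2];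
      rewrite ?e1 ?e2 // in fst *; rewrite fst in nhd.
  have rneq (z : dart G) : f z != root -> root_dart G != z.
    by apply: contraNneq => <-; rewrite (em_root E).
  have rs : root_dart G != s.
    by apply: rneq; rewrite fs; apply: contraNneq dL => e; rewrite -(va_opp V) e (va_root V).
  have rt : root_dart G != t by apply: rneq; rewrite ft; apply: (va_head_root V).
  exists (Lc :: w), (glue_and_move s t), ancG, stG, f; split.
  - by case: tG => tG; apply: (suffix_kreweras_c Fw kw tG).
  - by rewrite /= Gw.
  - exact: (glue_forward Fw ls sh tG).
  - exact: (emb_glue Fw (va_opp V) dL dT E fs ft).
have V1 := undo_leg V nh xL hx xh.
have [w [G [ancG [stG [f [kw Gw Fw E]]]]]] := IHn _ _ (smaller _ pL) V1.
pose g z := match z with NStem => st h | NHead => h | NLeg => x end.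
have gsv z : sv h (g z) by case: z => //=; apply: (tc_st_sv C nh).
have ph : st h != h by apply: contraNneq pL => ->; apply: (va_head V).
have px : st h != x by apply: contraNneq pL => ->.
case: (head_darts V nh) => [[e1 [e2 H]]|[e1 [e2 H]]].
  have ex : x = vrot (st h).
    by case/or3P: (H x hx) => /eqP // e; [rewrite e eqxx in xh|rewrite e eqxx in px].
  have gr z : g (rot_right z) = vrot (g z) by case: z => /=; rewrite ?ex.
  exists (Lb :: w), (phi_b G), (grow_anc ancG (r := rot_right)),
    (grow_st stG (r := rot_right)), (fun q => match q with inl e => f e | inr z => g z end).
  split.
  - exact: suffix_kreweras_b.
  - by rewrite /= Gw.
  - exact: forward_b.
  - exact: (emb_grow Fw V nh E).
have ex : x = vrot h.
  by case/or3P: (H x hx) => /eqP // e; [rewrite e eqxx in xh|rewrite e eqxx in px].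
have gr z : g (rot_left z) = vrot (g z) by case: z => /=; rewrite ?ex.
exists (La :: w), (phi_a G), (grow_anc ancG (r := rot_left)),
  (grow_st stG (r := rot_left)), (fun q => match q with inl e => f e | inr z => g z end).
split.
- exact: suffix_kreweras_a.
- by rewrite /= Gw.
- exact: forward_a.
- exact: (emb_grow Fw V nh E).
Qed.

(** The head-vertex shows the letter: a leg just after the head for [a], just before it for [b], no
    second leg for [c]. The previous state is then forced, up to the choice of a [crossing]. *)
Lemma emb_step (a : letter) w (G : growing_map) L h (f : dart G -> D) : valid L h ->
  suffix_kreweras (a :: w) -> phi_word (a :: w) init_map = Some G -> emb L h f ->
  nonroot h /\ exists (G1 : growing_map) (f1 : dart G1 -> D), phi_word w init_map = Some G1 /\
  match a with
  | La => vrot h \in L /\ emb (L :|: edge (st h)) (opp (st h)) f1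
  | Lb => [/\ vrot h \notin L, vrot (vrot h) \in L & emb (L :|: edge (st h)) (opp (st h)) f1]
  | Lc => [/\ vrot h \notin L, vrot (vrot h) \notin L
            & exists2 d, crossing L h d & emb (L :|: edge d) d f1]
  end.
Proof.
move=> V kaw Gaw E; have kw : suffix_kreweras w.
  by move: kaw; rewrite suffix_kreweras_cons => /and3P[].
have [G1 [anc1 [st1 [Gw Fw]]]] := forward_word (suffix_kreweras_exc kw).
move: Gaw; rewrite /phi_word /= -/(phi_word w init_map) Gw /=.
case: a kaw => kaw /= Ga.
- move: Ga => [eG]; move: f E; rewrite -eG => f E.
  have Fa := forward_a Fw; have nh : nonroot h by rewrite -(em_head E) -(em_nonroot E Fa).
  split=> //; exists G1, (fun d : dart G1 => f (inl d)); split=> //; split.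
    rewrite -(em_head E) -(em_vrot E) -(em_leg E) //.
  exact: (emb_grow_inv Fw V E Fa).
- move: Ga => [eG]; move: f E; rewrite -eG => f E.
  have Fb := forward_b Fw; have nh : nonroot h by rewrite -(em_head E) -(em_nonroot E Fb).
  split=> //; exists G1, (fun d : dart G1 => f (inl d)); split=> //; split.
  + by rewrite -(em_head E) -(em_vrot E) -(em_leg E).
  + by rewrite -(em_head E) -!(em_vrot E) -(em_leg E).
  exact: (emb_grow_inv Fw V E Fb).
have szT : 1 < size (tour_legs G1).
  have := fw_size Fw; move: kaw; rewrite suffix_kreweras_cons !count_letter => /and3P[].
  lia.
have [s [t [m [/andP[ls sh] tG ast nts Gc]]]] := phi_c_glue Fw szT.
move: Ga; rewrite Gc => -[eG]; move: f E; rewrite -eG => f E.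
have Fc := glue_forward Fw ls sh tG ast nts.
have nh : nonroot h by rewrite -(em_head E) -(em_nonroot E Fc) (fw_head_nonroot Fc).
have [_ un _] := nonroot_darts nh.
have ft : f t = h := em_head E.
have [lt th] : is_leg t /\ t != head_leg G1.
  have : t \in tour_legs G1 by case: tG => ->; rewrite inE mem_rcons !inE eqxx ?orbT.
  by rewrite mem_tour => /and3P[].
have nleg (z : dart G1) : fconnect (@vrot G1) t z -> f z != h -> f z \notin L.
  move=> tz; apply: contraNN; rewrite -(em_leg E) (@glue_leg G1 s t sh) => /and3P[lz zh _].
  by rewrite -(fw_legs Fw lt lz th zh tz) ft.
have v1 : f (vrot t) = vrot h by rewrite -ft -(em_vrot E).
have v2 : f (vrot (vrot t)) = vrot (vrot h) by rewrite -v1 -(em_vrot E).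
split=> //; exists G1, f; split=> //; split.
- rewrite -v1; apply: nleg; first exact: fconnect1.
  by rewrite v1; apply: contraTneq un => e; rewrite /= !inE e eqxx.
- rewrite -v2; apply: nleg; first exact: connect_trans (fconnect1 _ _) (fconnect1 _ _).
  by rewrite v2; apply: contraTneq un => e; rewrite /= !inE e eqxx orbT.
exists (f (head_leg G1)).
  exact: (emb_glue_crossing Fw V ls sh tG ast nts E).
by have [] := emb_glue_inv Fw (va_opp V) ls sh E.
Qed.

(** The two growing maps need not be equal: the induction follows the states, which both embeddings
    share. *)
Lemma word_unique w w' L h (G G' : growing_map) (f : dart G -> D) (f' : dart G' -> D) :
  valid L h -> suffix_kreweras w -> suffix_kreweras w' ->
  phi_word w init_map = Some G -> phi_word w' init_map = Some G' ->
  emb L h f -> emb L h f' -> w = w'.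
Proof.
have nil_root (G0 : growing_map) (f0 : dart G0 -> D) L0 h0 :
    phi_word [::] init_map = Some G0 -> emb L0 h0 f0 -> anc h0 root.
  move=> [eG]; move: f0; rewrite -eG => f0 E; rewrite -(em_head E) -[anc _ _]negbK.
  by rewrite -(em_nonroot E init_forward).
elim: w w' L h G G' f f' => [|a w IHw] [|a' w'] L h G G' f f' V kw kw' Gw Gw' E E' //.
- by have [] := emb_step V kw' Gw' E'; rewrite (nil_root _ _ _ _ Gw E).
- by have [] := emb_step V kw Gw E; rewrite (nil_root _ _ _ _ Gw' E').
have [nh [G1 [f1 [G1w H]]]] := emb_step V kw Gw E.
have [_ [G1' [f1' [G1w' H']]]] := emb_step V kw' Gw' E'.
have sk (b : letter) (r : word) : suffix_kreweras (b :: r) -> suffix_kreweras r.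
  by rewrite suffix_kreweras_cons => /and3P[].
have [_ un _] := nonroot_darts nh.
have Vab x : x \in L -> sv h x -> x != h -> valid (L :|: edge (st h)) (opp (st h)).
  by move=> xL hx xh; apply: (undo_leg V nh xL hx xh).
have sv1 : sv h (vrot h) := fconnect1 _ _.
have sv2 : sv h (vrot (vrot h)) := connect_trans sv1 (fconnect1 _ _).
have h1 : vrot h != h by apply: contraTneq un => e; rewrite /= !inE e eqxx.
have h2 : vrot (vrot h) != h by apply: contraTneq un => e; rewrite /= !inE e eqxx orbT.
case: a a' kw kw' Gw Gw' H H' => -[] kw kw' Gw Gw'.
- move=> [hL E1] [_ E1'].
  by rewrite (IHw _ _ _ _ _ _ _ (Vab _ hL sv1 h1) (sk _ _ kw) (sk _ _ kw') G1w G1w' E1 E1').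
- by move=> [hL _] [/negP].
- by move=> [hL _] [/negP].
- by move=> [/negP + _ _] [].
- move=> [_ hL E1] [_ _ E1'].
  by rewrite (IHw _ _ _ _ _ _ _ (Vab _ hL sv2 h2) (sk _ _ kw) (sk _ _ kw') G1w G1w' E1 E1').
- by move=> [_ hL _] [_ /negP].
- by move=> [/negP + _ _] [].
- by move=> [_ /negP + _] [_].
move=> [_ _ [d cr E1]] [_ _ [d' cr' E1']].
rewrite (crossing_unique V nh cr' cr) in E1'.
by rewrite (IHw _ _ _ _ _ _ _ (undo_glue V cr) (sk _ _ kw) (sk _ _ kw') G1w G1w' E1 E1').
Qed.

(** * The initial state: undoing the closure *)

Lemma initial_valid : bridgeless N -> valid (edge root) (opp root).
Proof.
move=> no_bridge.
have c0 : opp_closed (set0 : {set D}) by move=> d; rewrite !inE.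
have e0 : set0 :|: edge root = edge root by rewrite set0U.
have r0 : root \notin (set0 : {set D}) by rewrite inE.
have edgeT d : d \in edge root -> d \notin T.
  by rewrite in_edge => /orP[]/eqP-> //; rewrite T_oppE.
have stL d : nonroot d -> st d \notin edge root.
  by move=> nd; apply: contraTN (tc_st_tree C nd); apply: edgeT.
have cE : opp_closed (edge root) by rewrite -e0; apply: opp_closedU.
split=> //.
- by rewrite in_edge eqxx.
- by rewrite in_edge eqxx orbT.
- by move=> d nd; rewrite (negbTE (stL d nd)).
- by rewrite /active; have [//|/stL->] := boolP (anc _ root).
- move=> l _; rewrite in_edge => /orP[]/eqP->; first exact: (tc_root C).
  exact: (anc_refl C).
(* The tree joins the ends of the root-edge, so its two sides lie in different faces of [N], and the
   cut merges these. *)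
- move=> l _; rewrite in_edge => /orP[]/eqP-> //.
  rewrite (fconnect_sym (cut_face_inj vrot_inj oppK cE)) -e0.
  apply: fconnect_swap (cut_face_swap oppK c0 r0) _; first exact: (cut_face_inj vrot_inj oppK c0).
  apply: (sides_disconnected vrot_inj oppK opp_neq planar connected0 c0 r0).
  rewrite e0 (cut_rel_sym vrot_inj oppK cE).
  by apply: connect_up => [|y _]; [exact: (tc_root C)|exact: stL].
(* Without its stem, [u] is still joined to the root, so some half-edge leaves its subtree. It is
   external by [stem_crossing], and it is not on the root-edge, both ends of which are outside. *)
- move=> u nu _ nur; case: (boolP [exists d, [&& d \notin edge root, d \notin T, anc u d
      & ~~ anc u (opp d)]]) => [/existsP[d /and4P[]]|]; first by exists d.
  move=> /existsPn noex; case/negP: (nu).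
  have : exists2 x, vertex x = root_vertex N & anc u x.
    apply: (connect_ind (P := fun W => exists2 x, vertex x = W & anc u x) _ _
             (no_bridge (st u) u root)); first by exists u; rewrite ?(anc_refl C).
    move=> W W' [x xW ux] /existsP[e /and3P[eE /eqP eW /eqP eW']].
    exists (opp e) => //; have ue : anc u e.
      by rewrite -(anc_svr vrot_inj C _ (_ : sv x e)) // -vertex_eq // xW eW.
    apply/negPn/negP=> nue; have [eT|eT] := boolP (e \in T).
      have [_ ee] := stem_crossing eT ue nue.
      by move: eE; rewrite in_setC in_edge ee eqxx.
    have := noex e; rewrite eT ue nue !andbT negbK in_edge => /orP[]/eqP er.
      by rewrite er (negbTE nu) in ue.
    by rewrite er (negbTE nur) in ue.
  case=> x /eqP; rewrite vertex_eq // => xr ux.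
  by rewrite -(anc_svr vrot_inj C _ xr).
Qed.

(** Together with [iso_of_emb]: an isomorphism from the closed map onto [N] is the same as an
    embedding into the initial state. *)
Lemma emb_of_iso w (G : growing_map) ancG stG (f : dart G -> D) : @forward w G ancG stG ->
  is_leg (root_dart G) -> injective f -> (forall d : dart G, f (vrot d) = vrot (f d)) ->
  (forall d : dart G, f (@opp (glue (root_dart G)) d) = opp (f d)) -> f (root_dart G) = root ->
  (forall d : dart G, (f d \in T) = (d \in tree G)) -> emb (edge root) (opp root) f.
Proof.
move=> Fw lr f_inj f_vrot f_opp f_root f_tree.
have fh : f (head_leg G) = opp root.
  rewrite -f_root -f_opp (glue_oppE (root_dart G) (root_dart G)).
  by rewrite eq_sym (negbTE (fw_head_root Fw)) eqxx.
have edgeE (d : dart G) : (f d \in edge root) = (d == root_dart G) || (d == head_leg G).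
  by rewrite in_edge -fh -f_root !(inj_eq f_inj).
split=> //.
- move=> d; rewrite /cut_opp edgeE.
  have [->|dr] := eqVneq d (root_dart G); first by rewrite (eqP lr).
  have [->|dh] := eqVneq d (head_leg G); first by rewrite (head_opp Fw).
  rewrite -f_opp (glue_oppE (root_dart G) (root_dart G)).
  by rewrite (negbTE dh) (negbTE dr).
- move=> d; rewrite f_tree edgeE; have [dT|//] := boolP (d \in tree G).
  have ld := fw_tree Fw dT.
  have -> : (d == root_dart G) = false by apply: contraNF ld => /eqP->.
  by have -> : (d == head_leg G) = false by apply: contraNF ld => /eqP->; apply: (fw_head Fw).
Qed.

Lemma iso_of_emb w (G : growing_map) ancG stG (f : dart G -> D) : @forward w G ancG stG ->
  emb (edge root) (opp root) f -> suffix_kreweras w ->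
  tour_legs G = [:: root_dart G] /\ tree_map_iso (glue (root_dart G)) N.
Proof.
move=> Fw E kw.
have edgeE (d : dart G) : (f d \in edge root) = (d == root_dart G) || (d == head_leg G).
  by rewrite in_edge -(em_head E) -(em_root E) !(inj_eq (em_inj E)).
have edgeT d : d \in edge root -> d \notin T.
  by rewrite in_edge => /orP[]/eqP-> //; rewrite T_oppE.
have stL d : nonroot d -> st d \notin edge root.
  by move=> nd; apply: contraTN (tc_st_tree C nd); apply: edgeT.
have cE : opp_closed (edge root).
  by rewrite -(set0U (edge root)); apply: opp_closedU => // d; rewrite !inE.
split.
  have tourE z : z \in tour_legs G -> z = root_dart G.
    rewrite mem_tour (em_leg E) edgeE => /and3P[+ zh _]; rewrite (negbTE zh) orbF.
    by move/eqP.
  have := fw_root Fw; rewrite kw => -[F [B [tG _ _]]].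
  have := uniq_tour G; rewrite tG in tourE *.
  case: F tourE {tG} => [|x' F] tourE /=; last first.
    by rewrite (tourE x') ?mem_head // mem_cat mem_head orbT.
  by case: B tourE => // y' B tourE; rewrite (tourE y') ?inE ?eqxx ?orbT.
exists f; split.
- apply: (inj_card_bij (em_inj E)); rewrite -(card_codom (em_inj E)).
  apply: subset_leq_card; apply/subsetP=> y _.
  have [||d <-] := em_surj E cE _ (_ : active (edge root) y); last exact: codom_f.
    by move=> d nd; rewrite (negbTE (stL d nd)).
  by rewrite /active; have [//|/stL->] := boolP (anc y root).
- exact: (em_vrot E).
- move=> d; rewrite (glue_oppE (root_dart G) (root_dart G)).
  have [->|dh] := eqVneq d (head_leg G).
    by rewrite (em_root E) (em_head E) oppK.
  have [->|dr] := eqVneq d (root_dart G); first by rewrite (em_root E) (em_head E).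
  by rewrite (em_opp E) /cut_opp edgeE (negbTE dh) (negbTE dr).
- exact: (em_root E).
- move=> d; rewrite [d \in _](em_tree E); case: (boolP (f d \in T)) => // fT.
  by apply/esym; apply: contraTN fT; apply: edgeT.
Qed.

End Undo.

(** * Kreweras walks and rooted depth-maps *)

Lemma kreweras_excursion w : kreweras w -> excursion w.
Proof.
case/krewerasE=> kw ta tb; apply/excursionE; split; last by rewrite ta tb; lia.
exact: suffix_kreweras_exc.
Qed.

Lemma kreweras_size w n : kreweras w -> size w = 3 * n -> nc w = n.
Proof. by case/krewerasE=> _ ta tb; rewrite size_word ta tb; lia. Qed.

Lemma kreweras_Phi w : kreweras w -> exists G anc st,
  [/\ phi_word w init_map = Some G, @forward w G anc st, tour_legs G = [:: root_dart G]
    & Phi w = Some (@MarkedMap (glue (root_dart G)) [set head_leg G; root_dart G])].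
Proof.
move=> kw; have [G [anc [st [s [Gw Fw tG sr]]]]] := excursion_Phi (kreweras_excursion kw).
have e : s = root_dart G by apply/sr.
by subst s; exists G, anc, st; split=> //; apply: PhiE.
Qed.

Theorem mainTheorem11 :
  (forall w : word, excursion w ->
     exists M : marked_map,
       [/\ Phi w = Some M,
           near_cubic2 M,
           marked_depth_map M
         & marked_edge M = root_edge M <-> kreweras w])
  /\
  (forall n : nat,
     [/\ (forall w : word, kreweras w -> size w = 3 * n ->
            exists M : marked_map,
              [/\ Phi w = Some M,
                  marked_edge M = root_edge M
                & [/\ depth_map M, near_cubic2 M, bridgeless M & map_size M n]]),
         (forall (w w' : word) (M M' : marked_map),
            kreweras w -> size w = 3 * n -> Phi w = Some M ->
            kreweras w' -> size w' = 3 * n -> Phi w' = Some M' ->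
            tree_map_iso M M' -> w = w')
       & (forall N : tree_map,
            [/\ depth_map N, near_cubic2 N, bridgeless N & map_size N n] ->
            exists (w : word) (M : marked_map),
              [/\ kreweras w, size w = 3 * n, Phi w = Some M & tree_map_iso M N])]).
Proof.
split=> [w /excursion_Phi[G [anc [st [s [Gw Fw tG sr]]]]]|n].
  exists (@MarkedMap (glue s) [set head_leg G; s]); split.
  - exact: PhiE.
  - exact: (closed_near_cubic Fw _).
  - exact: (closed_marked Fw tG).
  - exact: (iff_trans (closed_root_edge Fw s) sr).
split.
- move=> w kw sw; have [G [anc [st [Gw Fw tG Pw]]]] := kreweras_Phi kw.
  eexists; split; first exact: Pw.
    by apply/(closed_root_edge Fw).
  split; [exact: (closed_depth Fw tG)|exact: (closed_near_cubic Fw _)| |].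
    exact: (closed_bridgeless Fw tG erefl).
  by rewrite /map_size (closed_edges Fw tG) (kreweras_size kw sw).
- move=> w w' M M' kw sw Pw kw' sw' Pw'.
  have [G [anc [st [Gw Fw tG]]]] := kreweras_Phi kw; rewrite Pw => -[->] {M Pw}.
  have [G' [anc' [st' [Gw' Fw' tG']]]] := kreweras_Phi kw'; rewrite Pw' => -[->] {M' Pw'}.
  case=> f [f_bij f_vrot f_opp f_root f_tree].
  have leg_root w0 G0 anc0 st0 : @forward w0 G0 anc0 st0 -> tour_legs G0 = [:: root_dart G0] ->
      is_leg (root_dart G0).
    move=> _ t0; have : root_dart G0 \in tour_legs G0 by rewrite t0 mem_head.
    by rewrite mem_tour => /and3P[].
  have [[vinj [oppK noleg] _ planar] [_ _ root_ext]] := closed_depth Fw' tG'.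
  have cert := closed_cert Fw' tG'; have cubic := closed_near_cubic Fw' (root_dart G').
  have comp := closed_comp Fw' tG'.
  have V := initial_valid vinj oppK noleg cert planar root_ext (closed_bridgeless Fw' tG' erefl).
  (* The second closed map serves as ambient map: [G] embeds by the isomorphism, [G'] by the
     identity. *)
  pose N := glue (root_dart G').
  have E : emb (N := N) (G := G) (edge (root_dart N)) (opp (root_dart N)) f.
    exact: (emb_of_iso (N := N) Fw (leg_root _ _ _ _ Fw tG) (bij_inj f_bij)).
  have E' : emb (N := N) (G := G') (edge (root_dart N)) (opp (root_dart N)) id.
    exact: (emb_of_iso (N := N) Fw' (leg_root _ _ _ _ Fw' tG')).
  case/krewerasE: kw => kw _ _; case/krewerasE: kw' => kw' _ _.
  exact: (word_unique vinj oppK noleg cert planar cubic root_ext comp V kw kw' Gw Gw' E E').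
- move=> N [[[vinj [oppK noleg] con planar] [span ext root_ext]] cubic no_bridge sz].
  have cert := spanning_tree_cert vinj oppK span.
  have comp d : d \notin tree N -> stem_anc d (opp d) || stem_anc (opp d) d.
    by move=> /ext[]/(ancestorP vinj oppK cert)->; rewrite ?orbT.
  have V := initial_valid vinj oppK noleg cert planar root_ext no_bridge.
  have [w [G [ancG [stG [f [kw Gw Fw E]]]]]] :=
    exists_word vinj oppK noleg cert planar cubic root_ext comp V.
  have [tG iso] := iso_of_emb vinj oppK noleg cert root_ext Fw E kw.
  have kreww : kreweras w.
    apply/krewerasE; have := fw_root Fw; rewrite kw tG => -[[|? F] [B [eB sF sB]]].
      by case: eB sF sB => <- /= <- <-.
    by case: F eB {sF}.
  exists w, (@MarkedMap (glue (root_dart G)) [set head_leg G; root_dart G]).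
  split=> //; last exact: PhiE.
  (* Comparing the numbers of half-edges, [2 (3n + 1)] in [N] and [2 + 3 (na w + nb w)] in [G],
     gives the length of the word. *)
  have [g [g_bij _ _ _ _]] := iso; have := bij_eq_card g_bij.
  rewrite (card_edges oppK noleg) sz size_word => eD.
  have {}eD : #|dart G| = (3 * n + 1) * 2 := eD.
  by move: eD; rewrite (fw_darts Fw); case/krewerasE: kreww => _ -> ->; lia.
Qed.
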